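(* Let $0<q<1$, $X\in\{B,C\}$, and let $\omega\in\Omega$ be such that $\Psi_\omega(q^{c(X)_i})>0$ for every $i\ge1$ and the Taylor expansion $\Phi_\omega(x)=\sum_{n\ge0}\varphi_\omega(n)x^n$ converges in an annulus (centered at $0$) containing $q^X_i=(q^{c(X)_i}+q^{-c(X)_i})/2$ for every $i\ge1$. For each $N\ge1$ let $(Q^{\chi_{\omega,N}}_t)_{t\ge0}$ be the Markov semigroup on $\mathbb{S}_N^+$ with generator $\mathbb{L}_{\chi_{\omega,N}}$. Then there exists a unique Markov semigroup $(Q^{\chi_\omega}_t)_{t\ge0}$ on $\mathfrak{Y}$ such that $$Q^{\chi_\omega}_t\,{}_q\Lambda^\infty_N={}_q\Lambda^\infty_N\,Q^{\chi_{\omega,N}}_t\qquad\text{for all }N\ge1,\ t\ge0 .$$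
   Context: $\epsilon(B)=1/2$, $\epsilon(C)=1$, $c(X)_i=i-1+\epsilon(X)$ for $i\ge1$. $\mathbb{S}_N^+=\{\lambda\in\mathbb{Z}^N:\lambda_1\ge\dots\ge\lambda_N\ge0\}$. For $\lambda\in\mathbb{S}_N^+$, $f^{X_N}_\lambda$ is the Laurent polynomial $$f^{X_N}_\lambda(z_1,\dots,z_N)=\frac{\det\Big[\frac{z_j^{\lambda_i+c(X)_{N-i+1}}-z_j^{-\lambda_i-c(X)_{N-i+1}}}{z_j^{\epsilon(X)}-z_j^{-\epsilon(X)}}\Big]_{i,j=1}^N}{\prod_{1\le i<j\le N}(z_i+z_i^{-1}-z_j-z_j^{-1})},$$ and $g^{X_N}_\lambda(z_1,\dots,z_N)=f^{X_N}_\lambda(q^{c(X)_1}z_1,\dots,q^{c(X)_N}z_N)/f^{X_N}_\lambda(q^{c(X)_1},\dots,q^{c(X)_N})$ on $\mathbb{T}^N$. For $N\ge2$ the stochastic matrix ${}_q\Lambda^N_{N-1}$ on $\mathbb{S}_N^+\times\mathbb{S}_{N-1}^+$ is defined by $g^{X_N}_\lambda(z_1,\dots,z_{N-1},1)=\sum_{\mu\in\mathbb{S}_{N-1}^+}{}_q\Lambda^N_{N-1}(\lambda,\mu)g^{X_{N-1}}_\mu(z_1,\dots,z_{N-1})$. $\varprojlim_N(\mathcal{M}_p(\mathbb{S}_N^+),{}_q\Lambda^N_{N-1})$ is the set of sequences $(m_N)_{N\ge1}$ of probability measures $m_N$ on $\mathbb{S}_N^+$ with $\sum_\lambda m_N(\lambda){}_q\Lambda^N_{N-1}(\lambda,\mu)=m_{N-1}(\mu)$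 for all $N\ge2$, $\mu\in\mathbb{S}^+_{N-1}$, with the topology of componentwise weak convergence. $\mathfrak{Y}=\{(y_1,y_2,\dots)\in\mathbb{Z}_{\ge0}^\infty:0\le y_1\le y_2\le\cdots\}$ with the topology of componentwise convergence, and $\mathcal{M}_p(\mathfrak{Y})$ is the set of Borel probability measures on $\mathfrak{Y}$ with the weak topology. There are Markov kernels ${}_q\Lambda^\infty_N$ from $\mathfrak{Y}$ to $\mathbb{S}_N^+$ ($N\ge1$) such that $P\mapsto(P\,{}_q\Lambda^\infty_N)_{N\ge1}$ is a homeomorphism from $\mathcal{M}_p(\mathfrak{Y})$ onto $\varprojlim_N(\mathcal{M}_p(\mathbb{S}_N^+),{}_q\Lambda^N_{N-1})$ (for each $y$, $({}_q\Lambda^\infty_N(y,\cdot))_N$ is the extreme coherent system labelled by $y$); these kernels are fixed. $\Omega$ is the set of $\omega=(\alpha,\beta,\gamma)\in\mathbb{R}_{\ge0}^\infty\times\mathbb{R}_{\ge0}^\infty\times\mathbb{R}_{\ge0}$ with $\alpha_1\ge\alpha_2\ge\cdots$, $\beta_1\ge\beta_2\ge\cdots$, $\beta_1\le1$ and $\sum_i(\alpha_i+\beta_i)<\infty$. For $\omega\in\Omega$, $$\Phi_\omega(x)=e^{\gamma(x-1)}\prod_{i=1}^\infty\frac{1+\beta_i(1-\frac{\beta_i}{2})(x-1)}{1-\alpha_i(1+\frac{\alpha_i}{2})(x-1)},\qquad\Psi_\omega(z)=\Phi_\omega\Big(\frac{z+z^{-1}}2\Big).$$ The generator is $$\mathbb{L}_{\chi_{\omega,N}}(\lambda,\mu)=\frac{f^{X_N}_\mu(q^{c(X)_1},\dots,q^{c(X)_N})}{f^{X_N}_\lambda(q^{c(X)_1},\dots,q^{c(X)_N})}\cdot\frac{\det\Big[\oint_{|z|=1}\Psi_\omega(z)(z^{l_i}-z^{-l_i})\overline{(z^{m_j}-z^{-m_j})}\frac{dz}{2\pi\mathrm{i}z}\Big]_{i,j=1}^N}{2^N\prod_{j=1}^N\Psi_\omega(q^{c(X)_j})}-\delta_{\lambda,\mu},$$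 with $l_i=\lambda_i+c(X)_{N-i+1}$, $m_i=\mu_i+c(X)_{N-i+1}$; $\mathbb{L}_{\chi_{\omega,N}}+I$ is a stochastic matrix and $Q^{\chi_{\omega,N}}_t=\exp(t\,\mathbb{L}_{\chi_{\omega,N}})$. A Markov semigroup on $\mathfrak{Y}$ is a family of Markov (Borel probability) kernels $(Q_t)_{t\ge0}$ on $\mathfrak{Y}$ with $Q_0=\mathrm{id}$, $Q_sQ_t=Q_{s+t}$; products denote composition of kernels. *)

(* Defs.v *)
From HB Require Import structures.
From mathcomp Require Import all_boot all_order all_algebra.
From mathcomp Require Import complex.
From mathcomp Require Import all_classical all_reals all_analysis.
From mathcomp Require Import showcase.summability.

Set Implicit Arguments.
Unset Strict Implicit.
Unset Printing Implicit Defensive.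

Import Order.TTheory GRing.Theory Num.Theory.
Import numFieldNormedType.Exports.

Local Open Scope classical_set_scope.
Local Open Scope ring_scope.
Local Open Scope complex_scope.

HB.instance Definition _ (R : rcfType) := NormedModule.copy R[i] R[i]^o.

Section Signatures.
Variable N : nat.

Record signature := Signature {
  sigval :> N.-tuple nat;
  _ : sorted geq sigval
}.

HB.instance Definition _ := [isSub for sigval].
HB.instance Definition _ := [Countable of signature by <:].

Fact sorted_nseq0 : sorted geq (nseq_tuple N 0%N).
Proof.
rewrite sorted_pairwise; last by move=> x y z /= yx /leq_trans; apply.
by apply/(pairwiseP 0%N) => i j; rewrite !inE size_nseq => iN jN _;
  rewrite !nth_nseq iN jN.
Qed.

HB.instance Definition _ := isPointed.Build signature (Signature sorted_nseq0).
HB.instance Definition _ := hasNbhs.Build signature principal_filter.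
HB.instance Definition _ := Discrete_ofNbhs.Build signature erefl.

End Signatures.

Section PathSpace.

Definition nondecreasing_paths : set {ptws nat -> nat} :=
  [set y | forall i j, (i <= j)%N -> (y i <= y j)%N].

Definition pathspace : Type := set_type nondecreasing_paths.

HB.instance Definition _ := Topological.on pathspace.

Fact nondecreasing_paths0 : (fun=> 0%N) \in nondecreasing_paths.
Proof. by apply/mem_set => i j. Qed.

HB.instance Definition _ :=
  isPointed.Build pathspace (exist _ (fun=> 0%N) nondecreasing_paths0).

End PathSpace.

Definition borel (T : ptopologicalType) : Type := g_sigma_algebraType (@open T).
HB.instance Definition _ (T : ptopologicalType) :=
  Measurable.copy (borel T) (g_sigma_algebraType (@open T)).

Section BorelProbabilities.
Context (R : realType) (T : ptopologicalType).

Definition Mp : Type := probability (borel T) R.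

HB.instance Definition _ := gen_eqMixin Mp.
HB.instance Definition _ := gen_choiceMixin Mp.

Definition bounded_continuous : Type :=
  {h : T -> R | continuous h /\ exists M, forall x, `|h x| <= M}.

Definition expectations (P : Mp) : {ptws bounded_continuous -> R} :=
  fun h => (\int[P : probability (borel T) R]_x (sval h x))%R.

HB.instance Definition _ :=
  Topological.copy Mp (initial_topology expectations).

End BorelProbabilities.

Section Kernels.
Local Open Scope ereal_scope.
Context d d' (X : measurableType d) (Y : measurableType d') (R : realType).
Variables (P : probability X R) (k : R.-pker X ~> Y).

Definition kpush (A : set Y) : \bar R := \int[P]_x k x A.

Let kpush0 : kpush set0 = 0.
Proof. by rewrite /kpush integral0_eq// => x _; rewrite measure0. Qed.

Let kpush_ge0 A : 0 <= kpush A. Proof. exact: integral_ge0. Qed.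

Let kpush_sigma_additive : semi_sigma_additive kpush.
Proof.
move=> U mU tU mUU; rewrite [X in _ --> X](_ : _ =
  \int[P]_x (\sum_(n <oo) k x (U n))); last first.
  apply: eq_integral => x _.
  by apply/esym/cvg_lim => //; exact/measure_semi_sigma_additive.
apply/cvg_closeP; split.
  by apply: is_cvg_nneseries => n _ _; exact: integral_ge0.
rewrite closeE// integral_nneseries// => n; exact: measurable_kernel.
Qed.

HB.instance Definition _ := isMeasure.Build _ _ R kpush
  kpush0 kpush_ge0 kpush_sigma_additive.

Let kpushT : kpush [set: Y] = 1.
Proof.
rewrite /kpush (eq_integral (cst 1)) => [|x _]; last exact: prob_kernel.
by rewrite integral_cst// mul1e; exact: probability_setT.
Qed.

HB.instance Definition _ := Measure_isProbability.Build _ _ R kpush kpushT.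

End Kernels.

Definition pushMp (R : realType) (T U : ptopologicalType)
  (P : Mp R T) (k : R.-pker borel T ~> borel U) : Mp R U :=
  kpush (P : probability (borel T) R) k.

Inductive root_type := TypeB | TypeC.

Section Functions.
Variables (R : realType) (X : root_type).
Local Notation C := R[i].

(* Twice the half-integers epsilon(X) and c(X)_i, i >= 1. *)
Definition dbl_eps : nat := if X is TypeB then 1 else 2.
Definition dbl_c (i : nat) : nat := (i.-1).*2 + dbl_eps.

Definition cX (i : nat) : R := (dbl_c i)%:R / 2.

(* z^(k/2). The branch of the square root is immaterial: the exponents that
   occur in one expression have the same parity, and these powers are only used
   in quotients x / y and products x * conj y of two such expressions. *)
Definition hpow (z : C) (k : int) : C := sqrtC z ^ k.

(* 2 (lambda_i + c(X)_(N-i+1)); the index i is counted from 0. *)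
Definition dbl_shift N (lam : signature N) (i : 'I_N) : nat :=
  (tnth lam i).*2 + dbl_c (N - i).

(* The quotient formula of the Laurent polynomial f. It is only evaluated at
   points with z_j = q^(c(X)_j) u_j, |u_j| = 1, where no denominator vanishes. *)
Definition fX N (lam : signature N) (z : 'I_N -> C) : C :=
  \det (\matrix_(i < N, j < N)
    ((hpow (z j) (dbl_shift lam i) - hpow (z j) (- (dbl_shift lam i)%:Z))
     / (hpow (z j) dbl_eps - hpow (z j) (- dbl_eps%:Z))))
  / \prod_(i < N) \prod_(j < N | (i < j)%N)
      (z i + (z i)^-1 - z j - (z j)^-1).

Variable q : R.

Definition qcX (i : nat) : C := (q `^ cX i)%:C.

Definition fX_qc N (lam : signature N) : C := fX lam (fun j => qcX j.+1).

Definition gX N (lam : signature N) (z : 'I_N -> C) : C :=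
  fX lam (fun j => qcX j.+1 * z j) / fX_qc lam.

(* (z_1, ..., z_(N-1), 1) *)
Definition extend1 N (z : 'I_N -> C) (j : 'I_N.+1) : C :=
  oapp z 1 (unlift ord_max j).

(* The N-th matrix of the family goes from S_(N+2) to S_(N+1). The sum over mu
   is unordered. *)
Definition is_link
    (Lam : forall N, signature N.+2 -> signature N.+1 -> R) : Prop :=
  forall N (lam : signature N.+2),
  [/\ forall mu, 0 <= Lam N lam mu,
      \esum_(mu in [set: signature N.+1]) (Lam N lam mu)%:E = 1%E
    & forall z : 'I_N.+1 -> C, (forall j, `|z j| = 1) ->
      partial_sum (fun mu => (Lam N lam mu)%:C * gX mu z) @ totally
        --> gX lam (extend1 z)].

(* Sequences are indexed from 0. *)
Record Omega := MkOmega {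
  alpha : nat -> R;
  beta : nat -> R;
  gamma : R;
  alpha_ge0 : forall n, 0 <= alpha n;
  beta_ge0 : forall n, 0 <= beta n;
  gamma_ge0 : 0 <= gamma;
  alpha_noninc : forall n, alpha n.+1 <= alpha n;
  beta_noninc : forall n, beta n.+1 <= beta n;
  beta_le1 : beta 0 <= 1;
  summable_omega : cvgn (series (fun n => alpha n + beta n))
}.

Variable w : Omega.

Definition cexp (z : C) : C :=
  Complex (expR (complex.Re z) * cos (complex.Im z))
          (expR (complex.Re z) * sin (complex.Im z)).

Definition Phi (x : C) : C :=
  cexp ((gamma w)%:C * (x - 1)) *
  limn (fun n : nat => \prod_(i < n)
    ((1 + (beta w i * (1 - beta w i / 2))%:C * (x - 1)) /
     (1 - (alpha w i * (1 + alpha w i / 2))%:C * (x - 1)))).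

Definition Psi (z : C) : C := Phi ((z + z^-1) / 2).

Definition taylor_coef (n : nat) : C := derive1n n Phi 0 / n`!%:R.

Definition qX (i : nat) : R := (q `^ cX i + q `^ (- cX i)) / 2.

Definition taylor_annulus : Prop :=
  exists (r : R) (rho : \bar R),
  [/\ 0 <= r, forall i, (0 < i)%N -> r < qX i /\ ((qX i)%:E < rho)%E
    & forall x : C, r < complex.Re `|x| -> ((complex.Re `|x|)%:E < rho)%E ->
      series (fun n => taylor_coef n * x ^+ n) @ \oo --> Phi x].

(* The integral of F(z) dz / (2 pi i z) over |z| = 1. *)
Definition contour_int (F : C -> C) : C :=
  Complex
    ((2 * pi)^-1 * \int[lebesgue_measure]_(t in `[0, 2 * pi])
        complex.Re (F (Complex (cos t) (sin t))))
    ((2 * pi)^-1 * \int[lebesgue_measure]_(t in `[0, 2 * pi])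
        complex.Im (F (Complex (cos t) (sin t)))).

(* The complex expression is real; the projection only changes its type. *)
Definition generator N (lam mu : signature N) : R :=
  complex.Re
    (fX_qc mu / fX_qc lam *
     (\det (\matrix_(i < N, j < N) contour_int (fun z =>
        let l := dbl_shift lam i in
        let m := dbl_shift mu j in
        Psi z * (hpow z l - hpow z (- l%:Z))
              * (hpow z m - hpow z (- m%:Z))^*))
      / (2 ^+ N * \prod_(j < N) Psi (qcX j.+1))))
  - (lam == mu)%:R.

End Functions.

Section MatrixExponential.
Variables (R : realType) (I : choiceType).

Fixpoint mpow (L : I -> I -> R) (n : nat) : I -> I -> R :=
  if n is n'.+1 then fun i k => sum (fun j : I => mpow L n' i j * L j k)
  else fun i k => (i == k)%:R.

Definition mexp (L : I -> I -> R) (t : R) (i k : I) : R :=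
  limn (series (fun n => t ^+ n / n`!%:R * mpow L n i k)).

End MatrixExponential.

Section Boundary.
Variable R : realType.

(* Records of type probability may differ on nonmeasurable sets. *)
Definition eq_measure (T : ptopologicalType) (P P' : Mp R T) : Prop :=
  forall A : set (borel T), measurable A ->
    (P : probability (borel T) R) A = (P' : probability (borel T) R) A.

Definition mass (T : ptopologicalType) (P : Mp R T) (x : T) : \bar R :=
  (P : probability (borel T) R) [set x].

Variable Lam : forall N, signature N.+2 -> signature N.+1 -> R.

Definition coherent (m : forall N, Mp R (signature N.+1)) : Prop :=
  forall N (mu : signature N.+1),
  (\esum_(lam in [set: signature N.+2])
     (mass (m N.+1) lam * (Lam lam mu)%:E) = mass (m N) mu)%E.

Variable K : forall N, R.-pker borel pathspace ~> borel (signature N.+1).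

Definition boundary_map (P : Mp R pathspace) :
    prod_topology (fun N => Mp R (signature N.+1)) :=
  fun N => pushMp P (K N).

(* boundary_map is a homeomorphism onto the set of coherent sequences with the
   topology induced by the product, measures being identified by eq_measure. *)
Definition is_boundary : Prop :=
  [/\ forall P, coherent (boundary_map P),
      forall m, coherent m ->
        exists P, forall N, eq_measure (boundary_map P N) (m N),
      forall P P',
        (forall N, eq_measure (boundary_map P N) (boundary_map P' N)) ->
        eq_measure P P',
      continuous boundary_map
    & forall P (U : set (Mp R pathspace)), nbhs P U ->
        exists2 V, nbhs (boundary_map P) V & boundary_map @^-1` V `<=` U].

Definition markov_semigroup
    (Q : R -> R.-pker borel pathspace ~> borel pathspace) : Prop :=
  (forall y (A : set (borel pathspace)), measurable A -> Q 0 y A = \d_y A) /\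
  (forall s t, 0 <= s -> 0 <= t ->
   forall y (A : set (borel pathspace)), measurable A ->
     Q (s + t) y A = (\int[Q s y]_x Q t x A)%E).

(* Q_t K_N = K_N exp(t L_N), tested on the points of the countable target. *)
Definition intertwines
    (L : forall N, signature N.+1 -> signature N.+1 -> R)
    (Q : R -> R.-pker borel pathspace ~> borel pathspace) : Prop :=
  forall N t, 0 <= t -> forall y (mu : signature N.+1),
    (\int[Q t y]_x K N x [set mu] =
     \int[K N y]_lam (mexp (@L N) t lam mu)%:E)%E.

End Boundary.

(* Main.v *)
From HB Require Import structures.
Require Import Defs.
From mathcomp Require Import all_boot all_order all_algebra all_fingroup.
From mathcomp Require Import complex finmap.
From mathcomp Require Import all_classical all_reals all_analysis.
From mathcomp Require Import measurable_realfun showcase.summability.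
From mathcomp Require cyclic separable cyclotomic.
From mathcomp Require Import ring lra zify.

(** Let q^X_i = (q^(c_i) + q^-(c_i)) / 2. These points are unbounded, so the
    Taylor series of Phi represents it outside a disc. Then no alpha can be
    positive: multiplied by its denominators, Phi would have to vanish at a pole,
    where the numerators are at least 1 ([entire_alpha_eq0]). Hence Phi is entire
    and is a limit of polynomials P(x), products of factors 1 + b (x - 1) with
    0 <= b <= 1/2.

    Multiplication of the functions z^l - z^-l by 1 + b ((z + 1/z)/2 - 1) is a
    nonnegative tridiagonal matrix, which is totally nonnegative because it
    factors into nonnegative bidiagonal ones ([jacobi_totally_nonnegative]). By
    the Cauchy-Binet formula, the minors of the product of these matrices are
    nonnegative and are the coefficients of P(x_1) ... P(x_N) f_lambda in the
    f_mu ([steps_det]). The contour integrals of the generator are limits of the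
    entries of such products, so that T = L + 1 is an entrywise limit of
    stochastic matrices of finite range ([generatorE], [range_transition_cvg]).
    No mass is lost in the limit: f_lambda at the principal point of q^2, divided
    by f_lambda at that of q, is up to a factor harmonic for these matrices, and it
    grows at infinity ([range_transition_growth]). So T is stochastic.

    The matrices T of levels N + 1 and N commute with the link: both orders give
    the expansion in the g_kappa of the product of g_lambda (z, 1) with the
    normalized multiplier, whose factor at the variable 1 is trivial
    ([range_commutation], [jump_commutation]). The coefficients of such an
    expansion, an infinite series on the torus, are recovered by averages over
    finite subgroups of the torus. They are bounded uniformly in the function
    g_mu, by a rearrangement inequality for the exponents in the determinants,
    and so may be interchanged with the series ([torus_average_bounded]).

    The exponential of t (T - 1) is the mixture of the powers of T with Poisson
    weights ([mexp_poisson]). Therefore it is a semigroup of stochastic matrices,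
    and it commutes with the links.

    It remains to lift to the boundary ([boundary_semigroup]). For y in the path
    space, the laws K_N(y) exp (t L_N) form a coherent sequence, so they come from
    one probability Q_t(y). The map y -> Q_t(y) is weakly continuous, since the
    boundary map is a homeomorphism onto its image and the evolution preserves
    bounded functions on the discrete levels. Weak continuity gives the
    measurability of the probabilities of clopen cylinders, which generate the
    Borel sets. The semigroup property and uniqueness follow because a measure on
    the boundary is determined by its images on the levels. *)

Set Implicit Arguments.
Unset Strict Implicit.
Unset Printing Implicit Defensive.

Import Order.TTheory GRing.Theory Num.Theory.
Import numFieldNormedType.Exports.

Local Open Scope ring_scope.

(** * Minors of products and total nonnegativity *)

Definition strictly_decreasing N (f : 'I_N -> nat) : bool :=
  [forall i : 'I_N, forall j : 'I_N, (i < j)%N ==> (f j < f i)%N].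

Lemma strictly_decreasingP N (f : 'I_N -> nat) :
  reflect (forall i j : 'I_N, (i < j)%N -> (f j < f i)%N)
    (strictly_decreasing f).
Proof.
apply: (iffP forallP) => [h i j ij|h i]; last first.
  by apply/forallP => j; apply/implyP; exact: h.
by move: (h i) => /forallP/(_ j)/implyP; apply.
Qed.

Lemma strictly_decreasing_inj N (f : 'I_N -> nat) :
  strictly_decreasing f -> injective f.
Proof.
move=> /strictly_decreasingP h i j fij; apply: val_inj.
have [/h|/h|//] := ltngtP i j; by rewrite fij ltnn.
Qed.

Lemma strictly_decreasing_lift N (f : 'I_N.+1 -> nat) :
  strictly_decreasing f -> strictly_decreasing (fun i => f (lift ord0 i)).
Proof.
by move=> /strictly_decreasingP h; apply/strictly_decreasingP => i j ij; apply: h.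
Qed.

(** Exactly one permutation sorts an injective sequence. Written as a sum, this
    lets a sum over injective maps be regrouped by their sorted versions. *)
Lemma sum_sorting_perm (V : nmodType) N (f : 'I_N -> nat) (x : V) :
  injective f ->
  \sum_(s : {perm 'I_N} | strictly_decreasing (fun i => f (s i))) x = x.
Proof.
move=> finj.
(* The permutation sorting f is the inverse of its rank function. *)
pose rk i := #|[set j | (f i < f j)%N]|.
have rk_mono i j : (f i < f j)%N -> (rk j < rk i)%N.
  move=> ij; apply: proper_card; apply/properP; split.
    by apply/fintype.subsetP => k; rewrite !inE; exact: ltn_trans.
  by exists j; rewrite !inE ?ltnn.
have rk_lt i : (rk i < N)%N.
  rewrite -[X in (_ < X)%N]card_ord -cardsT; apply: proper_card.
  apply/properP; split; first exact: finset.subsetT.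
  by exists i; rewrite !inE ?ltnn.
pose r i := Ordinal (rk_lt i).
have rinj : injective r.
  move=> i j /(congr1 val) /= rij; apply: finj.
  by have [/rk_mono|/rk_mono|//] := ltngtP (f i) (f j); rewrite rij ltnn.
rewrite (big_pred1 (perm rinj)^-1%g) // => s /=; apply/idP/eqP => [sd|->].
  apply/permP => i; apply: (@perm_inj _ (perm rinj)); rewrite permKV permE.
  apply: val_inj => /=; rewrite /rk.
  rewrite -(card_imset _ (@perm_inj _ s^-1%g)).
  rewrite (_ : _ @: _ = [set k : 'I_N | (k < i)%N]).
    rewrite -sum1_card (eq_bigl (fun k : 'I_N => (k < i)%N)); last first.
      by move=> k; rewrite inE.
    by rewrite (big_ord_narrow (ltnW (ltn_ord i))) sum_nat_const card_ord muln1.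
  apply/setP => k; rewrite inE; move/strictly_decreasingP: sd => sd.
  apply/imsetP/idP => [[j]|ki].
    rewrite inE => ij ->; rewrite ltnNge; apply/negP; rewrite leq_eqVlt.
    case/orP => [/eqP/val_inj|/sd].
      by move=> e; move: ij; rewrite e permKV ltnn.
    by rewrite permKV => /ltnW; rewrite leqNgt ij.
  by exists (s k); rewrite ?permK // inE; exact: sd.
apply/strictly_decreasingP => i j ij; rewrite ltnNge leq_eqVlt.
apply/negP => /orP[/eqP/finj/perm_inj e|/rk_mono].
  by move: ij; rewrite e ltnn.
have E k : rk ((perm rinj)^-1%g k) = k.
  by rewrite -[RHS](congr1 val (permKV (perm rinj) k)) permE.
by rewrite !E ltnNge (ltnW ij).
Qed.

(** Expand the determinant over all maps: those with a repeated value give a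
    determinant with two equal rows, the others are permutations of sorted ones. *)
Lemma Cauchy_Binet (R : comNzRingType) N n (A : 'M[R]_(N, n)) (B : 'M[R]_(n, N)) :
  \det (A *m B) =
  \sum_(g : {ffun 'I_N -> 'I_n} | strictly_decreasing (fun i => g i))
     \det (colsub g A) * \det (rowsub g B).
Proof.
have -> : \det (A *m B) =
    \sum_(f : {ffun 'I_N -> 'I_n}) (\prod_i A i (f i)) * \det (rowsub f B).
  rewrite /determinant; under eq_bigr => s _.
    under eq_bigr => i _ do rewrite mxE.
    rewrite bigA_distr_bigA mulr_sumr /=.
    under eq_bigr => f _ do rewrite big_split mulrCA.
    over.
  rewrite exchange_big; apply: eq_bigr => f _; rewrite mulr_sumr.
  apply: eq_bigr => s _; congr (_ * (_ * _)).
  by apply: eq_bigr => i _; rewrite mxE.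
pose G (f : {ffun 'I_N -> 'I_n}) := (\prod_i A i (f i)) * \det (rowsub f B).
rewrite -/(G _).
transitivity (\sum_(f : {ffun 'I_N -> 'I_n})
   \sum_(s : {perm 'I_N} | strictly_decreasing (fun i => f (s i))) G f).
  apply: eq_bigr => f _; have [/injectiveP finj|] := boolP (injectiveb f).
    rewrite (@sum_sorting_perm _ _ (fun i => f i)) // => i j.
    by move/val_inj/finj.
  move=> fninj; have [i [j [ij fij]]] : exists i j, i != j /\ f i = f j.
    move/injectivePn: fninj => [i [j ij fij]]; by exists i, j.
  rewrite (_ : (_ * _) = 0) /G.
    by rewrite (determinant_alternate ij) ?mulr0 // ?big1 // => k; rewrite !mxE fij.
  by rewrite (determinant_alternate ij) ?mulr0 // => k; rewrite !mxE fij.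
rewrite (exchange_big_dep xpredT) //=.
transitivity (\sum_(s : {perm 'I_N}) \sum_(g : {ffun 'I_N -> 'I_n}
    | strictly_decreasing (fun i => g i)) G [ffun i => g (s^-1%g i)]).
  apply: eq_bigr => s _.
  rewrite (reindex_onto (fun g : {ffun 'I_N -> 'I_n} => [ffun i => g (s^-1%g i)])
    (fun f : {ffun 'I_N -> 'I_n} => [ffun i => f (s i)])) /=; last first.
    by move=> f _; apply/ffunP => i; rewrite !ffunE permKV.
  apply: eq_bigl => g.
  have -> : [ffun i => [ffun k => g (s^-1%g k)] (s i)] = g.
    by apply/ffunP => i; rewrite !ffunE permK.
  rewrite eqxx andbT.
  by apply: eq_forallb => i; apply: eq_forallb => j; rewrite !ffunE !permK.
rewrite exchange_big; apply: eq_bigr => g _; rewrite {1}/determinant.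
rewrite mulr_suml (reindex_inj invg_inj) /=; apply: eq_bigr => s _.
rewrite /G invgK mulrAC -mulrA; under eq_bigr => i _ do rewrite ffunE.
under [in RHS]eq_bigr => i _ do rewrite mxE.
rewrite mulrA mulrC; congr (_ * _).
rewrite (_ : rowsub _ B = perm_mx s *m rowsub g B).
  by rewrite det_mulmx det_perm mulrC.
by rewrite -row_permE; apply/matrixP => i j; rewrite !mxE ffunE.
Qed.

Definition minor (R : comNzRingType) (K : nat -> nat -> R) N (a b : 'I_N -> nat) : R :=
  \det (\matrix_(i, j) K (a i) (b j)).

Definition totally_nonnegative (R : numDomainType) (K : nat -> nat -> R) : Prop :=
  forall N (a b : 'I_N -> nat),
    strictly_decreasing a -> strictly_decreasing b -> 0 <= minor K a b.

(** In a minor of a bidiagonal kernel the first row or the first column vanishes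
    off its first entry, so the minor is a product of entries. *)
Lemma totally_nonnegative_bidiagonal (R : numDomainType) (K : nat -> nat -> R) :
  (forall i j, 0 <= K i j) ->
  (forall i j, K i j != 0 -> (j <= i <= j.+1)%N) ->
  totally_nonnegative K.
Proof.
move=> K0 Kb; elim=> [|N IH] a b ad bd; first by rewrite /minor det_mx00.
have Kz i j : ~~ (j <= i <= j.+1)%N -> K i j = 0.
  by move=> h; apply/eqP; apply: contraNT h; exact: Kb.
have -> : minor K a b = K (a ord0) (b ord0) *
    minor K (fun i => a (lift ord0 i)) (fun i => b (lift ord0 i)).
  have cof : cofactor (\matrix_(i, j) K (a i) (b j)) ord0 ord0 =
      minor K (fun i => a (lift ord0 i)) (fun i => b (lift ord0 i)).
    rewrite /cofactor addn0 expr0 mul1r; congr (\det _).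
    by apply/matrixP => i j; rewrite !mxE.
  move/strictly_decreasingP: ad => ad; move/strictly_decreasingP: bd => bd.
  have [ab|ba] := leqP (a ord0) (b ord0).
    rewrite /minor (expand_det_col _ ord0) big_ord_recl big1 => [|i _].
      by rewrite addr0 cof mxE.
    by rewrite mxE Kz ?mul0r //; have := ad ord0 (lift ord0 i) isT; lia.
  rewrite /minor (expand_det_row _ ord0) big_ord_recl big1 => [|i _].
    by rewrite addr0 cof mxE.
  by rewrite mxE Kz ?mul0r //; have := bd ord0 (lift ord0 i) isT; lia.
by rewrite mulr_ge0 // IH // strictly_decreasing_lift.
Qed.

Lemma totally_nonnegative_tr (R : numDomainType) (K : nat -> nat -> R) :
  totally_nonnegative K -> totally_nonnegative (fun i j => K j i).
Proof.
move=> h N a b ad bd; have := h N b a bd ad.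
rewrite /minor -det_tr; congr (0 <= \det _).
by apply/matrixP => i j; rewrite !mxE.
Qed.

Section BandedProducts.
Variables (R : comNzRingType) (w : nat).

Definition band (K : nat -> nat -> R) := forall i k, (i + w < k)%N -> K i k = 0.

(** The inner index stops at i + w, beyond the support of row i when the left
    factor has band width w. *)
Definition kernel_mul (K K' : nat -> nat -> R) i j :=
  \sum_(k < (i + w).+1) K i k * K' k j.

Lemma kernel_mul_widen K K' i j n : band K -> (i + w < n)%N ->
  kernel_mul K K' i j = \sum_(k < n) K i k * K' k j.
Proof.
move=> bK le_n; rewrite /kernel_mul (big_ord_widen n (fun k => K i k * K' k j)) //.
rewrite big_mkcond /=; apply: eq_bigr => k _; case: ltnP => // h.
by rewrite bK ?mul0r.
Qed.

End BandedProducts.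

(** A minor of a product is a sum of products of minors, by Cauchy-Binet. *)
Lemma totally_nonnegative_mul (R : numDomainType) w (K K' : nat -> nat -> R) :
  band w K -> totally_nonnegative K -> totally_nonnegative K' ->
  totally_nonnegative (kernel_mul w K K').
Proof.
move=> bK tK tK' N a b ad bd; pose n := (\max_i a i + w).+1.
have -> : minor (kernel_mul w K K') a b =
    \det ((\matrix_(i < N, k < n) K (a i) k) *m (\matrix_(k < n, j < N) K' k (b j))).
  congr (\det _); apply/matrixP => i j; rewrite !mxE (@kernel_mul_widen _ _ _ _ _ _ n) //.
    by apply: eq_bigr => k _; rewrite !mxE.
  by rewrite ltnS leq_add2r; exact: (leq_bigmax i).
rewrite Cauchy_Binet sumr_ge0 // => g gd; apply: mulr_ge0.
  have := tK N a (fun i => g i) ad gd; rewrite /minor; congr (0 <= \det _).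
  by apply/matrixP => i j; rewrite !mxE.
have := tK' N (fun i => g i) b gd bd; rewrite /minor; congr (0 <= \det _).
by apply/matrixP => i j; rewrite !mxE.
Qed.

(** * Tridiagonal kernels *)

Section Jacobi.
Variable R : fieldType.
Variables d0 d h : R.

Definition jacobi (i j : nat) : R :=
  if i == j then if i == 0%N then d0 else d
  else if (j == i.+1) || (i == j.+1) then h else 0.

(** The pivots of Gaussian elimination on the tridiagonal kernel. *)
Fixpoint pivot (i : nat) : R := if i is i'.+1 then d - h ^+ 2 / pivot i' else d0.

Definition jacobi_lower (i k : nat) : R :=
  if k == i then 1 else if k.+1 == i then h / pivot k else 0.

Definition jacobi_upper (k j : nat) : R :=
  if k == j then pivot k else if k.+1 == j then h else 0.

Lemma jacobi_band : band 1 jacobi.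
Proof.
move=> i k; rewrite /jacobi => ik.
by do 2![case: eqP => [?|_]; first by lia]; rewrite /=; case: eqP => [?|_]; first by lia.
Qed.

Lemma jacobi_LU : (forall i, pivot i != 0) ->
  forall i j, jacobi i j = kernel_mul 1 jacobi_lower jacobi_upper i j.
Proof.
move=> p0 i j; rewrite /kernel_mul addn1 2!big_ord_recr /=.
rewrite {3}/jacobi_lower (gtn_eqF (ltnSn i)) (gtn_eqF (ltnW (ltnSn i.+1))) mul0r addr0.
rewrite {2}/jacobi_lower eqxx mul1r; case: i => [|i].
  rewrite big_ord0 add0r /jacobi /jacobi_upper /= orbF.
  by rewrite eq_sym; case: eqP => // _; rewrite eq_sym; case: j => [|[|j]].
rewrite big_ord_recr /= big1 ?add0r => [|k _]; last first.
  rewrite /jacobi_lower (ltn_eqF (leqW (ltn_ord k))) eqSS (ltn_eqF (ltn_ord k)).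
  by rewrite mul0r.
have nE (m k : nat) : m <> k -> (m == k) = false by move/eqP/negPf.
rewrite /jacobi_lower (nE i i.+1) ?eqxx; last by lia.
rewrite /jacobi_upper /jacobi; have [->|ji] := eqVneq j i.
  rewrite (nE i.+1 i) ?(nE i.+2 i) ?(nE i i.+2) ?eqxx /=; try lia.
  by rewrite addr0 divfK.
have [ji1|ji1] := eqVneq j i.+1.
  by rewrite mulrAC -expr2 addrC subrK.
rewrite ?(nE i.+1 j) ?(nE i.+1 j.+1) ?mulr0 ?add0r ?orbF; try lia.
by rewrite eq_sym.
Qed.

End Jacobi.

(** The pivots stay at least h when 2 h <= d, so that both bidiagonal factors of
    the elimination are nonnegative. *)
Lemma jacobi_totally_nonnegative (R : realFieldType) (d0 d h : R) :
  0 <= h -> 0 < d0 -> h <= d0 -> 0 < d -> 2 * h <= d ->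
  totally_nonnegative (jacobi d0 d h).
Proof.
move=> h0 d0_gt0 hd0 d_gt0 hd.
have piv i : 0 < pivot d0 d h i /\ h <= pivot d0 d h i.
  elim: i => [//|i [p0 hp]] /=.
  have le_h : h ^+ 2 / pivot d0 d h i <= h.
    by rewrite ler_pdivrMr // expr2 ler_wpM2l.
  split; last by lra.
  have [->|hn0] := eqVneq h 0; first by rewrite expr0n /= mul0r subr0.
  have : 0 < h by rewrite lt_def hn0.
  lra.
have piv0 i := lt0r_neq0 (proj1 (piv i)).
have LU := jacobi_LU piv0.
have bL : band 1 (jacobi_lower d0 d h).
  move=> i k; rewrite /jacobi_lower => ik.
  by do 2![case: eqP => [?|_]; first by lia].
have tL : totally_nonnegative (jacobi_lower d0 d h).
  apply: totally_nonnegative_bidiagonal => i j; rewrite /jacobi_lower.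
    case: eqP => _ //; case: eqP => _ //.
    by rewrite divr_ge0 // ltW //; have [] := piv j.
  by case: (j =P i) => [->|_]; [lia|case: (_ =P i) => [<-|_]; [lia|rewrite eqxx]].
have tU : totally_nonnegative (jacobi_upper d0 d h).
  apply: (@totally_nonnegative_tr _ (fun i j => jacobi_upper d0 d h j i)).
  apply: totally_nonnegative_bidiagonal => i j; rewrite /jacobi_upper.
    by case: eqP => _; [rewrite ltW //; have [] := piv j|case: eqP].
  by case: (j =P i) => [->|_]; [lia|case: (j.+1 =P i) => [<-|_]; [lia|rewrite eqxx]].
have tLU := totally_nonnegative_mul bL tL tU.
move=> N a b ad bd; have := tLU N a b ad bd; congr (0 <= \det _).
by apply/matrixP => i j; rewrite !mxE LU.
Qed.

(** * Multiplication operators on odd Laurent polynomials *)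

Section OddLaurent.
Variable (F : fieldType) (e : nat).

(** The basis z^l - z^-l with l = a + e/2, in terms of v, where v^2 = z. *)
Definition odd_laurent (v : F) (a : nat) : F := v ^+ (a.*2 + e) - v ^- (a.*2 + e).

Definition two_cosh (v : F) : F := v ^+ 2 + v ^- 2.

Lemma odd_laurentS v a : v != 0 ->
  two_cosh v * odd_laurent v a.+1 = odd_laurent v a.+2 + odd_laurent v a.
Proof.
move=> v0; rewrite /two_cosh /odd_laurent.
have -> : (a.+2.*2 + e = (a.*2 + e) + 2 + 2)%N by lia.
have -> : (a.+1.*2 + e = (a.*2 + e) + 2)%N by lia.
by rewrite !exprD; field; rewrite !expf_neq0.
Qed.

(** The recurrence at 0 involves the index -1, where the basis function is minus
    the one of index 0 if e = 1, and zero if e = 2. *)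
Definition corner : F := if e == 1%N then -1 else 0.

Lemma odd_laurent0 v : v != 0 -> (e == 1%N) || (e == 2%N) ->
  two_cosh v * odd_laurent v 0 = odd_laurent v 1 + corner * odd_laurent v 0.
Proof.
by move=> v0 /orP[] /eqP e12; rewrite /two_cosh /odd_laurent /corner e12 /=; field.
Qed.

(** The matrix of multiplication by 1 + b (x - 1), with x = (z + 1/z) / 2. *)
Definition step (b : F) : nat -> nat -> F :=
  jacobi (1 - b + corner * (b / 2)) (1 - b) (b / 2).

Definition steps (bs : seq F) : nat -> nat -> F :=
  foldr (fun b K => kernel_mul 1 (step b) K) (fun i j => (i == j)%:R) bs.

Definition steps_poly (bs : seq F) (x : F) : F := \prod_(b <- bs) (1 + b * (x - 1)).

Lemma steps_band bs : band (size bs) (steps bs).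
Proof.
elim: bs => [|b bs IH] i k /=; first by rewrite addn0 => /ltn_eqF->.
move=> ik; rewrite /kernel_mul big1 // => j _.
by rewrite IH ?mulr0 //; have := ltn_ord j; lia.
Qed.

Hypothesis char0 : 2%:R != 0 :> F.

Lemma step_odd_laurent v b a n : v != 0 -> (e == 1%N) || (e == 2%N) -> (a + 1 < n)%N ->
  \sum_(k < n) step b a k * odd_laurent v k =
  (1 + b * (two_cosh v / 2 - 1)) * odd_laurent v a.
Proof.
move=> v0 e12 an.
have := @kernel_mul_widen F 1 (step b) (fun k _ => odd_laurent v k) a 0 n.
move=> <- //; last exact: jacobi_band.
rewrite /kernel_mul addn1 2!big_ord_recr /=; case: a {an} => [|a].
  rewrite big_ord0 add0r /step /jacobi /=.
  have := odd_laurent0 v0 e12.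
  move: (two_cosh v) (odd_laurent v 0) (odd_laurent v 1) corner => X s0 s1 c E.
  have -> : s1 = X * s0 - c * s0 by rewrite E addrK.
  by field.
rewrite big_ord_recr /= big1 ?add0r => [|k _]; last first.
  rewrite /step /jacobi (gtn_eqF (leqW (ltn_ord k))) (ltn_eqF (leqW (leqW (ltn_ord k)))).
  by rewrite /= eqSS (gtn_eqF (ltn_ord k)) mul0r.
rewrite /step /jacobi eqxx (gtn_eqF (ltnSn a)) (ltn_eqF (ltnSn a.+1)) eqxx orbT /=.
have := odd_laurentS a v0.
move: (two_cosh v) (odd_laurent v a) (odd_laurent v a.+1) (odd_laurent v a.+2) => X s0 s1 s2 E.
have -> : s2 = X * s1 - s0 by rewrite E addrK.
by field.
Qed.

Lemma steps_odd_laurent v bs a n : v != 0 -> (e == 1%N) || (e == 2%N) ->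
  (a + size bs < n)%N ->
  \sum_(k < n) steps bs a k * odd_laurent v k =
  steps_poly bs (two_cosh v / 2) * odd_laurent v a.
Proof.
move=> v0 e12; elim: bs a n => [|b bs IH] a n /=.
  rewrite addn0 => an; rewrite /steps_poly big_nil mul1r (bigD1 (Ordinal an)) //=.
  rewrite eqxx mul1r big1 ?addr0 // => k; rewrite -val_eqE /= eq_sym => /negPf ->.
  by rewrite mul0r.
move=> an; under eq_bigr => k _ do rewrite /kernel_mul mulr_suml.
rewrite exchange_big /= /steps_poly big_cons -mulrA mulrCA.
rewrite -(@step_odd_laurent v b a (a + 1).+1) // mulr_sumr; apply: eq_bigr => k _.
under eq_bigr => j _ do rewrite -mulrA.
rewrite -mulr_sumr IH; last by have := ltn_ord k; lia.
by rewrite mulrCA.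
Qed.

(** Multiplication by a symmetric function of the squares in an expansion over
    determinants: the Cauchy-Binet formula applied to the product of the matrix
    of the multiplication operator with the evaluation matrix. *)
Lemma steps_det N (v : 'I_N -> F) bs (a : 'I_N -> nat) n :
  (forall j, v j != 0) -> (e == 1%N) || (e == 2%N) ->
  (forall i, (a i + size bs < n)%N) ->
  (\prod_j steps_poly bs (two_cosh (v j) / 2)) *
    \det (\matrix_(i, j) odd_laurent (v j) (a i)) =
  \sum_(g : {ffun 'I_N -> 'I_n} | strictly_decreasing (fun i => g i))
     minor (steps bs) a (fun i => g i) * \det (\matrix_(i, j) odd_laurent (v j) (g i)).
Proof.
move=> v0 e12 an.
pose A := \matrix_(i < N, k < n) steps bs (a i) k.
pose B := \matrix_(k < n, j < N) odd_laurent (v j) k.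
rewrite (eq_bigr (fun g : {ffun 'I_N -> 'I_n} => \det (colsub g A) * \det (rowsub g B))).
  rewrite -Cauchy_Binet; set D := \matrix_(i, j) _.
  pose dv : 'rV[F]_N := \row_j steps_poly bs (two_cosh (v j) / 2).
  have -> : A *m B = D *m diag_mx dv.
    rewrite mul_mx_diag; apply/matrixP => i j; rewrite !mxE mulrC -(@steps_odd_laurent _ _ _ n) //.
    by apply: eq_bigr => k _; rewrite !mxE.
  rewrite det_mulmx det_diag mulrC; congr (_ * _).
  by apply: eq_bigr => j _; rewrite mxE.
move=> g _; rewrite /minor; congr (_ * _); congr determinant.
  by apply/matrixP => i j; rewrite !mxE.
by apply/matrixP => i j; rewrite !mxE.
Qed.

End OddLaurent.

(** For b <= 1/2 the diagonal of each tridiagonal factor dominates the sum of the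
    two entries next to it. *)
Lemma steps_totally_nonnegative (R : realFieldType) e (bs : seq R) :
  {in bs, forall b, 0 <= b <= 2^-1} -> totally_nonnegative (steps e bs).
Proof.
elim: bs => [|b bs IH] bsP /=.
  apply: totally_nonnegative_bidiagonal => i j; first exact: ler0n.
  by case: (i =P j) => [->|_]; [lia|rewrite eqxx].
apply: totally_nonnegative_mul; first exact: jacobi_band.
  have /andP[b0 b1] := bsP b (mem_head _ _).
  by apply: jacobi_totally_nonnegative; rewrite /corner; case: (e == 1%N); lra.
by apply: IH => c cbs; apply: bsP; rewrite inE cbs orbT.
Qed.

(** * The Weyl denominator *)

Lemma card_ord_gt N (i : 'I_N) : #|[pred j : 'I_N | (i < j)%N]| = (N - i.+1)%N.
Proof.
apply/eqP; rewrite -(eqn_add2r #|[predC [pred j : 'I_N | (i < j)%N]]|) cardC card_ord.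
apply/eqP; rewrite -sum1_card (eq_bigl (fun j : 'I_N => (j < i.+1)%N)); last first.
  by move=> j; rewrite !inE -leqNgt.
rewrite (big_ord_narrow (ltn_ord i)) sum_nat_const card_ord muln1 subnK //.
Qed.

Section Weyl.
Variable F : fieldType.
Variable e : nat.
Hypothesis e12 : (e == 1%N) || (e == 2%N).

(** The quotient of odd_laurent v n by odd_laurent v 0 as a polynomial in
    v^2 + v^-2, a variant of the Chebyshev polynomials. These polynomials are
    monic, hence a unitriangular change of basis leads to a Vandermonde matrix. *)
Fixpoint weyl_poly (n : nat) : {poly F} :=
  if n is n'.+1 then
    if n' is n''.+1 then 'X * weyl_poly n' - weyl_poly n'' else 'X - (corner F e)%:P
  else 1.

Lemma weyl_poly_monic n :
  size (weyl_poly n) = n.+1 /\ weyl_poly n \is monic.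
Proof.
have step (p p' : {poly F}) k : size p = k.+2 -> p \is monic -> (size p' <= k.+1)%N ->
    size ('X * p - p') = k.+3 /\ 'X * p - p' \is monic.
  move=> sp mp sp'; have sXp : size ('X * p) = k.+3.
    by rewrite mulrC size_mulX ?sp // monic_neq0.
  have lt_s : (size (- p')%R < size ('X * p)%R)%N by rewrite sXp size_polyN ltnS; apply: leq_trans sp' _; rewrite leqW.
  split; first by rewrite size_polyDl.
  by rewrite monicE lead_coefDl // mulrC lead_coefMX (monicP mp).
suff: (size (weyl_poly n) = n.+1 /\ weyl_poly n \is monic) /\
    (size (weyl_poly n.+1) = n.+2 /\ weyl_poly n.+1 \is monic) by case.
elim: n => [|n [IH0 IH1]].
  by split; [rewrite /= size_poly1 monic1|rewrite /= size_XsubC monicXsubC].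
split; first exact: IH1.
by case: IH1 => s1 m1; case: IH0 => s0 _; apply: step; rewrite ?s0.
Qed.

Lemma odd_laurent_weyl v n : v != 0 ->
  odd_laurent e v n = odd_laurent e v 0 * (weyl_poly n).[two_cosh v].
Proof.
move=> v0.
suff: odd_laurent e v n = odd_laurent e v 0 * (weyl_poly n).[two_cosh v] /\
   odd_laurent e v n.+1 = odd_laurent e v 0 * (weyl_poly n.+1).[two_cosh v] by case.
elim: n => [|n [IH0 IH1]].
  split; first by rewrite /= hornerC mulr1.
  by rewrite /= !hornerE mulrBr mulrC odd_laurent0 // [_ * corner F e]mulrC addrK.
split=> //; rewrite [weyl_poly _]/= -/(weyl_poly n.+1) hornerD hornerN hornerM hornerX.
by rewrite mulrBr -IH0 mulrCA -IH1 odd_laurentS // addrK.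
Qed.

Lemma weyl_det N (w : 'I_N -> F) : (forall i, w i != 0) ->
  \det (\matrix_(i, j) odd_laurent e (w j) i) =
  (\prod_i odd_laurent e (w i) 0) *
  \prod_(i < N) \prod_(j < N | (i < j)%N) (two_cosh (w j) - two_cosh (w i)).
Proof.
move=> w0; pose A := \matrix_(i < N, k < N) (weyl_poly i)`_k.
pose X : 'rV[F]_N := \row_j two_cosh (w j).
pose d : 'rV[F]_N := \row_j odd_laurent e (w j) 0.
have -> : \matrix_(i, j) odd_laurent e (w j) i = A *m Vandermonde N X *m diag_mx d.
  rewrite mul_mx_diag; apply/matrixP => i j; rewrite !mxE odd_laurent_weyl // mulrC.
  congr (_ * _); rewrite (@horner_coef_wide _ N) ?(proj1 (weyl_poly_monic i)) //.
  by apply: eq_bigr => k _; rewrite !mxE.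
rewrite !det_mulmx det_diag det_Vandermonde det_trig; last first.
  apply/is_trig_mxP => i k ik; rewrite mxE nth_default //.
  by rewrite (proj1 (weyl_poly_monic i)).
rewrite big1 ?mul1r => [|i _]; last first.
  rewrite mxE; have [s m] := weyl_poly_monic i.
  by move/monicP: m; rewrite lead_coefE s.
rewrite mulrC; congr (_ * _); first by apply: eq_bigr => i _; rewrite mxE.
by apply: eq_bigr => i _; apply: eq_bigr => j _; rewrite !mxE.
Qed.

(** The node v with v^2 = q^(k + e/2), when p^4 = q. *)
Definition node (p : F) (k : nat) : F := p ^+ (k.*2 + e).

(** This exchange of labels and nodes turns the value of a determinant at the
    principal point into a Weyl denominator in the labels. *)
Lemma odd_laurent_node p k a :
  odd_laurent e (node p k) a = odd_laurent e (node p a) k.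
Proof. by rewrite /odd_laurent /node -!exprM mulnC. Qed.

(** Up to a sign that does not depend on a, the determinant with labels a at the
    nodes 0, ..., N - 1; all factors are positive when a is decreasing. *)
Definition weyl_product (p : F) N (a : 'I_N -> nat) : F :=
  (\prod_i - odd_laurent e (node p (a i)) 0) *
  \prod_(i < N) \prod_(j < N | (i < j)%N)
     (two_cosh (node p (a i)) - two_cosh (node p (a j))).

Definition weyl_sign N : F :=
  (\prod_(i < N) (-1)) * \prod_(i < N) \prod_(j < N | (i < j)%N) (-1).

Lemma weyl_sign_neq0 N : weyl_sign N != 0.
Proof.
rewrite mulf_neq0 //; first by rewrite prodf_seq_neq0; apply/allP => i _; rewrite oppr_eq0 oner_eq0.
rewrite prodf_seq_neq0; apply/allP => i _ /=; rewrite prodf_seq_neq0.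
by apply/allP => j _; rewrite oppr_eq0 oner_eq0 implybT.
Qed.

Lemma weyl_productE p N (a : 'I_N -> nat) : p != 0 ->
  \det (\matrix_(i, j) odd_laurent e (node p j) (a i)) =
  weyl_sign N * weyl_product p a.
Proof.
move=> p0; rewrite -det_tr.
have -> : (\matrix_(i, j) odd_laurent e (node p j) (a i))^T =
    \matrix_(i < N, j < N) odd_laurent e (node p (a j)) i.
  by apply/matrixP => i j; rewrite !mxE odd_laurent_node.
rewrite weyl_det => [|i]; last by rewrite expf_neq0.
rewrite /weyl_sign /weyl_product mulrACA; congr (_ * _); rewrite -big_split /=.
  by apply: eq_bigr => i _; rewrite mulN1r opprK.
apply: eq_bigr => i _; rewrite -big_split /=.
by apply: eq_bigr => j _; rewrite mulN1r opprB.
Qed.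

(** With p^2 in place of p, every factor y - y' of the product is multiplied by
    y + y'. *)
Definition weyl_growth (p : F) N (a : 'I_N -> nat) : F :=
  (\prod_i (node p (a i) ^+ e + node p (a i) ^- e)) *
  \prod_(i < N) \prod_(j < N | (i < j)%N)
     (two_cosh (node p (a i)) + two_cosh (node p (a j))).

Lemma weyl_product_sqr p N (a : 'I_N -> nat) : p != 0 ->
  weyl_product (p ^+ 2) a = weyl_product p a * weyl_growth p a.
Proof.
move=> p0; have n0 k : node p k != 0 by rewrite expf_neq0.
have nodeX k : node (p ^+ 2) k = node p k ^+ 2 by rewrite /node -!exprM mulnC.
rewrite /weyl_product /weyl_growth mulrACA; congr (_ * _); rewrite -big_split /=.
  apply: eq_bigr => i _; rewrite nodeX /odd_laurent double0 add0n -exprM mulnC exprM.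
  have := expf_neq0 e (n0 (a i)); move: (node p (a i) ^+ e) => y y0.
  by field.
apply: eq_bigr => i _; rewrite -big_split /=.
apply: eq_bigr => j _; rewrite !nodeX /two_cosh.
by field; rewrite !n0.
Qed.

End Weyl.

Section Positivity.
Variables (R : numFieldType) (e : nat) (p : R).
Hypothesis e12 : (e == 1%N) || (e == 2%N).
Hypothesis p01 : 0 < p < 1.

Let p0 : 0 < p. Proof. by case/andP: p01. Qed.
Let p1 : p < 1. Proof. by case/andP: p01. Qed.

Let exp_le n m : (m <= n)%N -> p ^+ n <= p ^+ m.
Proof. by move=> ?; rewrite ler_wiXn2l // ltW. Qed.

Let expN_le n m : (m <= n)%N -> p ^- m <= p ^- n.
Proof. by move=> mn; rewrite lef_pV2 ?posrE ?exprn_gt0 // exp_le. Qed.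

Let le_p n : (0 < n)%N -> p ^+ n <= p.
Proof. by move=> n0; rewrite -[leRHS]expr1 exp_le. Qed.

(** The exponent of the dominant monomial of the Weyl product. *)
Definition weyl_exponent N (a : 'I_N -> nat) : nat :=
  \sum_(i < N) ((N - i.+1).*2 + e) * ((a i).*2 + e).

Lemma odd_laurent_node_ge k :
  (1 - p) * p ^- (e * (k.*2 + e)) <= - odd_laurent e (node e p k) 0.
Proof.
rewrite /odd_laurent /node double0 add0n opprB -exprM mulnC mulrBl mul1r.
rewrite lerD2l lerN2 ler_pdivlMr ?exprn_gt0 // -exprD le_p //.
by case/orP: e12 => /eqP ->; lia.
Qed.

Lemma two_cosh_node_ge k l : (l < k)%N ->
  (1 - p) ^+ 2 * p ^- ((k.*2 + e).*2) <=
  two_cosh (node e p k) - two_cosh (node e p l).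
Proof.
move=> lk; have pn n : p ^+ n != 0 by rewrite expf_neq0 // lt0r_neq0.
have -> : two_cosh (node e p k) - two_cosh (node e p l) =
   (1 - p ^+ ((k - l).*2.*2)) * (1 - p ^+ ((k + l + e).*2.*2)) * p ^- ((k.*2 + e).*2).
  have kE : ((k.*2 + e) = (k - l).*2 + (l.*2 + e))%N by lia.
  have sE : ((k + l + e) = (k - l) + (l.*2 + e))%N by lia.
  rewrite /two_cosh /node sE kE -!muln2 !mulnDl !exprD !exprM.
  have := pn (k - l)%N; have := pn l; have := pn e.
  move: (p ^+ (k - l)) (p ^+ l) (p ^+ e) => x y z z0 y0 x0.
  by field; rewrite x0 y0 z0.
apply: ler_pM => //; rewrite ?sqr_ge0 ?invr_ge0 ?exprn_ge0 // ?(ltW p0) //.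
  by rewrite subr_ge0 ltW.
rewrite expr2; apply: ler_pM; rewrite ?subr_ge0 ?(ltW p1) //.
  by rewrite lerD2l lerN2 le_p //; lia.
rewrite lerD2l lerN2 le_p //; lia.
Qed.

Lemma odd_laurent_node_gt0 k : 0 < - odd_laurent e (node e p k) 0.
Proof.
apply: lt_le_trans (odd_laurent_node_ge k).
by rewrite divr_gt0 ?exprn_gt0 // subr_gt0.
Qed.

Lemma two_cosh_node_lt k l : (l < k)%N -> two_cosh (node e p l) < two_cosh (node e p k).
Proof.
move=> /two_cosh_node_ge h; rewrite -subr_gt0; apply: lt_le_trans h.
by rewrite divr_gt0 ?exprn_gt0 // subr_gt0.
Qed.

Lemma weyl_product_gt0 N (a : 'I_N -> nat) : strictly_decreasing a ->
  0 < weyl_product e p a.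
Proof.
move=> /strictly_decreasingP ad; rewrite mulr_gt0 //.
  by rewrite prodr_gt0 // => i _; exact: odd_laurent_node_gt0.
apply: prodr_gt0 => i _; apply: prodr_gt0 => j ij.
by rewrite subr_gt0 two_cosh_node_lt // ad.
Qed.

(** Every factor is at least a fixed multiple of its dominant term. *)
Lemma weyl_product_ge N : exists2 c : R, 0 < c &
  forall a : 'I_N -> nat, strictly_decreasing a ->
    c * p ^- weyl_exponent a <= weyl_product e p a.
Proof.
exists ((\prod_(i < N) (1 - p)) * \prod_(i < N) \prod_(j < N | (i < j)%N) ((1 - p) ^+ 2)).
  by rewrite mulr_gt0 // prodr_gt0 // => i _; rewrite ?prodr_gt0 // => *; rewrite ?exprn_gt0 // subr_gt0.
move=> a /strictly_decreasingP ad.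
have -> : p ^- weyl_exponent a = (\prod_(i < N) p ^- (e * ((a i).*2 + e))) *
    \prod_(i < N) \prod_(j < N | (i < j)%N) p ^- (((a i).*2 + e).*2).
  rewrite -big_split /= /weyl_exponent.
  under [in RHS]eq_bigr => i _.
    rewrite prodr_const card_ord_gt -!exprVn -exprM -exprD.
    over.
  rewrite prodrXr -exprVn; congr (_ ^+ _); apply: eq_bigr => i _.
  by rewrite -!muln2; nia.
rewrite mulrACA -2!big_split /=; apply: ler_pM.
- rewrite prodr_ge0 // => i _; rewrite divr_ge0 ?exprn_ge0 ?subr_ge0 ?(ltW p0) ?(ltW p1) //.
- rewrite prodr_ge0 // => i _; rewrite -big_split prodr_ge0 // => j _ /=.
  by rewrite divr_ge0 ?exprn_ge0 ?subr_ge0 ?(ltW p0) ?(ltW p1) //.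
- apply: ler_prod => i _; rewrite odd_laurent_node_ge andbT.
  by rewrite divr_ge0 ?exprn_ge0 ?subr_ge0 ?(ltW p0) ?(ltW p1) //.
apply: ler_prod => i _; rewrite -big_split /=; apply/andP; split.
  by rewrite prodr_ge0 // => j _ /=; rewrite divr_ge0 ?exprn_ge0 ?subr_ge0 ?(ltW p0) ?(ltW p1) //.
apply: ler_prod => j ij; rewrite two_cosh_node_ge ?ad // andbT.
by rewrite divr_ge0 ?exprn_ge0 ?subr_ge0 ?(ltW p0) ?(ltW p1) //.
Qed.

Lemma weyl_growth_ge N (a : 'I_N -> nat) i : p ^- a i <= weyl_growth e p a.
Proof.
have ge1 n : 1 <= p ^- n by rewrite -[leLHS]invr1 -(expr0 p) expN_le.
have pn n : 0 <= p ^+ n by rewrite exprn_ge0 // ltW.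
have ge2 k n : 1 <= node e p k ^+ n + node e p k ^- n.
  by rewrite /node -exprM ler_wpDl.
have pge1 (I : finType) (P : pred I) (G : I -> R) : (forall i, P i -> 1 <= G i) -> 1 <= \prod_(i | P i) G i.
  by move=> G1; elim/big_rec: _ => // k x /G1 Gk x1; rewrite -[leLHS]mulr1 ler_pM.
rewrite -[leLHS]mulr1; apply: ler_pM => //; first by rewrite invr_ge0.
  rewrite (bigD1 i) //= -[leLHS]mulr1; apply: ler_pM => //; first by rewrite invr_ge0.
    rewrite /node -exprM ler_wpDl // expN_le //.
    by case/orP: e12 => /eqP ->; lia.
  by apply: pge1 => k _; exact: ge2.
apply: (pge1) => k _; apply: (pge1) => j _; apply: (le_trans (ge2 (a k) 2%N)).
by rewrite lerDl; apply: le_trans (ge2 (a j) 2%N).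
Qed.

(** Rearrangement: pairing the largest labels with the largest nodes maximizes
    the exponent. Each unordered pair of labels contributes at most its
    maximum. *)
Lemma rearrangement_le N (a : 'I_N -> nat) (s : {perm 'I_N}) : strictly_decreasing a ->
  (\sum_(j < N) j * a (s j) <= \sum_(i < N) (N - i.+1) * a i)%N.
Proof.
move=> /strictly_decreasingP ad.
have pairs (m : 'I_N -> 'I_N -> nat) : (forall i j, m i j = m j i) ->
    (\sum_i \sum_(j | i != j) m i j = 2 * \sum_(i < N) \sum_(j < N | (i < j)%N) m i j)%N.
  move=> mC; rewrite mul2n -addnn [X in (_ + X)%N](exchange_big_dep xpredT) //= -big_split /=.
  apply: eq_bigr => i _; rewrite (bigID (fun j : 'I_N => (i < j)%N)) /=; congr (_ + _)%N.
    by apply: eq_bigl => j; rewrite -val_eqE neq_ltn; case: ltngtP.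
  rewrite (eq_bigr (fun j => m j i)) => [|j _]; last exact: mC.
  by apply: eq_bigl => j; rewrite -val_eqE neq_ltn; case: ltngtP.
pose M i j := maxn (a i) (a j).
have MC i j : M i j = M j i by rewrite /M maxnC.
have le1 : (\sum_(j < N) j * a (s j) <= \sum_(i < N) \sum_(j < N | (i < j)%N) M (s i) (s j))%N.
  rewrite (exchange_big_dep xpredT) //=; apply: leq_sum => j _.
  apply: (@leq_trans (\sum_(i < N | (i < j)%N) a (s j))); last first.
    by apply: leq_sum => i _; rewrite /M leq_maxr.
  by rewrite sum_nat_const -sum1_card (big_ord_narrow (ltnW (ltn_ord j))) sum_nat_const card_ord muln1.
have eq2 : (\sum_(i < N) \sum_(j < N | (i < j)%N) M i j = \sum_(i < N) (N - i.+1) * a i)%N.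
  apply: eq_bigr => i _; rewrite (eq_bigr (fun=> a i)) => [|j ij].
    by rewrite sum_nat_const card_ord_gt.
  by apply/maxn_idPl; rewrite ltnW // ad.
apply: leq_trans le1 _; rewrite -eq2 -(leq_pmul2l (isT : 0 < 2)%N) -!pairs //.
rewrite [leqRHS](reindex_inj (@perm_inj _ s)) /=.
apply: eq_leq; apply: eq_bigr => i _; rewrite [RHS](reindex_inj (@perm_inj _ s)) /=.
by apply: eq_bigl => j; rewrite (inj_eq perm_inj).
Qed.

(** On the torus through the nodes every odd determinant is bounded by a constant
    multiple of the Weyl product with the same labels. *)
Lemma odd_laurent_det_bound N : exists2 c : R, 0 < c &
  forall (a : 'I_N -> nat) (v : 'I_N -> R), strictly_decreasing a ->
    (forall j, `|v j| = node e p j) ->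
    `| \det (\matrix_(i, j) odd_laurent e (v j) (a i)) | <= c * weyl_product e p a.
Proof.
have [c c0 wc] := weyl_product_ge N.
exists ((N`! * 2 ^ N)%:R / c); first by rewrite divr_gt0 // ltr0n muln_gt0 fact_gt0 expn_gt0.
move=> a v ad nv.
apply: (@le_trans _ _ ((N`! * 2 ^ N)%:R * p ^- weyl_exponent a)); last first.
  by rewrite -mulrA ler_wpM2l // ler_pdivlMl // wc.
apply: (le_trans (ler_norm_sum _ _ _)).
rewrite natrM -mulrA -[in leRHS](card_Sn N) -sum1_card natr_sum mulr_suml.
apply: ler_sum => s _; rewrite normrM normrX normrN1 expr1n !mul1r normr_prod.
apply: (@le_trans _ _ (\prod_(i < N) (2 * p ^- (((s i).*2 + e) * ((a i).*2 + e))))).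
  apply: ler_prod => i _; rewrite normr_ge0 mxE /=.
  apply: (le_trans (ler_normB _ _)); rewrite normfV !normrX nv /node -!exprM.
  rewrite mulr2n mulrDl mul1r lerD2r.
  apply: (@le_trans _ _ 1); first by rewrite exprn_ile1 // ltW.
  by rewrite invf_ge1 ?exprn_gt0 // exprn_ile1 // ltW.
rewrite big_split /= prodr_const card_ord natrX ler_wpM2l ?exprn_ge0 //.
under eq_bigr => i _ do rewrite -exprVn.
rewrite prodrXr exprVn expN_le //.
rewrite /weyl_exponent.
have split4 (f : 'I_N -> nat) :
    (\sum_(i < N) ((f i).*2 + e) * ((a i).*2 + e) =
     4 * (\sum_(i < N) f i * a i) + 2 * e * (\sum_(i < N) f i) +
     \sum_(i < N) (2 * e * a i + e * e))%N.
  rewrite !big_distrr -!big_split; apply: eq_bigr => i _ /=.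
  by rewrite -!muln2; nia.
rewrite !(split4 (fun i => s i), split4 (fun i => N - i.+1)%N) leq_add2r leq_add //.
  rewrite leq_pmul2l //; apply: leq_trans (rearrangement_le s^-1%g ad).
  by rewrite (reindex_inj (@perm_inj _ s^-1%g)) /=; apply: eq_leq; apply: eq_bigr => i _; rewrite permKV.
rewrite leq_mul2l; apply/orP; right.
have <- : (\sum_(i < N) i = \sum_(i < N) s i)%N by rewrite (reindex_inj (@perm_inj _ s)).
by rewrite (reindex_inj rev_ord_inj).
Qed.

End Positivity.

Local Open Scope classical_set_scope.
Local Open Scope ring_scope.
Local Open Scope complex_scope.

(** * Complex sequences *)

Local Notation nrm := Normc.normc.

Section ComplexSequences.
Context {R : realType}.
Implicit Types (z w : R[i]) (u : nat -> R[i]).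

Lemma normC_nrm z : `|z| = (nrm z)%:C.
Proof. by []. Qed.

Lemma nrm_ge0 z : 0 <= nrm z.
Proof. by rewrite -ler0c -normC_nrm. Qed.

Lemma nrmM z w : nrm (z * w) = nrm z * nrm w.
Proof. exact: Normc.normcM. Qed.

Lemma nrmD z w : nrm (z + w) <= nrm z + nrm w.
Proof. by rewrite -lecR rmorphD /= -!normC_nrm; exact: ler_normD. Qed.

Lemma nrmN z : nrm (- z) = nrm z.
Proof. by apply: complexI; rewrite -!normC_nrm normrN. Qed.

Lemma nrmB z w : nrm (z - w) <= nrm z + nrm w.
Proof. by rewrite (le_trans (nrmD _ _)) // nrmN. Qed.

Lemma nrmBC z w : nrm (z - w) = nrm (w - z).
Proof. by rewrite -nrmN opprB. Qed.

Lemma nrmX z n : nrm (z ^+ n) = nrm z ^+ n.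
Proof. by apply: complexI; rewrite rmorphXn /= -!normC_nrm normrX. Qed.

Lemma nrm_real (x : R) : nrm x%:C = `|x|.
Proof. by rewrite /= expr0n /= addr0 sqrtr_sqr. Qed.

Lemma nrm0 : nrm 0 = 0 :> R.
Proof. exact: Normc.normc0. Qed.

Lemma nrm1 : nrm 1 = 1 :> R.
Proof. exact: Normc.normc1. Qed.

Lemma nrm_eq0 z : (nrm z == 0) = (z == 0).
Proof. by apply/eqP/eqP => [/Normc.eq0_normc //|->]; rewrite nrm0. Qed.

Lemma nrm_sum I (r : seq I) P (F : I -> R[i]) :
  nrm (\sum_(i <- r | P i) F i) <= \sum_(i <- r | P i) nrm (F i).
Proof.
elim/big_rec2: _ => [|i x y _ h]; first by rewrite nrm0.
by rewrite (le_trans (nrmD _ _)) // lerD2l.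
Qed.

Lemma nrm_prod I (r : seq I) P (F : I -> R[i]) :
  nrm (\prod_(i <- r | P i) F i) = \prod_(i <- r | P i) nrm (F i).
Proof. by elim/big_rec2: _ => [|i x y _ h]; rewrite ?nrm1 // nrmM h. Qed.

Lemma nrm_sqr (a b : R) : nrm (a +i* b)%C ^+ 2 = a ^+ 2 + b ^+ 2.
Proof. by rewrite /= sqr_sqrtr // addr_ge0 ?sqr_ge0. Qed.

Lemma Re_le_nrm z : `|complex.Re z| <= nrm z.
Proof.
case: z => a b; rewrite -(@ler_pXn2r _ 2) ?nnegrE ?nrm_ge0 //= -/(nrm (a +i* b)%C).
by rewrite nrm_sqr real_normK ?num_real // lerDl sqr_ge0.
Qed.

Lemma Im_le_nrm z : `|complex.Im z| <= nrm z.
Proof.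
case: z => a b; rewrite -(@ler_pXn2r _ 2) ?nnegrE ?nrm_ge0 //= -/(nrm (a +i* b)%C).
by rewrite nrm_sqr real_normK ?num_real // lerDr sqr_ge0.
Qed.

Lemma nrm_le_ReIm z : nrm z <= `|complex.Re z| + `|complex.Im z|.
Proof.
case: z => a b; rewrite -(@ler_pXn2r _ 2) ?nnegrE ?nrm_ge0 ?addr_ge0 //=.
rewrite -/(nrm (a +i* b)%C) nrm_sqr sqrrD !real_normK ?num_real //.
by rewrite addrAC lerDl mulrn_wge0 // mulr_ge0.
Qed.

Lemma cvgC_nrmP u z : u @ \oo --> z <->
  (forall eps : R, 0 < eps -> exists n0, forall n, (n0 <= n)%N -> nrm (u n - z) <= eps).
Proof.
split=> [uz eps eps0|h].
  have /cvgrPdist_le/(_ eps%:C) := uz; rewrite ltcR => /(_ eps0)[n0 _ hn].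
  by exists n0 => n /hn /=; rewrite normC_nrm lecR nrmBC.
apply/cvgrPdist_le => -[e1 e2]; rewrite ltcE /= => /andP[/eqP -> e0].
have [n0 hn] := h _ e0; exists n0 => // n /hn /= le_e.
by rewrite normC_nrm lecR nrmBC.
Qed.

Lemma cvgR_absP (f : nat -> R) (l : R) : f @ \oo --> l <->
  (forall eps : R, 0 < eps -> exists n0, forall n, (n0 <= n)%N -> `|f n - l| <= eps).
Proof.
split=> [/cvgrPdist_le h eps /h [n0 _ hn]|h].
  by exists n0 => n /hn /=; rewrite distrC.
by apply/cvgrPdist_le => eps /h[n0 hn]; exists n0 => // n /hn /=; rewrite distrC.
Qed.

Lemma cvgC_Re u z : u @ \oo --> z -> (@complex.Re R \o u) @ \oo --> complex.Re z.
Proof.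
move=> /cvgC_nrmP h; apply/cvgR_absP => eps /h[n0 hn]; exists n0 => n /hn.
by apply: le_trans; rewrite -raddfB; exact: Re_le_nrm.
Qed.

Lemma cvgC_ReIm u z : (@complex.Re R \o u) @ \oo --> complex.Re z ->
  (@complex.Im R \o u) @ \oo --> complex.Im z -> u @ \oo --> z.
Proof.
move=> /cvgR_absP hr /cvgR_absP hi; apply/cvgC_nrmP => eps eps0.
have e2 : 0 < eps / 2 by rewrite divr_gt0.
have [n1 h1] := hr _ e2; have [n2 h2] := hi _ e2; exists (maxn n1 n2) => n.
rewrite geq_max => /andP[/h1 k1 /h2 k2].
apply: (le_trans (nrm_le_ReIm _)); rewrite [leRHS](splitr eps) lerD //.
  by move: k1; rewrite /= -raddfB.
by move: k2; rewrite /= -raddfB.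
Qed.

Lemma cauchyC_cvg u :
  (forall eps : R, 0 < eps ->
     exists n0, forall n m, (n0 <= n)%N -> (n0 <= m)%N -> nrm (u n - u m) <= eps) ->
  cvgn u.
Proof.
move=> h.
have cR (f : R[i] -> R) : (forall z w, f (z - w) = f z - f w) ->
    (forall z, `|f z| <= nrm z) -> cvgn (f \o u).
  move=> fB fle; apply/cauchy_cvgP/cauchy_exP => eps eps0.
  have e2 : 0 < eps / 2 by rewrite divr_gt0.
  have [n0 hn] := h _ e2; exists (f (u n0)); exists n0 => // n /= n0n.
  rewrite -ball_normE /ball_ /= -fB (le_lt_trans (fle _)) //.
  by rewrite (le_lt_trans (hn _ _ _ _)) // gtr_pMr // invf_lt1 // ltr1n.
have re_cvg := cR _ (raddfB _) Re_le_nrm.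
have im_cvg := cR _ (raddfB _) Im_le_nrm.
apply/cvg_ex; exists (limn (@complex.Re R \o u) +i* limn (@complex.Im R \o u))%C.
exact: cvgC_ReIm.
Qed.

Lemma cvgCM (u v : nat -> R[i]) (y z : R[i]) :
  u @ \oo --> y -> v @ \oo --> z -> (fun n => u n * v n) @ \oo --> y * z.
Proof. by move=> h1 h2; exact: (@cvgM R[i] nat \oo _ u v y z h1 h2). Qed.
Lemma cvgCB (u v : nat -> R[i]) (y z : R[i]) :
  u @ \oo --> y -> v @ \oo --> z -> (fun n => u n - v n) @ \oo --> y - z.
Proof. by move=> h1 h2; exact: (@cvgB R[i] R[i] nat \oo _ u v y z h1 h2). Qed.
Lemma cvgCV (u : nat -> R[i]) (y : R[i]) : y != 0 ->
  u @ \oo --> y -> (fun n => (u n)^-1) @ \oo --> y^-1.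
Proof. by move=> y0 h1; exact: (@cvgV R[i] nat \oo _ u y y0 h1). Qed.

End ComplexSequences.

(** * The complex exponential as a uniform limit of polynomials *)

Section ComplexExponential.
Context {R : realType}.

Lemma sin_le_abs (x : R) : `|sin x| <= `|x|.
Proof.
wlog x0 : x / 0 <= x.
  by move=> h; have [/h //|/ltW x0] := leP 0 x; rewrite -normrN -sinN -[leRHS]normrN h // oppr_ge0.
have [|c _] := @MVT_segment R sin cos 0 x x0.
  exact/continuous_subspaceT/continuous_sin.
by rewrite sin0 !subr0 => ->; rewrite normrM ler_piMl // cos_max.
Qed.

Lemma one_sub_cos_le (x : R) : `|cos x - 1| <= x ^+ 2 / 2.
Proof.
have -> : x = (x / 2) *+ 2 by rewrite -mulr_natr divfK.
rewrite cos_mulr2n; move: (x / 2) => y.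
have -> : cos y ^+ 2 *+ 2 - 1 - 1 = - (2 * sin y ^+ 2) by rewrite cos2sin2; ring.
rewrite normrN normrM normrX ger0_norm //.
have := sin_le_abs y; rewrite -(@ler_pXn2r _ 2) ?nnegrE // => h.
rewrite (le_trans (ler_wpM2l _ h)) // real_normK ?num_real //.
by rewrite [leRHS](_ : _ = 2 * y ^+ 2) //; field.
Qed.

Lemma sin_sub_le (x : R) : `|x| <= 1 -> `|sin x - x| <= x ^+ 2 / 2.
Proof.
wlog x0 : x / 0 <= x.
  move=> h; have [/h //|/ltW x0] := leP 0 x.
  have := h (- x); rewrite oppr_ge0 normrN sinN opprK sqrrN addrC distrC.
  by move=> /(_ x0).
move=> x1.
have [|c] := @MVT_segment R (fun x => sin x - x) (fun x => cos x - 1) 0 x x0.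
  apply: continuous_subspaceT => y; apply: cvgB; [exact: continuous_sin|exact: cvg_id].
rewrite in_itv /= sin0 !subr0 => /andP[c0 cx] ->; rewrite normrM.
have le_c : `|cos c - 1| <= x ^+ 2 / 2.
  by rewrite (le_trans (one_sub_cos_le c)) // ler_pM2r // ler_pXn2r.
by rewrite -[leRHS]mulr1 ler_pM.
Qed.

Lemma expR_le_half (a : R) : `|a| <= 2^-1 -> expR a <= 2.
Proof.
move=> ha; have := expR_ge1Dx (- a); rewrite expRN => h.
have e0 := expR_gt0 a; move: ha; rewrite ler_norml => /andP[_ ha].
have : 2^-1 <= (expR a)^-1 by apply: le_trans h; lra.
by rewrite lef_pV2 ?posrE.
Qed.

Lemma expR_sub_le (a : R) : `|a| <= 2^-1 -> `|expR a - 1 - a| <= 2 * a ^+ 2.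
Proof.
move=> ha; have h1 := expR_ge1Dx a; have h2 := expR_ge1Dx (- a).
have e0 := expR_gt0 a; rewrite expRN in h2.
have h3 : (1 - a) * expR a <= 1.
  by rewrite -ler_pdivlMr // div1r.
rewrite ger0_norm; last by lra.
by move: ha; rewrite ler_norml => /andP[? ?]; nra.
Qed.

Lemma cexpD (z w : R[i]) : cexp (z + w) = cexp z * cexp w.
Proof.
rewrite /cexp !raddfD /= expRD cosD sinD; case: z w => [a b] [c d] /=.
by apply/eqP; rewrite eq_complex /=; apply/andP; split; apply/eqP; ring.
Qed.

Lemma cexpMn (z : R[i]) n : cexp (z *+ n) = cexp z ^+ n.
Proof.
elim: n => [|n IH]; last by rewrite mulrS cexpD IH exprS.
by rewrite mulr0n /cexp /= expR0 cos0 sin0 mul1r mulr0.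
Qed.

Lemma nrm_cexp (z : R[i]) : nrm (cexp z) = expR (complex.Re z).
Proof.
apply/eqP; rewrite -(@eqrXn2 _ 2) ?nrm_ge0 ?expR_ge0 // /cexp nrm_sqr.
by rewrite !exprMn -mulrDr cos2Dsin2 mulr1.
Qed.

Lemma cexp_sub_le (z : R[i]) : nrm z <= 2^-1 -> nrm (cexp z - 1 - z) <= 4 * nrm z ^+ 2.
Proof.
case: z => a b hz; have ha := le_trans (Re_le_nrm _) hz; have hb := le_trans (Im_le_nrm _) hz.
rewrite /= in ha hb; rewrite nrm_sqr (le_trans (nrm_le_ReIm _)) //=.
rewrite oppr0 addr0.
have -> : expR a * cos b - 1 - a = (expR a - 1 - a) + expR a * (cos b - 1) by ring.
have -> : expR a * sin b - b = (expR a - 1 - a) * sin b + a * sin b + (sin b - b) by ring.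
have h1 := expR_sub_le ha; have h2 := expR_le_half ha; have h3 := one_sub_cos_le b.
have h4 : `|sin b - b| <= b ^+ 2 / 2 by apply: sin_sub_le; lra.
have h5 := sin_le_abs b; have h6 := sin_max b; have e0 := expR_ge0 a.
have k1 : `|expR a * (cos b - 1)| <= b ^+ 2.
  rewrite normrM (ger0_norm e0) [leRHS](_ : _ = 2 * (b ^+ 2 / 2)); last by field.
  by rewrite ler_pM.
have k2 : `|(expR a - 1 - a) * sin b| <= a ^+ 2.
  rewrite normrM [leRHS](_ : _ = 2 * a ^+ 2 * 2^-1); last by field.
  by rewrite ler_pM // (le_trans h5).
have k3 : `|a * sin b| <= (a ^+ 2 + b ^+ 2) / 2.
  rewrite normrM (le_trans (ler_wpM2l _ h5)) //.
  rewrite -[a ^+ 2]real_normK ?num_real // -[b ^+ 2]real_normK ?num_real //.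
  have := sqr_ge0 (`|a| - `|b|); move: `|a| `|b| => x y h; nra.
have := ler_normD (expR a - 1 - a) (expR a * (cos b - 1)).
have := ler_normD ((expR a - 1 - a) * sin b + a * sin b) (sin b - b).
have := ler_normD ((expR a - 1 - a) * sin b) (a * sin b).
have := sqr_ge0 a; have := sqr_ge0 b.
lra.
Qed.

(** Two n-th powers of numbers of modulus at most exp(|z|/n), at distance
    O(1/n^2): the difference of powers telescopes into n terms. *)
Lemma cexp_limit_le (z : R[i]) n : (0 < n)%N -> 2 * nrm z <= n%:R ->
  nrm (cexp z - (1 + z / n%:R) ^+ n) <= 4 * nrm z ^+ 2 * expR (nrm z) / n%:R.
Proof.
move=> n0 hn; have n0' : 0 < n%:R :> R by rewrite ltr0n.
pose w := z / n%:R; have nw : nrm w = nrm z / n%:R.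
  rewrite /w nrmM -[n%:R](rmorph_nat (real_complex R)) -fmorphV nrm_real ger0_norm ?invr_ge0 ?ltW //.
have zE : z = w *+ n by rewrite -mulr_natr /w divfK // pnatr_eq0 -lt0n.
have hw : nrm w <= 2^-1 by rewrite nw ler_pdivrMr //; lra.
have E0 := expR_gt0 (nrm w).
have M1 : nrm (cexp w) <= expR (nrm w).
  by rewrite nrm_cexp ler_expR (le_trans (ler_norm _)) // Re_le_nrm.
have M2 : nrm (1 + w) <= expR (nrm w).
  by rewrite (le_trans (nrmD _ _)) // nrm1 expR_ge1Dx.
rewrite {1}zE cexpMn -/w subrXX nrmM.
have -> : 4 * nrm z ^+ 2 * expR (nrm z) / n%:R =
    4 * nrm w ^+ 2 * (expR (nrm z) *+ n).
  by rewrite nw -mulr_natr; field; rewrite gt_eqF.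
apply: ler_pM; rewrite ?nrm_ge0 //.
  by rewrite opprD addrA cexp_sub_le.
have -> : expR (nrm z) *+ n = \sum_(i < n) expR (nrm z) by rewrite sumr_const card_ord.
apply: (le_trans (nrm_sum _ _ _)); apply: ler_sum => i _.
rewrite nrmM !nrmX (@le_trans _ _ (expR (nrm w) ^+ (n.-1 - i) * expR (nrm w) ^+ i)) //.
  by apply: ler_pM; rewrite ?exprn_ge0 ?nrm_ge0 //; apply: lerXn2r; rewrite ?nnegrE ?nrm_ge0 ?expR_ge0.
rewrite -exprD -expRM_natl ler_expR nw mulrA ler_pdivrMr // mulrC ler_wpM2l ?nrm_ge0 //.
by rewrite ler_nat; have := ltn_ord i; lia.
Qed.

End ComplexExponential.

(** * Uniformly convergent products *)

Section UniformLimits.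
Context {R : realType}.
Variable K : set R[i].

Definition ubounded (f : nat -> R[i] -> R[i]) (B : R) :=
  forall n x, K x -> nrm (f n x) <= B.

Definition ucauchy (f : nat -> R[i] -> R[i]) :=
  forall eps : R, 0 < eps -> exists n0, forall n m x,
    (n0 <= n)%N -> (n0 <= m)%N -> K x -> nrm (f n x - f m x) <= eps.

Lemma ucauchyM f g B B' : 0 < B -> 0 < B' -> ubounded f B -> ubounded g B' ->
  ucauchy f -> ucauchy g -> ucauchy (fun n x => f n x * g n x).
Proof.
move=> B0 B0' bf bg cf cg eps eps0.
have e1 : 0 < eps / (2 * B') by rewrite divr_gt0 // mulr_gt0.
have e2 : 0 < eps / (2 * B) by rewrite divr_gt0 // mulr_gt0.
have [n1 h1] := cf _ e1; have [n2 h2] := cg _ e2; exists (maxn n1 n2) => n m x.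
rewrite !geq_max => /andP[n1n n2n] /andP[n1m n2m] Kx.
have -> : f n x * g n x - f m x * g m x =
  (f n x - f m x) * g n x + f m x * (g n x - g m x) by ring.
apply: (le_trans (nrmD _ _)); rewrite !nrmM.
have -> : eps = eps / (2 * B') * B' + B * (eps / (2 * B)).
  by field; rewrite !gt_eqF.
by rewrite lerD // ler_pM ?nrm_ge0 ?h1 ?h2 ?bf ?bg.
Qed.

Lemma ucauchyB f g : ucauchy f -> ucauchy g -> ucauchy (fun n x => f n x - g n x).
Proof.
move=> cf cg eps eps0; have e2 : 0 < eps / 2 by rewrite divr_gt0.
have [n1 h1] := cf _ e2; have [n2 h2] := cg _ e2; exists (maxn n1 n2) => n m x.
rewrite !geq_max => /andP[n1n n2n] /andP[n1m n2m] Kx.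
have -> : f n x - g n x - (f m x - g m x) = (f n x - f m x) - (g n x - g m x) by ring.
by rewrite (le_trans (nrmB _ _)) // [leRHS](splitr eps) lerD ?h1 ?h2.
Qed.

Lemma ucauchy_series f (u : nat -> R) : cvgn (series u) ->
  (forall n x, K x -> nrm (f n.+1 x - f n x) <= u n) -> ucauchy f.
Proof.
move=> cu fu.
have le_fu n k x : K x -> nrm (f (n + k)%N x - f n x) <= series u (n + k)%N - series u n.
  move=> Kx; elim: k => [|k IH]; first by rewrite addn0 !subrr nrm0.
  rewrite addnS seriesSr.
  have -> : f (n + k).+1 x - f n x = (f (n + k)%N x - f n x) + (f (n + k).+1 x - f (n + k)%N x).
    by ring.
  rewrite (le_trans (nrmD _ _)) //.
  rewrite [leRHS](_ : _ = (series u (n + k)%N - series u n) + u (n + k)%N); last by ring.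
  by rewrite lerD // fu.
have ule n m x : (n <= m)%N -> K x -> nrm (f n x - f m x) <= `|series u n - series u m|.
  move=> nm Kx; rewrite nrmBC distrC -(subnKC nm) (le_trans (le_fu _ _ _ Kx)) //.
  exact: ler_norm.
move=> eps eps0; have e2 : 0 < eps / 2 by rewrite divr_gt0.
have [n0 h0] := (cvgR_absP _ _).1 cu _ e2; exists n0 => n m x n0n n0m Kx.
have le_eps : `|series u n - series u m| <= eps.
  have -> : series u n - series u m = (series u n - limn (series u)) - (series u m - limn (series u)).
    by ring.
  by rewrite (le_trans (ler_normB _ _)) // [leRHS](splitr eps) lerD ?h0.
have [nm|/ltnW mn] := leqP n m; first exact: le_trans (ule _ _ _ nm Kx) le_eps.
by rewrite nrmBC; apply: le_trans (ule _ _ _ mn Kx) _; rewrite distrC.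
Qed.

Definition affine_prod (c : nat -> R) n (x : R[i]) : R[i] :=
  \prod_(i < n) (1 + (c i)%:C * (x - 1)).

Variables (c : nat -> R) (M : R).
Hypothesis c_summable : cvgn (series (fun i => `|c i|)).
Hypothesis KM : forall x, K x -> nrm (x - 1) <= M.
Hypothesis M0 : 0 <= M.

Definition affine_prod_bound := expR (M * limn (series (fun i => `|c i|))).

Lemma affine_prod_bounded : ubounded (affine_prod c) affine_prod_bound.
Proof.
move=> n x Kx; rewrite /affine_prod nrm_prod.
apply: (@le_trans _ _ (\prod_(i < n) expR (M * `|c i|))).
  apply: ler_prod => i _; rewrite nrm_ge0 /=; apply: (le_trans (nrmD _ _)).
  rewrite nrm1 nrmM nrm_real (le_trans _ (expR_ge1Dx _)) // lerD2l mulrC.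
  by rewrite ler_wpM2r // KM.
rewrite -expR_sum ler_expR -mulr_sumr ler_wpM2l //.
have -> : \sum_(i < n) `|c i| = series (fun i => `|c i|) n by rewrite /series /= big_mkord.
apply: nondecreasing_cvgn_le => //; apply/nondecreasing_seqP => k.
by rewrite seriesSr lerDl.
Qed.

Lemma affine_prod_ucauchy : ucauchy (affine_prod c).
Proof.
apply: (@ucauchy_series _ (fun i => affine_prod_bound * M * `|c i|)).
  rewrite (_ : series _ = fun n => affine_prod_bound * M * series (fun i => `|c i|) n).
    by apply: is_cvgMr.
  by apply/funext => n; rewrite /series /= mulr_sumr.
move=> n x Kx; rewrite /affine_prod big_ord_recr /= mulrDr mulr1 addrC addKr.
rewrite !nrmM nrm_real [(`|c n| * _)]mulrC mulrA.
rewrite ler_wpM2r // ler_pM ?nrm_ge0 ?KM //.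
exact: affine_prod_bounded.
Qed.

Lemma affine_prod_cvg x : K x -> cvgn (fun n => affine_prod c n x).
Proof.
move=> Kx; apply: cauchyC_cvg => eps /affine_prod_ucauchy[n0 h].
by exists n0 => n m *; exact: h.
Qed.

End UniformLimits.

(** * Averages over roots of unity *)

Lemma exists_primitive_root (C : numClosedFieldType) n :
  (0 < n)%N -> exists z : C, n.-primitive_root z.
Proof.
move=> n0; pose p : {poly C} := 'X^n - 1.
have [r Dp] := closed_field_poly_normal p.
rewrite (monicP (monicXnsubC _ n0)) scale1r in Dp.
have rn1 : all n.-unity_root r by apply/allP => z; rewrite -root_prod_XsubC -Dp.
have sz_r : (n < (size r).+1)%N by rewrite -(size_prod_XsubC r id) -Dp size_XnsubC.
have [|z] := hasP (cyclic.has_prim_root n0 rn1 _ sz_r); last by exists z.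
rewrite -separable.separable_prod_XsubC -Dp cyclotomic.separable_Xn_sub_1 //.
by rewrite pnatr_eq0 -lt0n.
Qed.

Lemma sum_unity_root (F : fieldType) (m : nat) (z : F) :
  z ^+ m = 1 -> z != 1 -> \sum_(j < m) z ^+ j = 0.
Proof.
move=> zm z1; apply: (@mulfI _ (z - 1)); first by rewrite subr_eq0.
by rewrite -subrX1 zm subrr mulr0.
Qed.

Lemma prim_root_unity_neq0 (F : fieldType) (m : nat) (z : F) :
  m.-primitive_root z -> z != 0.
Proof.
move=> pz; apply/eqP => z0; have := prim_expr_order pz.
by rewrite z0 expr0n (gtn_eqF (prim_order_gt0 pz)) => /esym/eqP; rewrite oner_eq0.
Qed.

Lemma sum_prim_root (F : fieldType) (m i k : nat) (z : F) :
  m.-primitive_root z -> (i < m)%N -> (k < m)%N ->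
  \sum_(j < m) z ^+ (i * j) / z ^+ (k * j) = if i == k then m%:R else 0.
Proof.
move=> pz im km; have z0 := prim_root_unity_neq0 pz.
rewrite (eq_bigr (fun j : 'I_m => (z ^+ i / z ^+ k) ^+ j)) => [|j _]; last first.
  by rewrite expr_div_n -!exprM.
have [->|ik] := eqVneq i k.
  rewrite divff ?expf_neq0 // (eq_bigr (fun=> 1)) => [|j _]; last by rewrite expr1n.
  by rewrite sumr_const card_ord.
apply: sum_unity_root.
  by rewrite expr_div_n -!exprM ![(_ * m)%N]mulnC !exprM (prim_expr_order pz) !expr1n divff ?oner_eq0.
apply: contra ik => /eqP ik1.
have : z ^+ i == z ^+ k by rewrite -[z ^+ k]mul1r -ik1 divfK ?expf_neq0.
by rewrite (eq_prim_root_expr pz) !modn_small.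
Qed.

Section WeakMaximumPrinciple.
Context {R : realType}.

(** A coefficient of a polynomial is an average of its values at roots of unity,
    so the values on a circle control those inside up to a constant that does
    not depend on the degree. *)
Lemma poly_bound_inside (p : {poly R[i]}) (s d : R) (y : R[i]) :
  0 < s -> nrm y < s -> (forall x, nrm x = s -> nrm p.[x] <= d) ->
  nrm p.[y] <= d * (1 - nrm y / s)^-1.
Proof.
move=> s0 ys hp; pose m := (size p).+1.
have [z pz] := @exists_primitive_root R[i] m isT.
have z0 := prim_root_unity_neq0 pz.
have nz : nrm z = 1.
  apply/eqP; rewrite -(@eqrXn2 _ m) ?nrm_ge0 // -nrmX (prim_expr_order pz) nrm1.
  by rewrite expr1n.
have sC : s%:C != 0 by rewrite -(rmorph0 (real_complex R)) (inj_eq (@complexI R)) gt_eqF.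
have coefE (k : 'I_(size p)) :
    p`_k * s%:C ^+ k * m%:R = \sum_(j < m) p.[s%:C * z ^+ j] / z ^+ (k * j).
  transitivity (\sum_(j < m) \sum_(i < size p)
      p`_i * s%:C ^+ i * (z ^+ (i * j) / z ^+ (k * j))); last first.
    apply: eq_bigr => j _; rewrite horner_coef mulr_suml; apply: eq_bigr => i _.
    by rewrite exprMn -exprM [(j * i)%N]mulnC !mulrA.
  have lt_m (i : 'I_(size p)) : (i < m)%N by rewrite ltnS ltnW.
  rewrite exchange_big /=.
  under eq_bigr => i _ do rewrite -mulr_sumr (sum_prim_root pz (lt_m i) (lt_m k)).
  rewrite (bigD1 k) //= eqxx big1 ?addr0 // => i ik.
  by rewrite -val_eqE in ik; rewrite (negPf ik) mulr0.
have d0 : 0 <= d by apply: le_trans (nrm_ge0 _) (hp s%:C _); rewrite nrm_real gtr0_norm.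
have m0 : 0 < m%:R :> R by rewrite ltr0n.
have coef_le (k : 'I_(size p)) : nrm p`_k * s ^+ k <= d.
  rewrite -(@ler_pM2r _ m%:R) //.
  have -> : nrm p`_k * s ^+ k * m%:R = nrm (p`_k * s%:C ^+ k * m%:R).
    rewrite !nrmM nrmX nrm_real gtr0_norm // -(rmorph_nat (real_complex R)) nrm_real.
    by rewrite ger0_norm ?ler0n.
  rewrite coefE (le_trans (nrm_sum _ _ _)) //.
  have -> : d * m%:R = \sum_(j < m) d by rewrite sumr_const card_ord mulr_natr.
  apply: ler_sum => j _; rewrite nrmM.
  have -> : nrm (z ^+ (k * j))^-1 = 1 by rewrite Normc.normcV nrmX nz expr1n invr1.
  by rewrite mulr1 hp // nrmM nrmX nz expr1n mulr1 nrm_real gtr0_norm.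
have r0 : 0 <= nrm y / s by rewrite divr_ge0 ?nrm_ge0 // ltW.
have r1 : nrm y / s < 1 by rewrite ltr_pdivrMr // mul1r.
rewrite horner_coef (le_trans (nrm_sum _ _ _)) //.
apply: (@le_trans _ _ (\sum_(k < size p) d * (nrm y / s) ^+ k)).
  apply: ler_sum => k _; rewrite nrmM nrmX expr_div_n mulrA.
  by rewrite ler_pdivlMr ?exprn_gt0 // mulrAC ler_wpM2r ?exprn_ge0 ?nrm_ge0.
rewrite -mulr_sumr ler_wpM2l // -[leRHS]div1r ler_pdivlMr ?subr_gt0 //.
by rewrite mulrC -opprB mulNr -subrX1 opprB lerBlDr lerDl exprn_ge0.
Qed.

End WeakMaximumPrinciple.

(** * The Taylor hypothesis excludes the alpha parameters *)

(** Used to choose the radius of a circle that avoids finitely many poles. *)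
Lemma exists_avoiding (R : realFieldType) (l : seq R) (s0 s1 : R) : s0 < s1 ->
  exists2 s, s0 < s < s1 & s \notin l.
Proof.
move=> s01.
suff [t /andP[s0t ts1] ht] : exists2 t, s0 < t <= s1 & forall s, s0 < s < t -> s \notin l.
  exists ((s0 + t) / 2); last apply: ht; apply/andP; split; lra.
elim: l => [|y l [t /andP[s0t ts1] ht]]; first by exists s1; rewrite ?lexx ?andbT.
have [ys0|s0y] := leP y s0.
  exists t; first by rewrite s0t.
  move=> s /andP[h1 h2]; rewrite inE negb_or ht ?h1 // andbT gt_eqF //.
  exact: le_lt_trans h1.
exists (Num.min t y); first by rewrite lt_min s0t s0y ge_min ts1.
move=> s /andP[h1]; rewrite lt_min => /andP[h2 h3].
by rewrite inE negb_or ht ?h1 // andbT lt_eqF.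
Qed.

Section AlphaVanishes.
Context {R : realType}.
Variable w : Omega R.

Let a i := alpha w i * (1 + alpha w i / 2).
Let b i := beta w i * (1 - beta w i / 2).

Lemma alphaK_ge0 i : 0 <= a i.
Proof. by rewrite mulr_ge0 ?alpha_ge0 // addr_ge0 // divr_ge0 // alpha_ge0. Qed.

Lemma beta_le_1 i : beta w i <= 1.
Proof.
elim: i => [|i IH]; first exact: beta_le1.
exact: le_trans (beta_noninc w i) IH.
Qed.

Lemma betaK_bounds i : 0 <= b i <= 2^-1.
Proof.
rewrite /b; have := beta_ge0 w i; have := beta_le_1 i.
by move: (beta w i) => x x1 x0; apply/andP; split; nra.
Qed.

Lemma alpha_le i : alpha w i <= alpha w 0.
Proof. by elim: i => // i; exact: le_trans (alpha_noninc w i). Qed.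

Lemma summable_dominated (f g : nat -> R) (M : R) : (forall i, `|f i| <= M * g i) ->
  cvgn (series g) -> cvgn (series (fun i => `|f i|)).
Proof.
move=> fg cg; apply: (@series_le_cvg _ _ (fun i => M * g i)) => //.
  by move=> i; apply: le_trans (fg i).
rewrite (_ : series _ = fun n => M * series g n); first exact: is_cvgMr.
by apply/funext => n; rewrite /series /= mulr_sumr.
Qed.

Lemma alphaK_summable : cvgn (series (fun i => `|- a i|)).
Proof.
apply: (@summable_dominated _ (fun n => alpha w n + beta w n) (1 + alpha w 0 / 2)).
  move=> i; rewrite normrN ger0_norm ?alphaK_ge0 // /a mulrC.
  have := alpha_le i; have := alpha_ge0 w i; have := beta_ge0 w i.
  by move: (alpha w i) (beta w i) (alpha w 0) => x y z; nra.
exact: summable_omega.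
Qed.

Lemma betaK_summable : cvgn (series (fun i => `|b i|)).
Proof.
apply: (@summable_dominated _ (fun n => alpha w n + beta w n) 1).
  move=> i; rewrite ger0_norm ?mul1r; last by case/andP: (betaK_bounds i).
  rewrite /b; have := alpha_ge0 w i; have := beta_ge0 w i.
  by move: (alpha w i) (beta w i) => x y; nra.
exact: summable_omega.
Qed.

Lemma affine_prod_alphaE n x :
  affine_prod (fun i => - a i) n x = \prod_(i < n) (1 - (a i)%:C * (x - 1)).
Proof. by apply: eq_bigr => i _; rewrite rmorphN mulNr. Qed.

(** A convergent product without vanishing factor does not vanish: its tails are
    close to 1. *)
Lemma affine_prod_away0 (c : nat -> R) x : cvgn (series (fun i => `|c i|)) ->
  (forall i, 1 + (c i)%:C * (x - 1) != 0) ->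
  exists2 d : R, 0 < d & exists n0, forall n, (n0 <= n)%N -> d <= nrm (affine_prod c n x).
Proof.
move=> cc nz; pose u i := `|c i| * nrm (x - 1).
have cu : cvgn (series u).
  rewrite (_ : series u = fun n => nrm (x - 1) * series (fun i => `|c i|) n).
    exact: is_cvgMr.
  by apply/funext => n; rewrite /series /= mulr_sumr; apply: eq_bigr => i _; rewrite mulrC.
have u0 i : 0 <= u i by rewrite mulr_ge0 ?nrm_ge0.
have mono : nondecreasing_seq (series u).
  by apply/nondecreasing_seqP => i; rewrite seriesSr lerDl.
have [n0 h0] := (cvgR_absP _ _).1 cu 4^-1 ltac:(by rewrite invr_gt0).
have tail k : series u (n0 + k)%N - series u n0 <= 2^-1.
  have h1 := h0 _ (leq_addr k n0); have h2 := h0 _ (leqnn n0).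
  move: h1 h2; rewrite !ler_norml => /andP[_ h1] /andP[h2 _]; lra.
have tail_prod k : 1 - (series u (n0 + k)%N - series u n0) <=
    nrm (\prod_(i < k) (1 + (c (n0 + i)%N)%:C * (x - 1))).
  elim: k => [|k IH]; first by rewrite addn0 subrr subr0 big_ord0 nrm1.
  rewrite big_ord_recr /= nrmM addnS seriesSr.
  have h1 : 1 - u (n0 + k)%N <= nrm (1 + (c (n0 + k)%N)%:C * (x - 1)).
    rewrite lerBlDr -nrm1 -[in leLHS](addrK ((c (n0 + k)%N)%:C * (x - 1)) 1).
    by rewrite (le_trans (nrmB _ _)) // nrmM nrm_real.
  have [lt1|ge1] := ltP (u (n0 + k)%N) 1; last first.
    apply: (@le_trans _ _ 0); last by rewrite mulr_ge0 ?nrm_ge0.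
    have : series u n0 <= series u (n0 + k)%N.
      by apply: mono; rewrite leq_addr.
    lra.
  have t := tail k; have : series u n0 <= series u (n0 + k)%N.
    by apply: mono; rewrite leq_addr.
  move=> s0; apply: (@le_trans _ _ ((1 - (series u (n0 + k)%N - series u n0)) * (1 - u (n0 + k)%N))).
    by have := u0 (n0 + k)%N; nra.
  by apply: ler_pM => //; lra.
exists (nrm (affine_prod c n0 x) / 2).
  rewrite divr_gt0 // lt_def nrm_ge0 andbT nrm_eq0 prodf_seq_neq0.
  by apply/allP => i _; rewrite nz.
exists n0 => n n0n; rewrite -(subnKC n0n) /affine_prod big_split_ord /= nrmM.
rewrite ler_wpM2l ?nrm_ge0 //; apply: le_trans (tail_prod _).
by have := tail (n - n0)%N; lra.
Qed.

Definition exp_poly n (x : R[i]) : R[i] := (1 + (gamma w)%:C * (x - 1) / n%:R) ^+ n.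

Lemma nrm_natr n : nrm (n%:R : R[i]) = n%:R.
Proof. by rewrite -(rmorph_nat (real_complex R)) nrm_real ger0_norm. Qed.

Lemma exp_poly_approx (M : R) : 0 <= M -> exists2 A, 0 <= A & exists2 n0 : nat, (0 < n0)%N &
  forall n x, (n0 <= n)%N -> nrm (x - 1) <= M ->
    nrm (cexp ((gamma w)%:C * (x - 1)) - exp_poly n x) <= A / n%:R.
Proof.
move=> M0; have g0 := gamma_ge0 w; pose G := gamma w * M.
have G0 : 0 <= G by rewrite mulr_ge0.
exists (4 * G ^+ 2 * expR G); first by rewrite !mulr_ge0 ?expR_ge0 ?sqr_ge0.
exists (Num.truncn (2 * G)).+1 => // n x n0n xM.
have nG : nrm ((gamma w)%:C * (x - 1)) <= G.
  by rewrite nrmM nrm_real ger0_norm // ler_wpM2l.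
have G2 : 2 * G <= n%:R.
  by apply: le_trans (ltW (Num.Theory.truncnS_gt _)) _; rewrite ler_nat.
have n0 : (0 < n)%N by apply: leq_trans n0n.
apply: (le_trans (cexp_limit_le n0 _)).
  by apply: le_trans G2; rewrite ler_wpM2l.
rewrite ler_wpM2r ?invr_ge0 // ler_pM ?mulr_ge0 ?sqr_ge0 ?expR_ge0 ?ler_expR ?nrm_ge0 //.
by rewrite ler_wpM2l // ler_pXn2r ?nnegrE ?nrm_ge0.
Qed.

Lemma exp_poly_cvg x : exp_poly n x @[n --> \oo] --> cexp ((gamma w)%:C * (x - 1)).
Proof.
have [A A0 [n0 n0_gt0 h]] := exp_poly_approx (nrm_ge0 (x - 1)).
apply/cvgC_nrmP => eps eps0; exists (maxn n0 (Num.truncn (A / eps)).+1) => n.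
rewrite geq_max => /andP[n0n An]; rewrite nrmBC (le_trans (h _ _ n0n _)) //.
have n_gt0 : 0 < n%:R :> R by rewrite ltr0n; apply: leq_trans n0n.
rewrite ler_pdivrMr // mulrC -ler_pdivrMr //.
by apply: le_trans (ltW (Num.Theory.truncnS_gt _)) _; rewrite ler_nat.
Qed.

Lemma exp_poly_ucauchy (K : set R[i]) M : 0 <= M ->
  (forall x, K x -> nrm (x - 1) <= M) -> ucauchy K exp_poly.
Proof.
move=> M0 KM; have [A A0 [n0 n0_gt0 h]] := exp_poly_approx M0.
move=> eps eps0; exists (maxn n0 (Num.truncn (A / (eps / 2))).+1) => n m x.
rewrite !geq_max => /andP[n0n An] /andP[n0m Am] Kx.
have le2 k : (n0 <= k)%N -> ((Num.truncn (A / (eps / 2))).+1 <= k)%N ->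
    nrm (cexp ((gamma w)%:C * (x - 1)) - exp_poly k x) <= eps / 2.
  move=> n0k Ak; rewrite (le_trans (h _ _ n0k _)) ?KM //.
  have k_gt0 : 0 < k%:R :> R by rewrite ltr0n; apply: leq_trans n0k.
  rewrite ler_pdivrMr // mulrC -ler_pdivrMr ?divr_gt0 //.
  by apply: le_trans (ltW (Num.Theory.truncnS_gt _)) _; rewrite ler_nat.
set z := cexp _ in le2.
have -> : exp_poly n x - exp_poly m x = (z - exp_poly m x) - (z - exp_poly n x) by ring.
by rewrite (le_trans (nrmB _ _)) // [leRHS](splitr eps) lerD // le2.
Qed.

Lemma exp_poly_bounded (K : set R[i]) M : 0 <= M ->
  (forall x, K x -> nrm (x - 1) <= M) -> ubounded K exp_poly (expR (gamma w * M)).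
Proof.
move=> M0 KM [|n] x Kx; first by rewrite /exp_poly expr0 nrm1 -expR0 ler_expR mulr_ge0 ?gamma_ge0.
rewrite /exp_poly nrmX.
apply: (@le_trans _ _ (expR (gamma w * M / n.+1%:R) ^+ n.+1)).
  apply: lerXn2r; rewrite ?nnegrE ?nrm_ge0 ?expR_ge0 //.
  apply: (le_trans (nrmD _ _)); rewrite nrm1 (le_trans _ (expR_ge1Dx _)) // lerD2l.
  rewrite !nrmM Normc.normcV nrm_natr nrm_real ger0_norm ?gamma_ge0 //.
  by rewrite ler_wpM2r ?invr_ge0 // ler_wpM2l ?gamma_ge0 // KM.
by rewrite -expRM_natl mulrC divfK.
Qed.

Lemma Phi_cvg x (l : R[i]) :
  \prod_(i < n) ((1 + (b i)%:C * (x - 1)) / (1 - (a i)%:C * (x - 1))) @[n --> \oo] --> l ->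
  Phi w x = cexp ((gamma w)%:C * (x - 1)) * l.
Proof.
by move=> h; rewrite -(cvg_lim (@norm_hausdorff _ _) h).
Qed.

(** Suppose alpha_0 > 0. On a large circle without poles, the product of the power
    series with the denominators of Phi equals the numerators. Both sides are
    uniform limits of polynomials there, hence their difference is small inside
    the circle too. But at the pole 1 + 1/a_0, which lies inside, the denominators
    vanish while the numerators are at least 1. *)
Lemma entire_alpha_eq0 (r : R) (c : nat -> R[i]) :
  (forall x, r < nrm x -> series (fun n => c n * x ^+ n) @ \oo --> Phi w x) ->
  forall i, alpha w i = 0.
Proof.
move=> cPhi; suff al0 : alpha w 0 = 0.
  by move=> i; apply/eqP; rewrite eq_le alpha_ge0 -al0 alpha_le.
apply/eqP/negP => /negP al0.
have a0_gt0 : 0 < a 0%N.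
  have al_gt0 : 0 < alpha w 0 by rewrite lt_def al0 alpha_ge0.
  by rewrite /a mulr_gt0 // addr_gt0 // divr_gt0.
pose y0 : R := 1 + (a 0%N)^-1; pose M0 := Num.max r y0.
have y1 : 1 < y0 by rewrite ltrDl invr_gt0.
have M0y : y0 <= M0 by rewrite le_max lexx orbT.
have M0_gt0 : 0 < M0 + 1 by lra.
have [n0 hn0] : exists n0, forall i, (n0 <= i)%N -> a i * (M0 + 1) < 1.
  have := cvg_series_cvg_0 alphaK_summable.
  move=> /cvgR_absP/(_ ((M0 + 1)^-1 / 2)) []; first by rewrite divr_gt0 // invr_gt0.
  move=> n0 h; exists n0 => i /h; rewrite subr0 normr_id normrN ger0_norm ?alphaK_ge0 //.
  move=> le_i; rewrite -ltr_pdivlMr // div1r; apply: le_lt_trans le_i _.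
  by rewrite gtr_pMr ?invr_gt0 // invf_lt1 // ltr1n.
have [s /andP[M0s sM0] sl] := @exists_avoiding R [seq 1 + (a i)^-1 | i <- iota 0 n0] M0 (M0 + 1) ltac:(lra).
have rs : r < s by apply: le_lt_trans M0s; rewrite le_max lexx.
have s0 : 0 < s by lra.
pose K : set R[i] := [set x | nrm x = s].
have KM x : K x -> nrm (x - 1) <= s + 1.
  by move=> Kx; rewrite (le_trans (nrmB _ _)) // nrm1 Kx.
have sM : 0 <= s + 1 by lra.
have nz x : K x -> forall i, 1 + (- a i)%:C * (x - 1) != 0.
  move=> Kx i; rewrite rmorphN mulNr subr_eq0; apply/eqP => /esym ax.
  have ai0 : a i != 0.
    by apply/eqP => ai0; move/eqP: ax; rewrite ai0 mul0r eq_sym oner_eq0.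
  have xE : x = (1 + (a i)^-1)%:C.
    apply: (@addIr _ (-1)); apply: (@mulfI _ (a i)%:C).
      by rewrite -(rmorph0 (real_complex R)) (inj_eq (@complexI R)).
    by rewrite ax rmorphD rmorph1 addrAC subrr add0r -rmorphM divff.
  have ai_gt0 : 0 < a i by rewrite lt_def ai0 alphaK_ge0.
  have sE : s = 1 + (a i)^-1.
    by rewrite -Kx xE nrm_real ger0_norm // addr_ge0 // invr_ge0 ltW.
  have [i_lt|n0i] := ltnP i n0.
    by move/negP: sl; apply; apply/mapP; exists i; rewrite // mem_iota.
  have := hn0 _ n0i; apply/negP; rewrite -leNgt -ler_pdivrMl // mulr1.
  by lra.
pose F n x := series (fun k => c k * x ^+ k) n.
pose H := affine_prod (fun i => - a i); pose B := affine_prod b.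
(* The series converges beyond the circle, so its terms are dominated there by
   a geometric sequence. *)
have [A A0 hA] : exists2 A, 0 < A & forall k, nrm (c k) * (s + 1) ^+ k <= A.
  have s1C : r < nrm (s + 1)%:C by rewrite nrm_real ger0_norm //; lra.
  have := cvg_series_cvg_0 (cvgP _ (cPhi _ s1C)).
  move=> /cvgC_nrmP/(_ 1 ltr01)[k0 hk].
  pose m := \sum_(k < k0) nrm (c k) * (s + 1) ^+ k.
  have m0 : 0 <= m by rewrite sumr_ge0 // => k _; rewrite mulr_ge0 ?nrm_ge0 ?exprn_ge0.
  exists (1 + m); first by lra.
  move=> k; have [kk0|k0k] := ltnP k k0.
    rewrite /m (bigD1 (Ordinal kk0)) //= addrCA lerDl addr_ge0 // sumr_ge0 // => j _.
    by rewrite mulr_ge0 ?nrm_ge0 ?exprn_ge0.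
  have := hk _ k0k; rewrite subr0 nrmM nrmX nrm_real ger0_norm //; lra.
have q0 : 0 <= s / (s + 1) by rewrite divr_ge0 // ltW.
have q1 : s / (s + 1) < 1 by rewrite ltr_pdivrMr; lra.
have F_incr n x : K x -> nrm (F n.+1 x - F n x) <= A * (s / (s + 1)) ^+ n.
  move=> Kx; rewrite /F seriesSr addrAC subrr add0r nrmM nrmX Kx expr_div_n mulrA.
  by rewrite ler_pdivlMr ?exprn_gt0 //; [rewrite mulrAC ler_wpM2r ?exprn_ge0 // ltW|lra].
have F_cauchy : ucauchy K F.
  apply: (ucauchy_series _ F_incr).
  have := @is_cvg_geometric_series R A (s / (s + 1)); rewrite ger0_norm //; apply.
  exact: q1.
have F_bounded : ubounded K F (A / (1 - s / (s + 1))).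
  move=> n x Kx; rewrite /F /series /= (le_trans (nrm_sum _ _ _)) //.
  apply: (@le_trans _ _ (\sum_(0 <= k < n) A * (s / (s + 1)) ^+ k)).
    apply: ler_sum => k _; have := F_incr k x Kx.
    by rewrite /F seriesSr addrAC subrr add0r.
  rewrite -mulr_sumr ler_wpM2l ?(ltW A0) //; rewrite -[leRHS]div1r ler_pdivlMr ?subr_gt0 //.
  by rewrite big_mkord mulrC -opprB mulNr -subrX1 opprB lerBlDr lerDl exprn_ge0.
pose D n x := F n x * H n x - exp_poly n x * B n x.
have H_bounded := affine_prod_bounded alphaK_summable KM sM.
have B_bounded := affine_prod_bounded betaK_summable KM sM.
have H_cauchy := affine_prod_ucauchy alphaK_summable KM sM.
have B_cauchy := affine_prod_ucauchy betaK_summable KM sM.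
have E_cauchy := exp_poly_ucauchy sM KM.
have E_bounded := exp_poly_bounded sM KM.
have D_cauchy : ucauchy K D.
  apply: ucauchyB.
    apply: (ucauchyM _ _ F_bounded H_bounded) => //; last exact: expR_gt0.
    by rewrite divr_gt0 // subr_gt0.
  by apply: (ucauchyM _ _ E_bounded B_bounded) => //; exact: expR_gt0.
have D_cvg0 x : K x -> D n x @[n --> \oo] --> (0 : R[i]).
  move=> Kx; have Hc := affine_prod_cvg alphaK_summable KM sM Kx.
  have Bc := affine_prod_cvg betaK_summable KM sM Kx.
  have Fc : F n x @[n --> \oo] --> Phi w x by apply: cPhi; rewrite Kx.
  have [d d0 [k0 hk]] := affine_prod_away0 alphaK_summable (nz _ Kx).
  set h := limn _ in Hc; set be := limn _ in Bc.
  have h0 : h != 0.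
    rewrite -nrm_eq0 gt_eqF // (lt_le_trans (_ : 0 < d / 2)) ?divr_gt0 //.
    have [k1 hk1] := (cvgC_nrmP _ _).1 Hc (d / 2) ltac:(by rewrite divr_gt0).
    have l1 := hk1 (maxn k0 k1) (leq_maxr _ _); have l2 := hk (maxn k0 k1) (leq_maxl _ _).
    set v := affine_prod _ _ _ in l1 l2.
    have : nrm v <= nrm (v - h) + nrm h by apply: le_trans (nrmD _ _); rewrite subrK.
    lra.
  have PhiE : Phi w x = cexp ((gamma w)%:C * (x - 1)) * (be / h).
    apply: Phi_cvg.
    rewrite (_ : (fun n => _) = fun n => B n x * (H n x)^-1); last first.
      by apply/funext => n; rewrite prodf_div /H affine_prod_alphaE.
    exact: cvgCM Bc (cvgCV h0 Hc).
  rewrite (_ : 0 = Phi w x * h - cexp ((gamma w)%:C * (x - 1)) * be); last first.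
    by rewrite PhiE; field.
  exact: cvgCB (cvgCM Fc Hc) (cvgCM (@exp_poly_cvg x) Bc).
pose p n : {poly R[i]} := \poly_(k < n) c k * \prod_(i < n) (1 + (- a i)%:C *: ('X - 1)) -
  (1 + ((gamma w)%:C / n%:R) *: ('X - 1)) ^+ n * \prod_(i < n) (1 + (b i)%:C *: ('X - 1)).
have pE n x : (p n).[x] = D n x.
  rewrite /p /D /F /H /B /exp_poly /affine_prod !hornerE !horner_prod horner_poly.
  rewrite /series /= big_mkord.
  congr (_ * _ - _ * _); do ?by apply: eq_bigr => i _; rewrite !hornerE.
  by rewrite mulrAC.
have y0s : y0 < s by lra.
have ny0 : nrm y0%:C = y0 by rewrite nrm_real ger0_norm //; lra.
pose eps := (1 - y0 / s) / 4.
have ys1 : y0 / s < 1 by rewrite ltr_pdivrMr // mul1r.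
have eps0 : 0 < eps by rewrite divr_gt0 // subr_gt0.
have [n1 hn1] := D_cauchy _ eps0; pose n := n1.+1.
have D_le x : nrm x = s -> nrm (p n).[x] <= eps + eps.
  move=> Kx; have [m0 hm0] := (cvgC_nrmP _ _).1 (D_cvg0 x Kx) _ eps0.
  rewrite pE; have := hm0 _ (leq_maxl m0 n1); rewrite subr0.
  have := hn1 n _ x (leqnSn _) (leq_maxr m0 n1) Kx.
  set m := maxn _ _; move=> h1 h2; rewrite -[D n x](subrK (D m x)).
  by rewrite (le_trans (nrmD _ _)) // lerD.
have := @poly_bound_inside R (p n) s (eps + eps) y0%:C s0; rewrite ny0 => /(_ y0s D_le).
have yE : y0%:C - 1 = (a 0%N)^-1%:C by rewrite /y0 rmorphD rmorph1 addrAC subrr add0r.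
have H0 : H n y0%:C = 0.
  rewrite /H /affine_prod /n big_ord_recl /= yE rmorphN mulNr -rmorphM divff ?gt_eqF //.
  by rewrite subrr mul0r.
rewrite pE /D H0 mulr0 sub0r nrmN nrmM.
have E1 : 1 <= nrm (exp_poly n y0%:C).
  rewrite /exp_poly nrmX exprn_ege1 // yE -(rmorph_nat (real_complex R)) -fmorphV -!rmorphM.
  rewrite -(rmorph1 (real_complex R)) -rmorphD nrm_real ger0_norm ?lerDl ?addr_ge0 //;
    by rewrite !mulr_ge0 ?invr_ge0 ?gamma_ge0 ?(ltW a0_gt0).
have B1 : 1 <= nrm (B n y0%:C).
  rewrite /B /affine_prod nrm_prod; elim/big_rec: _ => // i x _ x1.
  rewrite -[leLHS]mulr1 ler_pM // yE -(rmorph1 (real_complex R)) -rmorphM -rmorphD nrm_real.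
  have /andP[b0 _] := betaK_bounds i.
  rewrite ger0_norm ?lerDl ?addr_ge0 //; by rewrite mulr_ge0 ?invr_ge0 ?(ltW a0_gt0).
have -> : (eps + eps) / (1 - y0 / s) = 2^-1.
  by rewrite /eps; field; rewrite !gt_eqF //= subr_gt0.
move=> /(le_trans (ler_pM ler01 ler01 E1 B1)); rewrite mulr1 leNgt invf_lt1 // ltr1n.
by [].
Qed.

End AlphaVanishes.

(** * Polynomial approximations of Phi *)

Section Approximation.
Context {R : realType}.
Variable w : Omega R.

(** Parameters of the polynomials that approximate Phi: finitely many factors of
    the product, and the exponential as an m-th power. The shift of m by a bound
    for 2 gamma keeps gamma / m below 1/2. *)
Definition approx (n : nat) : seq R :=
  let m := (n + (Num.truncn (2 * gamma w)).+1)%N in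
  [seq beta w i * (1 - beta w i / 2) | i <- iota 0 m] ++ nseq m (gamma w / m%:R).

Lemma approx_bounds n c : c \in approx n -> 0 <= c <= 2^-1.
Proof.
rewrite mem_cat => /orP[/mapP[i _ ->]|]; first exact: betaK_bounds.
move=> /nseqP[-> m0]; rewrite divr_ge0 ?gamma_ge0 //= ler_pdivrMr ?ltr0n //.
rewrite -ler_pdivrMl ?invr_gt0 // invrK.
apply: le_trans (ltW (Num.Theory.truncnS_gt _)) _.
by rewrite ler_nat leq_addl.
Qed.

Lemma steps_poly_norm_le1 (bs : seq R) x : {in bs, forall c, 0 <= c <= 2^-1} ->
  `|x| <= 1 -> `|steps_poly bs x| <= 1.
Proof.
move=> hb; rewrite ler_norml => /andP[x0 x1]; rewrite /steps_poly.
suff /andP[p0 p1] : 0 <= \prod_(c <- bs) (1 + c * (x - 1)) <= 1.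
  by rewrite ger0_norm.
rewrite big_seq; elim/big_rec: _ => [|c y /hb /andP[c0 c1] /andP[y0 y1]].
  by rewrite ler01 lexx.
have h1 : 0 <= 1 + c * (x - 1) by nra.
have h2 : 1 + c * (x - 1) <= 1 by nra.
by rewrite mulr_ge0 //= mulr_ile1.
Qed.

Lemma steps_poly_ge1 (bs : seq R) x : {in bs, forall c, 0 <= c <= 2^-1} ->
  1 <= x -> 1 <= steps_poly bs x.
Proof.
move=> hb x1; rewrite /steps_poly.
rewrite big_seq; elim/big_rec: _ => [//|c y /hb /andP[c0 c1] y1].
by have h1 : 1 <= 1 + c * (x - 1); nra.
Qed.

Hypothesis alpha0 : forall i, alpha w i = 0.

Let b i := beta w i * (1 - beta w i / 2).

Lemma steps_poly_approxE n x (m := (n + (Num.truncn (2 * gamma w)).+1)%N) :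
  (steps_poly (approx n) x)%:C = affine_prod b m x%:C * exp_poly w m x%:C.
Proof.
rewrite /steps_poly big_cat /= rmorphM !rmorph_prod; congr (_ * _).
  have -> : iota 0 m = index_iota 0 m by rewrite /index_iota subn0.
  rewrite big_map big_mkord; apply: eq_bigr => i _.
  by rewrite rmorphD rmorph1 rmorphM rmorphB rmorph1.
rewrite big_nseq iter_mulr_1 /exp_poly; congr (_ ^+ _).
rewrite rmorphD rmorph1 rmorphM rmorphB rmorph1 rmorphM fmorphV rmorph_nat.
by rewrite mulrAC.
Qed.

Lemma approx_cvgC x : (fun n => (steps_poly (approx n) x)%:C) @ \oo --> Phi w x%:C.
Proof.
have KM y : [set x%:C] y -> nrm (y - 1) <= nrm (x%:C - 1) by move=> ->.
have Bc := affine_prod_cvg (@betaK_summable R w) KM (nrm_ge0 _) (erefl x%:C).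
have -> : Phi w x%:C = limn (affine_prod b ^~ x%:C) * cexp ((gamma w)%:C * (x%:C - 1)).
  rewrite mulrC; apply: Phi_cvg.
  rewrite (_ : (fun n : nat => \prod_(i < n) _) = affine_prod b ^~ x%:C) //.
  apply/funext => n; apply: eq_bigr => i _.
  by rewrite alpha0 mul0r mul0r subr0 divr1.
pose s n := (n + (Num.truncn (2 * gamma w)).+1)%N.
rewrite (_ : (fun n => _) =
    fun n => (affine_prod b (s n) x%:C) * (exp_poly w (s n) x%:C)); last first.
  by apply/funext => n; rewrite steps_poly_approxE.
apply: cvgCM; rewrite /s.
  by rewrite (cvg_shiftn _ (affine_prod b ^~ x%:C)).
by rewrite (cvg_shiftn _ (exp_poly w ^~ x%:C)); exact: exp_poly_cvg.
Qed.

Definition phi (x : R) : R := complex.Re (Phi w x%:C).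

Lemma approx_cvg x : steps_poly (approx n) x @[n --> \oo] --> phi x.
Proof. exact: cvgC_Re (@approx_cvgC x). Qed.

Lemma PhiE x : Phi w x%:C = (phi x)%:C.
Proof.
rewrite /phi; case E: (Phi w x%:C) => [p r] /=; congr (_ +i* _)%C.
apply/eqP; rewrite -normr_eq0; apply/eqP/le_anti; rewrite normr_ge0 andbT.
apply/ler_addgt0Pr => eps eps0; rewrite add0r.
have [n0 /(_ n0 (leqnn _))] := (cvgC_nrmP _ _).1 (@approx_cvgC x) _ eps0.
apply: le_trans; apply: le_trans (Im_le_nrm _).
by rewrite E raddfB /= sub0r normrN.
Qed.

End Approximation.

(** * The Laurent polynomials f in terms of odd determinants *)

Lemma odd_laurent_sign (F : fieldType) e (b : bool) (v : F) a :
  odd_laurent e ((-1) ^+ b * v) a = (-1) ^+ (b && odd e) * odd_laurent e v a.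
Proof.
case: b => /=; last by rewrite !mul1r.
have sgE : (-1) ^+ (a.*2 + e) = (-1) ^+ odd e :> F.
  by rewrite -signr_odd oddD odd_double.
rewrite expr1 mulN1r /odd_laurent [(- v) ^+ _]exprNn invfM sgE.
case: (odd e); rewrite ?expr1 ?expr0 ?invrN1 ?invr1 -mulrBr //.
Qed.

Section LaurentPolynomials.
Context {R : realType}.
Variables (X : root_type) (q : R).
Notation e := (dbl_eps X).
Notation C := R[i].

Lemma dbl_eps12 : (e == 1%N) || (e == 2%N).
Proof. by case: X. Qed.

Definition labels N (lam : signature N) (i : 'I_N) : nat := (tnth lam i + (N - i.+1))%N.

Lemma labels_decreasing N (lam : signature N) : strictly_decreasing (labels lam).
Proof.
apply/strictly_decreasingP => i j ij; rewrite /labels.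
have : (tnth lam j <= tnth lam i)%N.
  case: lam => lam /= slam; rewrite !(tnth_nth 0%N).
  apply: (sorted_ltn_nth _ _ slam) => //; rewrite ?inE ?size_tuple ?ltn_ord //.
  by move=> y x z /= yx zy; exact: leq_trans zy yx.
by have := ltn_ord j; lia.
Qed.

Lemma dbl_shiftE N (lam : signature N) i : dbl_shift X lam i = ((labels lam i).*2 + e)%N.
Proof.
rewrite /dbl_shift /dbl_c /labels -subn1 -subnDA addn1 addnA; congr (_ + _)%N.
by rewrite -doubleD.
Qed.

Lemma sqrtC_sqr (v : C) : exists b : bool, sqrtC (v ^+ 2) = (-1) ^+ b * v.
Proof.
have /eqP := sqrtCK (v ^+ 2); rewrite eqf_sqr => /orP[] /eqP ->.
  by exists false; rewrite mul1r.
by exists true; rewrite expr1 mulN1r.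
Qed.

(** The choice of the square root of v^2 multiplies all these differences at v by
    a common sign, which cancels in quotients and in products of two. *)
Lemma hpowE (v : C) (b : bool) a : sqrtC (v ^+ 2) = (-1) ^+ b * v ->
  hpow (v ^+ 2) ((a.*2 + e)%N : int) - hpow (v ^+ 2) (- (a.*2 + e)%:Z) =
  (-1) ^+ (b && odd e) * odd_laurent e v a.
Proof.
move=> E; rewrite -odd_laurent_sign /hpow E /odd_laurent exprnN.
by rewrite -exprnP.
Qed.

Definition laurent_denom N (v : 'I_N -> C) : C :=
  (\prod_j odd_laurent e (v j) 0) *
  \prod_(i < N) \prod_(j < N | (i < j)%N) (two_cosh (v i) - two_cosh (v j)).

Lemma fXE N (lam : signature N) (v : 'I_N -> C) :
  fX X lam (fun j => v j ^+ 2) =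
  \det (\matrix_(i, j) odd_laurent e (v j) (labels lam i)) / laurent_denom v.
Proof.
rewrite /fX /laurent_denom invfM mulrA; congr (_ / _); last first.
  apply: eq_bigr => i _; apply: eq_bigr => j _.
  by rewrite /two_cosh opprD addrA.
pose d : 'rV[C]_N := \row_j (odd_laurent e (v j) 0)^-1.
rewrite -prodfV (eq_bigr (fun j => d 0 j)) => [|j _]; last by rewrite mxE.
rewrite -det_diag -det_mulmx mul_mx_diag; congr (\det _).
apply/matrixP => i j; rewrite !mxE dbl_shiftE.
have [b hb] := sqrtC_sqr (v j).
have := hpowE 0 hb; rewrite double0 add0n => ->; rewrite (hpowE _ hb).
rewrite -mulf_div divff ?mul1r //.
by case: (b && odd e); rewrite ?expr1 ?oppr_eq0 oner_eq0.
Qed.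

Hypothesis q0 : 0 < q.

(** With a fourth root p of q, the point q^(c_j) is the square of an integer power
    of p for either root type. *)
Definition qroot : R := q `^ (4^-1).

Lemma qcXE j : qcX X q j.+1 = (node e (qroot%:C : C) j) ^+ 2.
Proof.
rewrite /qcX /node -exprM -rmorphXn; congr _%:C.
rewrite /qroot -powR_mulrn ?powR_ge0 // -powRrM /cX /dbl_c /=; congr (_ `^ _).
by rewrite natrM; field.
Qed.

End LaurentPolynomials.

(** * Contour integrals over the unit circle *)

Lemma steps_rmorph (F F' : fieldType) (f : {rmorphism F -> F'}) e (bs : seq F) i j :
  steps e (map f bs) i j = f (steps e bs i j).
Proof.
elim: bs i j => [|b bs IH] i j /=; first by rewrite rmorph_nat.
rewrite /kernel_mul rmorph_sum; apply: eq_bigr => k _; rewrite rmorphM IH; congr (_ * _).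
rewrite /step /jacobi; have cE : corner F' e = f (corner F e).
  by rewrite /corner; case: ifP; rewrite ?rmorph0 // rmorphN rmorph1.
have bE : f b / 2 = f (b / 2) by rewrite rmorphM fmorphV rmorph_nat.
rewrite cE bE; case: ifP => _; last by case: ifP => _; rewrite ?rmorph0.
by case: ifP => _; rewrite !(rmorphD, rmorphN, rmorphM, rmorph1).
Qed.

Lemma steps_poly_rmorph (F F' : fieldType) (f : {rmorphism F -> F'}) (bs : seq F) x :
  steps_poly (map f bs) (f x) = f (steps_poly bs x).
Proof.
rewrite /steps_poly big_map rmorph_prod; apply: eq_bigr => b _.
by rewrite rmorphD rmorphM rmorphB rmorph1.
Qed.

Section Circle.
Context {R : realType}.
Local Notation mu := (@lebesgue_measure R).

Definition cis (t : R) : R[i] := (cos t +i* sin t)%C.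

Lemma cisD s t : cis (s + t) = cis s * cis t.
Proof.
by apply/eqP; rewrite /cis eq_complex /= cosD sinD; apply/andP; split; apply/eqP; ring.
Qed.

Lemma cis0 : cis 0 = 1.
Proof. by rewrite /cis cos0 sin0. Qed.

Lemma cis_neq0 t : cis t != 0.
Proof.
apply/eqP => t0; have := cisD t (- t); rewrite subrr cis0 t0 mul0r => /eqP.
by rewrite oner_eq0.
Qed.

Lemma cisX t n : cis t ^+ n = cis (n%:R * t).
Proof.
elim: n => [|n IH]; first by rewrite mul0r cis0.
by rewrite exprS IH -cisD mulrS mulrDl mul1r.
Qed.

Lemma cisV t : (cis t)^-1 = cis (- t).
Proof. by apply: (@mulfI _ (cis t)); rewrite ?cis_neq0 // divff ?cis_neq0 // -cisD subrr cis0. Qed.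

Definition half_sine (e : nat) (k : nat) (t : R) : R := sin ((k.*2 + e)%:R * (t / 2)).

Lemma odd_laurent_cis e t k :
  odd_laurent e (cis (t / 2)) k = (0 +i* (2 * half_sine e k t))%C.
Proof.
rewrite /odd_laurent cisX cisV /cis /half_sine cosN sinN; move: (_ * _) => y.
by apply/eqP; rewrite eq_complex /=; apply/andP; split; apply/eqP; ring.
Qed.

Lemma two_cosh_cis t : two_cosh (cis (t / 2)) / 2 = (cos t)%:C.
Proof.
rewrite /two_cosh cisX cisV (_ : 2 * (t / 2) = t); last by field.
rewrite /cis cosN sinN -[2]/(2%:R) -(rmorph_nat (real_complex R)) -fmorphV.
apply/eqP; rewrite eq_complex /=; apply/andP; split; apply/eqP; first by field.
by ring.
Qed.

(** The expansion of the multiplied basis function, read on the unit circle. *)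
Lemma steps_half_sine e bs a n t : (e == 1%N) || (e == 2%N) -> (a + size bs < n)%N ->
  steps_poly bs (cos t) * half_sine e a t = \sum_(k < n) steps e bs a k * half_sine e k t.
Proof.
move=> e12 an; have n2 : 2%:R != 0 :> R[i] by rewrite pnatr_eq0.
have := @steps_odd_laurent R[i] e n2 (cis (t / 2)) (map (real_complex R) bs) a n (cis_neq0 _) e12.
rewrite size_map => /(_ an); rewrite two_cosh_cis steps_poly_rmorph odd_laurent_cis.
under eq_bigr => k _ do rewrite steps_rmorph odd_laurent_cis.
have i2 (x : R) : (0 +i* (2 * x))%C = (0 +i* 2)%C * x%:C :> R[i].
  by apply/eqP; rewrite eq_complex /=; apply/andP; split; apply/eqP; ring.
rewrite i2; under eq_bigr => k _ do rewrite i2 mulrCA.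
rewrite -mulr_sumr mulrCA => /mulfI h; apply: complexI; rewrite rmorphM.
rewrite -h ?rmorph_sum; first by apply: eq_bigr => k _; rewrite rmorphM.
by rewrite eq_complex /= eqxx /= pnatr_eq0.
Qed.

Lemma integral_cos (n : nat) : (0 < n)%N ->
  \int[mu]_(t in `[0, 2 * pi]) cos (n%:R * t) = 0 :> R.
Proof.
move=> n0; have n_neq0 : n%:R != 0 :> R by rewrite pnatr_eq0 -lt0n.
rewrite /Rintegral (@continuous_FTC2 R _ (fun t => sin (n%:R * t) / n%:R)) /=.
- rewrite mulr0 sin0 mul0r; have -> : n%:R * (2 * pi) = 0 + (pi *+ 2) *+ n :> R.
    by rewrite add0r -mulrnA -[RHS]mulr_natl natrM; ring.
  by rewrite (periodicn (@sinD2pi R)) sin0 mul0r subrr.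
- by rewrite mulr_gt0 // pi_gt0.
- apply: continuous_subspaceT => t; apply: continuous_comp; last exact: continuous_cos.
  exact: mulrl_continuous.
- have cF : continuous (fun t : R => sin (n%:R * t) / n%:R).
    move=> t; apply: cvgMl; apply: continuous_comp; last exact: continuous_sin.
    exact: mulrl_continuous.
  split.
  + by move=> x _; apply: ex_derive.
  + by apply: cvg_at_right_filter; exact: cF.
  + by apply: cvg_at_left_filter; exact: cF.
- move=> x _; rewrite derive1E derive_val.
  rewrite !scaler0 add0r [n%:R%:A]mulr1.
  by rewrite -[LHS]/(n%:R^-1 * (cos (n%:R * x) * n%:R)) mulrCA mulVf // mulr1.
Qed.

Local Notation circle := (`[0, 2 * pi]%classic : set R).

Lemma circle_measure : fine (mu circle) = 2 * pi.
Proof.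
by rewrite lebesgue_measure_itv /= lte_fin mulr_gt0 ?pi_gt0 // -EFinB subr0.
Qed.

Lemma circle_integrable (f : R -> R) : continuous f -> mu.-integrable circle (EFin \o f).
Proof.
move=> cf; apply: continuous_compact_integrable; first exact: segment_compact.
exact: continuous_subspaceT.
Qed.

Lemma continuous_sum I (r : seq I) (f : I -> R -> R) :
  (forall i, continuous (f i)) -> continuous (fun t => \sum_(i <- r) f i t).
Proof.
by move=> cf t; exact: (cvg_big (@add_continuous R) _ (fun i _ => cf i t)).
Qed.

Lemma Rintegral_sum I (r : seq I) (f : I -> R -> R) :
  (forall i, continuous (f i)) ->
  \int[mu]_(t in circle) (\sum_(i <- r) f i t) = \sum_(i <- r) \int[mu]_(t in circle) f i t.
Proof.
move=> cf; elim: r => [|i r IH].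
  rewrite big_nil (@eq_Rintegral _ _ R mu circle (fun=> 0)) => [|t _]; last by rewrite big_nil.
  by rewrite Rintegral_cst // mul0r.
rewrite big_cons -IH -RintegralD //; first by apply: eq_Rintegral => t _; rewrite big_cons.
- exact: circle_integrable.
- by apply: circle_integrable; exact: continuous_sum.
Qed.

Lemma continuous_cosM (c : R) : continuous (fun t => cos (c * t)).
Proof.
move=> t; apply: continuous_comp; last exact: continuous_cos.
exact: mulrl_continuous.
Qed.

Lemma half_sineM e k c t : 2 * (half_sine e k t * half_sine e c t) =
  cos ((maxn k c - minn k c)%:R * t) - cos ((k + c + e)%:R * t).
Proof.
wlog ck : k c / (c <= k)%N.
  move=> h; case: (orP (leq_total c k)) => [/h //|kc].
  by have := h c k kc; rewrite maxnC minnC [(c + k)%N]addnC [half_sine e c t * _]mulrC.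
rewrite (maxn_idPl ck) (minn_idPr ck) /half_sine.
have -> : (k - c)%:R * t = (k.*2 + e)%:R * (t / 2) - (c.*2 + e)%:R * (t / 2) :> R.
  by rewrite natrB // !natrD -!muln2 !natrM; field.
have -> : (k + c + e)%:R * t = (k.*2 + e)%:R * (t / 2) + (c.*2 + e)%:R * (t / 2) :> R.
  by rewrite !natrD -!muln2 !natrM; field.
by rewrite cosB cosD; ring.
Qed.

Lemma half_sine_continuous e k : continuous (half_sine e k).
Proof.
move=> t; rewrite /half_sine; apply: continuous_comp; last exact: continuous_sin.
apply: cvgM; first exact: cvg_cst.
by apply: cvgMl; exact: cvg_id.
Qed.

Lemma integral_half_sineM e k c : (0 < e)%N ->
  \int[mu]_(t in circle) (2 * (half_sine e k t * half_sine e c t)) =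
  if k == c then 2 * pi else 0.
Proof.
move=> e0; rewrite (@eq_Rintegral _ _ R mu circle (fun t => cos ((maxn k c - minn k c)%:R * t) -
    cos ((k + c + e)%:R * t))) => [|t _]; last exact: half_sineM.
rewrite RintegralB //; try by apply: circle_integrable; exact: continuous_cosM.
rewrite [X in _ - X]integral_cos ?addn_gt0 ?e0 ?orbT // subr0.
have [->|kc] := eqVneq k c.
  rewrite maxnn minnn subnn (@eq_Rintegral _ _ R mu circle (fun=> 1)) => [|t _]; last by rewrite mul0r cos0.
  by rewrite Rintegral_cst // mul1r circle_measure.
by rewrite integral_cos // subn_gt0; have := kc; lia.
Qed.

(** Orthogonality of the functions half_sine e k on the circle: the matrix entry is
    a Fourier coefficient of the multiplied basis function. *)
Lemma steps_integral e bs a c : (e == 1%N) || (e == 2%N) ->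
  steps e bs a c = (2 * pi)^-1 * \int[mu]_(t in circle)
    (steps_poly bs (cos t) * (2 * (half_sine e a t * half_sine e c t))) :> R.
Proof.
move=> e12; have e0 : (0 < e)%N by case/orP: e12 => /eqP ->.
pose n := (a + size bs + c).+1.
have cS k : continuous (fun t => steps e bs a k * (2 * (half_sine e k t * half_sine e c t))).
  move=> t; apply: cvgM; first exact: cvg_cst.
  apply: cvgM; first exact: cvg_cst.
  by apply: cvgM; exact: half_sine_continuous.
rewrite (@eq_Rintegral _ _ R mu circle (fun t => \sum_(k < n) steps e bs a k * (2 * (half_sine e k t * half_sine e c t)))).
  rewrite Rintegral_sum //.
  have lt_c : (c < n)%N by rewrite /n; lia.
  rewrite (eq_bigr (fun k : 'I_n => if k == Ordinal lt_c then steps e bs a c * (2 * pi) else 0)) => [|k _].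
    by rewrite -big_mkcond big_pred1_eq /= mulrCA mulVf ?mulr1 // mulf_neq0 // gt_eqF ?pi_gt0.
  rewrite RintegralZl //; last first.
    by apply: circle_integrable => t; apply: cvgM; [exact: cvg_cst|apply: cvgM; exact: half_sine_continuous].
  rewrite integral_half_sineM // -val_eqE /=.
  by case: eqP => [->|_]; rewrite ?mulr0.
move=> t _; rewrite mulrCA mulrA mulrA -[2 * _ * _]mulrA.
rewrite (@steps_half_sine e bs a n) //; last by rewrite /n; lia.
rewrite mulr_sumr mulr_suml; apply: eq_bigr => k _; ring.
Qed.

Variables (w : Omega R) (e : nat).
Hypothesis alpha0 : forall i, alpha w i = 0.
Hypothesis e12 : (e == 1%N) || (e == 2%N).

Definition limit_kernel a c : R := (2 * pi)^-1 * \int[mu]_(t in circle)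
    (phi w (cos t) * (2 * (half_sine e a t * half_sine e c t))).

(** On the circle the variable x = cos t stays in [-1, 1], where the approximating
    polynomials are bounded by 1; this allows dominated convergence. *)
Lemma limit_kernel_dominated a c :
  mu.-integrable circle
    (EFin \o (fun t => phi w (cos t) * (2 * (half_sine e a t * half_sine e c t)))) /\
  steps e (approx w n) a c @[n --> \oo] --> limit_kernel a c.
Proof.
pose g n t := steps_poly (approx w n) (cos t) * (2 * (half_sine e a t * half_sine e c t)).
pose g0 t := phi w (cos t) * (2 * (half_sine e a t * half_sine e c t)).
have cg n : continuous (g n).
  pose m := (a + size (approx w n)).+1.
  rewrite (_ : g n = fun t => \sum_(k < m) steps e (approx w n) a k * (2 * (half_sine e k t * half_sine e c t))).
    apply: continuous_sum => k t; apply: cvgM; first exact: cvg_cst.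
    apply: cvgM; first exact: cvg_cst.
    by apply: cvgM; exact: half_sine_continuous.
  apply/funext => t; rewrite /g mulrCA mulrA mulrA -[2 * _ * _]mulrA.
  rewrite (@steps_half_sine e _ a m) //.
  rewrite mulr_sumr mulr_suml; apply: eq_bigr => k _; ring.
have gcvg t : g n t @[n --> \oo] --> g0 t.
  by apply: cvgM; [exact: approx_cvg|exact: cvg_cst].
have g_le n t : `|g n t| <= 2.
  rewrite /g normrM -[leRHS]mul1r ler_pM //.
    by apply: steps_poly_norm_le1; [exact: approx_bounds|exact: cos_max].
  by rewrite normrM ger0_norm // -[leRHS]mulr1 ler_pM // normrM mulr_ile1 // sin_max.
have mg n : measurable_fun (circle : set (measurableTypeR R)) (EFin \o g n).
  by apply/measurable_EFinP; apply: measurable_funTS; exact: continuous_measurable_fun.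
have cvgE t : circle t -> (EFin \o g n) t @[n --> \oo] --> (EFin \o g0) t.
  by move=> _; apply: cvg_EFin; [exact: nearW|exact: gcvg].
have mg0 : measurable_fun (circle : set (measurableTypeR R)) (EFin \o g0) by apply: emeasurable_fun_cvg mg cvgE.
have [] := @dominated_convergence _ _ _ mu circle _ (fun n => EFin \o g n) (EFin \o g0)
  (EFin \o cst 2) mg mg0.
- by [].
- exact: aeW.
- by apply: circle_integrable; exact: cst_continuous.
- by apply: aeW => t n _ /=; rewrite lee_fin g_le.
move=> ig0 _ h; split=> //.
rewrite (_ : (fun n => _) = fun n => (2 * pi)^-1 * \int[mu]_(t in circle) g n t); last first.
  by apply/funext => n; rewrite steps_integral.
apply: cvgM; first exact: cvg_cst.
apply: fine_cvg; rewrite fineK; last exact: integrable_fin_num.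
exact: h.
Qed.

Lemma steps_cvg a c : steps e (approx w n) a c @[n --> \oo] --> limit_kernel a c.
Proof. by case: (limit_kernel_dominated a c). Qed.

End Circle.

(** * The generator as a limit of finite-range transition matrices *)

Section Generator.
Context {R : realType}.
Variables (X : root_type) (q : R) (w : Omega R).
Notation e := (dbl_eps X).
Notation C := R[i].
Hypothesis q01 : 0 < q < 1.
Hypothesis alpha0 : forall i, alpha w i = 0.

Let q0 : 0 < q. Proof. by case/andP: q01. Qed.
Let e12 := dbl_eps12 X.
Notation p := (qroot q).

Lemma qroot01 : 0 < p < 1.
Proof.
have p0 : 0 < p by rewrite powR_gt0.
rewrite p0 /= ltNge; apply/negP => p1.
have : 1 <= p ^+ 4 by rewrite exprn_ege1.
rewrite /qroot -[_ ^+ 4]powR_mulrn ?powR_ge0 // -powRrM mulVf // powRr1 ?(ltW q0) // leNgt.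
by case/andP: q01 => _ ->.
Qed.

Let p0 : 0 < p. Proof. by case/andP: qroot01. Qed.

Lemma contour_kernel a c :
  contour_int (fun z => Psi w z
      * (hpow z ((a.*2 + e)%N : int) - hpow z (- (a.*2 + e)%:Z))
      * (hpow z ((c.*2 + e)%N : int) - hpow z (- (c.*2 + e)%:Z))^*) =
  (2 * limit_kernel w e a c)%:C.
Proof.
set F := (fun z => _).
have FE t : F (cos t +i* sin t)%C =
    (2 * (phi w (cos t) * (2 * (half_sine e a t * half_sine e c t))))%:C.
  have zE : (cos t +i* sin t)%C = cis (t / 2) ^+ 2.
    by rewrite cisX (_ : 2 * (t / 2) = t) //; field.
  rewrite /F zE; have [b hb] := sqrtC_sqr (cis (t / 2)); rewrite (@hpowE R X _ b a hb) (@hpowE R X _ b c hb).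
  have -> : Psi w (cis (t / 2) ^+ 2) = (phi w (cos t))%:C.
    by rewrite /Psi -/(two_cosh _) two_cosh_cis PhiE.
  rewrite !odd_laurent_cis; case: (b && odd e);
    rewrite ?expr1 ?expr0 ?mulN1r ?mul1r; apply/eqP; rewrite eq_complex /=;
    by apply/andP; split; apply/eqP; ring.
rewrite /contour_int; apply/eqP; rewrite eq_complex /=; apply/andP; split; apply/eqP.
  rewrite /limit_kernel [RHS]mulrCA; congr (_ * _).
  have [ig _] := limit_kernel_dominated alpha0 e12 a c.
  by rewrite -(RintegralZl _ _ ig) //; apply: eq_Rintegral => t _; rewrite FE.
rewrite (@eq_Rintegral _ _ R lebesgue_measure _ (fun=> 0)) => [|t _]; last by rewrite FE.
by rewrite Rintegral_cst // mul0r mulr0.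
Qed.

Definition label_weight N (lam mu : signature N) : R :=
  weyl_product e p (labels mu) / weyl_product e p (labels lam).

(** The Doob transform of the minors of K by the Weyl product. *)
Definition transition (K : nat -> nat -> R) (P : R -> R) N (lam mu : signature N) : R :=
  label_weight lam mu * minor K (labels lam) (labels mu) /
    \prod_(j < N) P (two_cosh (node e p j) / 2).

Definition range_transition bs := transition (steps e bs) (steps_poly bs).

Definition jump_transition := transition (limit_kernel w e) (phi w).

Lemma node_real (j : nat) : node e (p%:C : C) j = (node e p j)%:C.
Proof. by rewrite /node rmorphXn. Qed.

Lemma odd_laurent_real (x : R) a : odd_laurent e (x%:C : C) a = (odd_laurent e x a)%:C.
Proof. by rewrite /odd_laurent -rmorphXn -fmorphV -rmorphB. Qed.

Lemma two_cosh_real (x : R) : two_cosh (x%:C : C) = (two_cosh x)%:C.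
Proof. by rewrite /two_cosh -rmorphXn -fmorphV -rmorphD. Qed.

Lemma weyl_product_real N (a : 'I_N -> nat) :
  weyl_product e (p%:C : C) a = (weyl_product e p a)%:C.
Proof.
rewrite /weyl_product rmorphM !rmorph_prod; congr (_ * _).
  by apply: eq_bigr => i _; rewrite node_real odd_laurent_real rmorphN.
apply: eq_bigr => i _; rewrite rmorph_prod; apply: eq_bigr => j _.
by rewrite !node_real !two_cosh_real rmorphB.
Qed.

Lemma real_div (x y : R) : (x / y)%:C = x%:C / y%:C :> C.
Proof. by rewrite rmorphM fmorphV. Qed.

Lemma real_neq0 (x : R) : x != 0 -> x%:C != 0 :> C.
Proof. by rewrite -(rmorph0 (real_complex R)) (inj_eq (@complexI R)). Qed.

Lemma laurent_denom_neq0 N : laurent_denom X (fun j : 'I_N => node e (p%:C : C) j) != 0.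
Proof.
rewrite mulf_neq0 // prodf_seq_neq0; apply/allP => i _ /=.
  rewrite node_real odd_laurent_real real_neq0 // -oppr_eq0 gt_eqF //.
  exact: odd_laurent_node_gt0 qroot01 _.
rewrite prodf_seq_neq0; apply/allP => j _; apply/implyP => ij.
rewrite !node_real !two_cosh_real -rmorphB real_neq0 // lt_eqF // subr_lt0.
exact: two_cosh_node_lt qroot01 _ _ ij.
Qed.

Lemma fX_qcE N (lam : signature N) : fX_qc X q lam =
  weyl_sign C N * (weyl_product e p (labels lam))%:C /
    laurent_denom X (fun j : 'I_N => node e (p%:C : C) j).
Proof.
rewrite /fX_qc (_ : (fun j => _) = fun j : 'I_N => node e (p%:C : C) j ^+ 2).
  by rewrite fXE weyl_productE ?weyl_product_real // real_neq0 // gt_eqF.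
by apply/funext => j; rewrite qcXE.
Qed.

Lemma weyl_product_labels_gt0 N (lam : signature N) : 0 < weyl_product e p (labels lam).
Proof. by apply: weyl_product_gt0; [exact: e12|exact: qroot01|exact: labels_decreasing]. Qed.

Lemma fX_qc_ratio N (lam mu : signature N) :
  fX_qc X q mu / fX_qc X q lam = (label_weight lam mu)%:C.
Proof.
rewrite !fX_qcE /label_weight real_div -mulf_div -mulf_div.
by rewrite divff ?weyl_sign_neq0 // mul1r divff ?mulr1 // invr_eq0 laurent_denom_neq0.
Qed.

(** The contour integrals are twice the entries of the limit kernel, and the
    resulting factor 2^N cancels the one in the generator. *)
Lemma generatorE N (lam mu : signature N) :
  generator X q w lam mu = jump_transition lam mu - (lam == mu)%:R.
Proof.
rewrite /generator fX_qc_ratio; congr (_ - _).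
rewrite (_ : \matrix_(i, j) _ = 2 *: map_mx (real_complex R)
    (\matrix_(i < N, j < N) limit_kernel w e (labels lam i) (labels mu j))); last first.
  apply/matrixP => i j; rewrite !mxE !dbl_shiftE /=.
  by rewrite contour_kernel rmorphM rmorph_nat.
rewrite detZ det_map_mx (eq_bigr (fun j : 'I_N =>
    (phi w (two_cosh (node e p j) / 2))%:C)) => [|j _]; last first.
  rewrite /Psi qcXE // -/(two_cosh _) node_real two_cosh_real -PhiE //.
  by rewrite rmorphM fmorphV rmorph_nat.
rewrite -rmorph_prod -mulf_div divff ?mul1r; last by rewrite expf_neq0 // pnatr_eq0.
by rewrite -fmorphV -!rmorphM /= /jump_transition /transition mulrA.
Qed.

Lemma two_cosh_ge2 (x : R) : 0 < x -> 1 <= two_cosh x / 2.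
Proof.
move=> x0; rewrite ler_pdivlMr // mul1r /two_cosh.
have y0 : 0 < x ^+ 2 by rewrite exprn_gt0.
move: (x ^+ 2) y0 => y y0; rewrite -subr_ge0.
have -> : y + y^-1 - 2 = (y - 1) ^+ 2 / y by field; rewrite gt_eqF.
by rewrite divr_ge0 ?sqr_ge0 // ltW.
Qed.

Lemma node_gt0 j : 0 < node e p j.
Proof. by rewrite exprn_gt0. Qed.

Lemma phi_ge1 x : 1 <= x -> 1 <= phi w x.
Proof.
move=> x1; have h := @approx_cvg _ w alpha0 x.
rewrite -(cvg_lim (@Rhausdorff R) h); apply: limr_ge; first exact: cvgP h.
by apply: nearW => n; apply: steps_poly_ge1 x1; exact: approx_bounds.
Qed.

Lemma range_transition_ge0 bs N (lam mu : signature N) :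
  {in bs, forall c, 0 <= c <= 2^-1} -> 0 <= range_transition bs lam mu.
Proof.
move=> hb; rewrite /range_transition /transition; apply: mulr_ge0; first apply: mulr_ge0.
- by apply: divr_ge0; apply: ltW; exact: weyl_product_labels_gt0.
- exact: steps_totally_nonnegative hb _ _ _ (labels_decreasing _) (labels_decreasing _).
rewrite invr_ge0 prodr_ge0 // => j _; apply: le_trans ler01 _.
by apply: steps_poly_ge1 hb _; rewrite two_cosh_ge2 ?node_gt0.
Qed.

Lemma cvg_prodr I (r : seq I) (f : I -> nat -> R) (l : I -> R) :
  (forall i, f i @ \oo --> l i) ->
  (fun n => \prod_(i <- r) f i n) @ \oo --> \prod_(i <- r) l i.
Proof.
by move=> fl; exact: (cvg_big (@mul_continuous R) _ (fun i _ => fl i)).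
Qed.

Lemma cvg_sumr I T (F : set_system T) {FF : Filter F} (r : seq I) (f : I -> T -> R)
    (l : I -> R) : (forall i, f i @ F --> l i) ->
  (fun n => \sum_(i <- r) f i n) @ F --> \sum_(i <- r) l i.
Proof.
by move=> fl; exact: (cvg_big (@add_continuous R) FF (fun i _ => fl i)).
Qed.

Lemma range_transition_cvg N (lam mu : signature N) :
  range_transition (approx w n) lam mu @[n --> \oo] --> jump_transition lam mu.
Proof.
rewrite /range_transition /jump_transition /transition.
apply: cvgM; last apply: cvgV.
- apply: cvgM; first exact: cvg_cst.
  rewrite /minor /determinant; apply: cvg_sumr => s; apply: cvgM; first exact: cvg_cst.
  rewrite (_ : (fun n => _) = fun n => \prod_i steps e (approx w n) (labels lam i) (labels mu (s i))).
    rewrite (eq_bigr (fun i => limit_kernel w e (labels lam i) (labels mu (s i)))).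
      by apply: cvg_prodr => i; exact: steps_cvg.
    by move=> i _; rewrite mxE.
  by apply/funext => n; apply: eq_bigr => i _; rewrite mxE.
- rewrite prodf_seq_neq0; apply/allP => j _; rewrite /= gt_eqF //.
  by apply: lt_le_trans ltr01 _; apply: phi_ge1; rewrite two_cosh_ge2 ?node_gt0.
by apply: cvg_prodr => j; exact: approx_cvg.
Qed.

End Generator.

(** * Sums over signatures *)

Section SignatureSums.
Variable N : nat.
Implicit Types (lam mu : signature N).

Lemma labels_inj lam mu : labels lam =1 labels mu -> lam = mu.
Proof.
move=> h; apply: val_inj; apply: eq_from_tnth => i.
by have := h i; rewrite /labels => /addIn.
Qed.

Lemma strictly_decreasing_ge (g : 'I_N -> nat) (i : 'I_N) :
  strictly_decreasing g -> (N - i.+1 <= g i)%N.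
Proof.
move=> /strictly_decreasingP gd.
suff H k : forall j : 'I_N, (N - j.+1)%N = k -> (k <= g j)%N by exact: H.
elim: k => [//|k IH] j jk.
have j1 : (j.+1 < N)%N by have := ltn_ord j; lia.
have h2 := gd j (Ordinal j1) (ltnSn j).
have : (N - (Ordinal j1).+1)%N = k by rewrite /=; lia.
by move/IH; lia.
Qed.

Definition signature_of (g : 'I_N -> nat) : signature N :=
  insubd (Signature (sorted_nseq0 N)) [tuple (g i - (N - i.+1))%N | i < N].

Lemma labels_signature_of (g : 'I_N -> nat) : strictly_decreasing g ->
  labels (signature_of g) =1 g.
Proof.
move=> gd i; have st : sorted geq [tuple (g i - (N - i.+1))%N | i < N].
  apply/(sortedP 0%N) => k; rewrite size_tuple => kN.
  have k0 : (k < N)%N by exact: ltn_trans kN.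
  rewrite -[k]/(nat_of_ord (Ordinal k0)) -[k.+1]/(nat_of_ord (Ordinal kN)) -!tnth_nth !tnth_mktuple.
  move/strictly_decreasingP: (gd) => /(_ (Ordinal k0) (Ordinal kN) (ltnSn k)) /=.
  by have := strictly_decreasing_ge (Ordinal kN) gd; rewrite /=; lia.
rewrite /labels /signature_of /insubd insubT /= tnth_mktuple subnK //.
exact: strictly_decreasing_ge.
Qed.

(** The signatures whose labels are smaller than n. *)
Definition signatures_below (n : nat) : seq (signature N) :=
  [seq signature_of (fun i => (g : {ffun 'I_N -> 'I_n}) i) |
     g <- enum [pred g : {ffun 'I_N -> 'I_n} | strictly_decreasing (fun i => g i)]].

Lemma signatures_below_uniq n : uniq (signatures_below n).
Proof.
rewrite map_inj_in_uniq ?enum_uniq // => g h; rewrite !mem_enum !inE => gd hd gh.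
apply/ffunP => i; apply: val_inj.
by rewrite /= -(labels_signature_of gd) gh labels_signature_of.
Qed.

Lemma mem_signatures_below n mu :
  (mu \in signatures_below n) = [forall i, (labels mu i < n)%N].
Proof.
apply/mapP/forallP => [[g]|h].
  by rewrite mem_enum inE => gd -> i; rewrite labels_signature_of.
exists [ffun i => Ordinal (h i)].
  rewrite mem_enum inE; have /strictly_decreasingP d := labels_decreasing mu.
  by apply/strictly_decreasingP => i j ij; rewrite !ffunE /= d.
apply: labels_inj => i; rewrite labels_signature_of ?ffunE //.
have /strictly_decreasingP d := labels_decreasing mu.
by apply/strictly_decreasingP => k j kj; rewrite !ffunE /= d.
Qed.

Lemma steps_signature_sum (F : fieldType) (e : nat) (v : 'I_N -> F) bs lam n :
  2%:R != 0 :> F -> (forall j, v j != 0) -> (e == 1%N) || (e == 2%N) ->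
  (forall i, (labels lam i + size bs < n)%N) ->
  (\prod_j steps_poly bs (two_cosh (v j) / 2)) *
    \det (\matrix_(i, j) odd_laurent e (v j) (labels lam i)) =
  \sum_(mu <- signatures_below n) minor (steps e bs) (labels lam) (labels mu) *
     \det (\matrix_(i, j) odd_laurent e (v j) (labels mu i)).
Proof.
move=> c0 v0 e12 ln; rewrite (steps_det c0 v0 e12 ln) big_map big_enum /=.
apply: eq_bigr => g gd; congr (_ * _); rewrite ?/minor; congr determinant;
  by apply/matrixP => i j; rewrite !mxE labels_signature_of.
Qed.

Lemma minor_steps_support (F : fieldType) (e : nat) (bs : seq F) lam mu n :
  (forall i, (labels lam i + size bs < n)%N) -> mu \notin signatures_below n ->
  minor (steps e bs) (labels lam) (labels mu) = 0.
Proof.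
move=> ln; rewrite mem_signatures_below => /forallPn[j]; rewrite -leqNgt => nj.
rewrite /minor (expand_det_col _ j) big1 // => i _; rewrite mxE.
by rewrite (@steps_band F e bs) ?mul0r //; apply: leq_trans nj.
Qed.

Lemma exists_label_bound lam k : exists n, forall i, (labels lam i + k < n)%N.
Proof.
exists (\max_i labels lam i + k).+1 => i.
by rewrite ltnS leq_add2r; exact: (leq_bigmax i).
Qed.

End SignatureSums.

Section RowSums.
Context {R : realType}.
Variables (X : root_type) (q : R).
Notation e := (dbl_eps X).
Hypothesis q01 : 0 < q < 1.
Let e12 := dbl_eps12 X.
Notation p := (qroot q).
Let p01 := qroot01 q01.
Let p0 : 0 < p. Proof. by case/andP: p01. Qed.
Let two_neq0 : 2%:R != 0 :> R. Proof. by rewrite pnatr_eq0. Qed.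

Lemma poly_nodes_gt0 N (bs : seq R) (r : R) : {in bs, forall c, 0 <= c <= 2^-1} -> 0 < r ->
  1 <= \prod_(j < N) steps_poly bs (two_cosh (node e r j) / 2).
Proof.
move=> hb r0; elim/big_rec: _ => // j x _ x1; rewrite -[leLHS]mulr1 ler_pM //.
by apply: steps_poly_ge1 hb _; rewrite two_cosh_ge2 // exprn_gt0.
Qed.

Lemma steps_weyl_sum (bs : seq R) N (lam : signature N) n (r : R) : r != 0 ->
  (forall i, (labels lam i + size bs < n)%N) ->
  \sum_(mu <- signatures_below N n)
    minor (steps e bs) (labels lam) (labels mu) * weyl_product e r (labels mu) =
  (\prod_(j < N) steps_poly bs (two_cosh (node e r j) / 2)) * weyl_product e r (labels lam).
Proof.
move=> r0 ln; have := @steps_signature_sum N R e (fun j => node e r j) bs lam n two_neq0.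
move=> /(_ (fun j => expf_neq0 _ r0) e12 ln) /=; rewrite (weyl_productE e12 _ r0).
rewrite (eq_bigr (fun mu => weyl_sign R N *
    (minor (steps e bs) (labels lam) (labels mu) * weyl_product e r (labels mu)))).
  by rewrite -mulr_sumr mulrCA => /(mulfI (weyl_sign_neq0 _ _)).
by move=> mu _; rewrite (weyl_productE e12 (labels mu) r0) mulrCA.
Qed.

(** The expansion over determinants, evaluated at the principal point. *)
Lemma range_transition_sum (bs : seq R) N (lam : signature N) n :
  {in bs, forall c, 0 <= c <= 2^-1} ->
  (forall i, (labels lam i + size bs < n)%N) ->
  \sum_(mu <- signatures_below N n) range_transition X q bs lam mu = 1.
Proof.
move=> hb ln; have w0 := weyl_product_labels_gt0 X q01 lam.
have P0 := lt_le_trans ltr01 (@poly_nodes_gt0 N bs p hb p0).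
rewrite /range_transition /transition -mulr_suml.
rewrite (eq_bigr (fun mu => (weyl_product e p (labels lam))^-1 *
    (minor (steps e bs) (labels lam) (labels mu) * weyl_product e p (labels mu)))).
  by rewrite -mulr_sumr steps_weyl_sum ?gt_eqF //; field; rewrite !gt_eqF.
by move=> mu _; rewrite /label_weight; field; rewrite gt_eqF.
Qed.

(** Every Weyl product at a power of q is an eigenfunction of the minors, so the
    ratio of those at p^2 and p is, up to a factor, harmonic for the transition
    matrices; it grows at infinity and keeps their rows tight. *)
Lemma range_transition_growth (bs : seq R) N (lam : signature N) n :
  {in bs, forall c, 0 <= c <= 2^-1} ->
  (forall i, (labels lam i + size bs < n)%N) ->
  \sum_(mu <- signatures_below N n) range_transition X q bs lam mu * weyl_growth e p (labels mu)
  = weyl_growth e p (labels lam) *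
     (\prod_(j < N) steps_poly bs (two_cosh (node e (p ^+ 2) j) / 2)) /
     \prod_(j < N) steps_poly bs (two_cosh (node e p j) / 2).
Proof.
move=> hb ln; have pn : p != 0 by rewrite gt_eqF.
have w0 := weyl_product_labels_gt0 X q01 lam.
have P0 := lt_le_trans ltr01 (@poly_nodes_gt0 N bs p hb p0).
rewrite /range_transition /transition.
rewrite (eq_bigr (fun mu => (weyl_product e p (labels lam))^-1 *
  (\prod_(j < N) steps_poly bs (two_cosh (node e p j) / 2))^-1 *
    (minor (steps e bs) (labels lam) (labels mu) * weyl_product e (p ^+ 2) (labels mu)))).
  rewrite -mulr_sumr steps_weyl_sum ?expf_neq0 // (weyl_product_sqr _ _ pn).
  by field; rewrite !gt_eqF.
by move=> mu _; rewrite (weyl_product_sqr _ _ pn) /label_weight; field; rewrite !gt_eqF.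
Qed.

End RowSums.

(** * Unordered sums of nonnegative families *)

#[local] Existing Instance totally_filter.

Section UnorderedSums.
Context {R : realType} {I : choiceType}.
Implicit Types (f g c : I -> R) (s : seq I).
Local Notation "'S' f" := (\esum_(i in [set: I]) (f i)%:E)%E (at level 10, f at level 9).

Lemma esum_finite_support (f : I -> \bar R) s : uniq s -> (forall i, 0 <= f i)%E ->
  (forall i, i \notin s -> f i = 0)%E ->
  (\esum_(i in [set: I]) f i = \sum_(i <- s) f i)%E.
Proof.
move=> us f0 fs.
have -> : (\esum_(i in [set: I]) f i = \esum_(i in [set` s]) f i)%E.
  rewrite [RHS]esum_mkcond; apply: eq_esum => i _; rewrite mem_setE.
  by case: ifPn => // /fs.
by rewrite esum_fset; [rewrite -fsbig_seq|exact: finite_seq|].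
Qed.

Lemma sum_le_esum f s : uniq s -> (forall i, 0 <= f i) ->
  ((\sum_(i <- s) f i)%:E <= S f)%E.
Proof.
move=> us f0; apply: esum_ge; exists [set` s]; first by split => //; exact: finite_seq.
by rewrite -fsbig_seq // sumEFin.
Qed.

Lemma esum_le_sum f (M : R) : (forall s, uniq s -> \sum_(i <- s) f i <= M) ->
  (S f <= M%:E)%E.
Proof.
move=> h; apply: ge_ereal_sup => _ [A [finA _] <-].
by rewrite fsbig_finite // sumEFin lee_fin h // fset_uniq.
Qed.

Lemma esum_fin f s : uniq s -> (forall i, i \notin s -> f i = 0) -> (forall i, 0 <= f i) ->
  S f = (\sum_(i <- s) f i)%:E.
Proof.
move=> us fs f0; rewrite (esum_finite_support us) ?sumEFin //.
by move=> i /fs ->.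
Qed.

Lemma esum_tail_le f g s : uniq s -> (forall i, 0 <= f i <= g i) -> (S g < +oo)%E ->
  fine (S f) - \sum_(i <- s) f i <= fine (S g) - \sum_(i <- s) g i.
Proof.
move=> us fg Sg; have f0 i : 0 <= f i by case/andP: (fg i).
have gf0 i : 0 <= g i - f i by rewrite subr_ge0; case/andP: (fg i).
have SgE : S g = (S f + S (fun i => g i - f i))%E.
  rewrite -esumD; last 2 first.
  - by move=> i _ /=; rewrite lee_fin ?gf0 ?f0.
  - by move=> i _ /=; rewrite lee_fin ?gf0 ?f0.
  by apply: eq_esum => i _; rewrite -EFinD addrC subrK.
have f1 : S f \is a fin_num.
  rewrite ge0_fin_numE; last by apply: esum_ge0 => i _; rewrite lee_fin.
  apply: le_lt_trans Sg; apply: le_esum => i _; rewrite lee_fin.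
  by case/andP: (fg i).
have g1 : S (fun i => g i - f i) \is a fin_num.
  rewrite ge0_fin_numE; last by apply: esum_ge0 => i _; rewrite lee_fin.
  apply: le_lt_trans Sg; apply: le_esum => i _; rewrite lee_fin.
  by rewrite lerBlDr lerDl.
rewrite SgE fineD //.
have h := @sum_le_esum (fun i => g i - f i) s us gf0.
have : \sum_(i <- s) (g i - f i) <= fine (S (fun i => g i - f i)).
  by rewrite -lee_fin fineK.
rewrite sumrB; lra.
Qed.

Lemma partial_sumE (V : zmodType) (u : I -> V) (A : {fset I}) :
  partial_sum u A = \sum_(i <- A) u i.
Proof. by rewrite big_seq_fsetE. Qed.

(** Unconditional convergence of a nonnegative family is finiteness of the
    supremum of its finite sums. *)
Lemma esum_partial_sum f (l : R) : (forall i, 0 <= f i) ->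
  partial_sum f @ totally --> l <-> S f = l%:E.
Proof.
move=> f0.
have mono (A B : {fset I}) : (A `<=` B)%fset -> partial_sum f A <= partial_sum f B.
  move=> /fsubsetP AB; rewrite !partial_sumE.
  rewrite [leRHS](bigID (mem A)) /= -[X in X + _]big_filter.
  rewrite (perm_big [seq i <- B | i \in A]) /=; last first.
    apply: uniq_perm; rewrite ?filter_uniq ?fset_uniq // => i.
    by rewrite mem_filter; apply/idP/andP => [iA|[]//]; split => //; exact: AB.
  by rewrite lerDl sumr_ge0.
have cvgS : forall M, S f = M%:E -> partial_sum f @ totally --> M.
  move=> M SM; apply/cvgrPdist_le => eps eps0.
  have Sf : S f \is a fin_num by rewrite SM.
  have [_ [A [finA _] <-] hA] := ub_ereal_sup_adherent eps0 Sf.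
  rewrite -/(S f) SM fsbig_finite // sumEFin -EFinB lte_fin in hA.
  exists (fset_set A) => // B AB; have := mono _ _ AB; rewrite partial_sumE => h1.
  have h2 : partial_sum f B <= M.
    by rewrite partial_sumE -lee_fin -SM sum_le_esum // fset_uniq.
  rewrite ler_norml; apply/andP; split; lra.
split=> [fl|]; last exact: cvgS.
have le_l s : uniq s -> \sum_(i <- s) f i <= l.
  move=> us; rewrite -(cvg_lim (@Rhausdorff R) fl); apply: limr_ge; first exact: cvgP fl.
  exists [fset i in s]%fset => // B sB; have := mono _ _ sB; apply: le_trans.
  rewrite partial_sumE; rewrite [leRHS](perm_big s) //; apply: uniq_perm => //.
  by move=> i; rewrite in_fset.
have Sl := esum_le_sum le_l.
have Sfin : S f \is a fin_num.
  rewrite ge0_fin_numE; last by apply: esum_ge0 => i _; rewrite lee_fin.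
  exact: le_lt_trans Sl (ltry _).
have := cvgS (fine (S f)); rewrite fineK // => /(_ erefl).
move=> fS; rewrite -(fineK Sfin); congr _%:E.
by rewrite -(cvg_lim (@Rhausdorff R) fS) (cvg_lim (@Rhausdorff R) fl).
Qed.

(** Dominated convergence for sums with weights of total mass one: weights that
    converge without loss of mass at infinity, against bounded coefficients. *)
Lemma tannery (p : nat -> I -> R) (p0 : I -> R) (c : nat -> I -> R) (c0 : I -> R) :
  (forall n i, 0 <= p n i) -> (forall n, S (p n) = 1%E) ->
  (forall i, p n i @[n --> \oo] --> p0 i) ->
  (forall eps : R, 0 < eps -> exists2 s, uniq s & forall n, 1 - eps <= \sum_(i <- s) p n i) ->
  (forall n i, 0 <= c n i <= 1) -> (forall i, c n i @[n --> \oo] --> c0 i) ->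
  S p0 = 1%E /\
  fine (S (fun i => p n i * c n i)) @[n --> \oo] --> fine (S (fun i => p0 i * c0 i)).
Proof.
move=> p_ge0 p1 pcvg tight c01 ccvg.
have lim_ge0 (u : nat -> R) l m : u @ \oo --> l -> (forall n, m <= u n) -> m <= l.
  move=> ul h; rewrite -(cvg_lim (@Rhausdorff R) ul); apply: limr_ge; first exact: cvgP ul.
  exact: nearW.
have lim_le0 (u : nat -> R) l m : u @ \oo --> l -> (forall n, u n <= m) -> l <= m.
  move=> ul h; rewrite -(cvg_lim (@Rhausdorff R) ul); apply: limr_le; first exact: cvgP ul.
  exact: nearW.
have p0_ge0 i : 0 <= p0 i by exact: lim_ge0 (pcvg i) _.
have c0_01 i : 0 <= c0 i <= 1.
  apply/andP; split; first by apply: lim_ge0 (ccvg i) _ => n; case/andP: (c01 n i).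
  by apply: lim_le0 (ccvg i) _ => n; case/andP: (c01 n i).
have sum_cvg s : \sum_(i <- s) p n i @[n --> \oo] --> \sum_(i <- s) p0 i.
  exact: cvg_sumr.
have p_le1 n s : uniq s -> \sum_(i <- s) p n i <= 1.
  by move=> us; rewrite -lee_fin -(p1 n) sum_le_esum.
have p0_le1 s : uniq s -> \sum_(i <- s) p0 i <= 1.
  by move=> us; apply: lim_le0 (sum_cvg s) _ => n; exact: p_le1.
have p0_tight eps s : (forall n, 1 - eps <= \sum_(i <- s) p n i) -> 1 - eps <= \sum_(i <- s) p0 i.
  by move=> h; exact: lim_ge0 (sum_cvg s) h.
have Sp0 : S p0 = 1%E.
  apply/eqP; rewrite eq_le; apply/andP; split; first exact: esum_le_sum.
  apply/lee_addgt0Pr => eps eps0; have [s us hs] := tight _ eps0.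
  rewrite -leeBlDr // (le_trans _ (sum_le_esum us p0_ge0)) // -EFinB lee_fin.
  exact: p0_tight.
split=> //; apply/cvgR_absP => eps eps0.
have e4 : 0 < eps / 4 by rewrite divr_gt0.
have [s us hs] := tight _ e4.
have [n0 hn0] : exists n0, forall n, (n0 <= n)%N ->
    `|\sum_(i <- s) p n i * c n i - \sum_(i <- s) p0 i * c0 i| <= eps / 4.
  have /cvgR_absP : \sum_(i <- s) p n i * c n i @[n --> \oo] --> \sum_(i <- s) p0 i * c0 i.
    by apply: cvg_sumr => i; exact: cvgM.
  exact.
exists n0 => n /hn0 hn.
have lt1 (g : I -> R) : S g = 1%E -> (S g < +oo)%E by move=> ->; rewrite ltry.
have tail (g cc : I -> R) : (forall i, 0 <= g i) -> (forall i, 0 <= cc i <= 1) -> S g = 1%E ->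
    1 - eps / 4 <= \sum_(i <- s) g i ->
    0 <= fine (S (fun i => g i * cc i)) - \sum_(i <- s) g i * cc i <= eps / 4.
  move=> g0 cc01 Sg gs.
  have gc0 i : 0 <= g i * cc i by rewrite mulr_ge0 //; case/andP: (cc01 i).
  have gc1 i : g i * cc i <= g i by rewrite ler_piMr //; case/andP: (cc01 i).
  have := @esum_tail_le (fun i => g i * cc i) g s us.
  rewrite Sg ltry => /(_ (fun i => ltac:(by rewrite gc0 gc1)) isT) /= h.
  apply/andP; split; last by apply: le_trans h _; lra.
  rewrite subr_ge0 -lee_fin fineK ?sum_le_esum //.
  rewrite ge0_fin_numE; last by apply: esum_ge0 => i _; rewrite lee_fin.
  apply: le_lt_trans (_ : S g < _)%E; last exact: lt1.
  by apply: le_esum => i _; rewrite lee_fin.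
have /andP[t1 t2] := tail (p n) (c n) (p_ge0 n) (c01 n) (p1 n) (hs n).
have /andP[t3 t4] := tail p0 c0 p0_ge0 c0_01 Sp0 (p0_tight _ _ hs).
move: hn; rewrite !ler_norml => /andP[h1 h2]; apply/andP; split; lra.
Qed.

End UnorderedSums.

(** * Tightness of the approximating rows *)

Lemma sum_subset_le (R : numDomainType) (I : eqType) (s1 s2 : seq I) (f : I -> R) :
  uniq s1 -> uniq s2 -> {subset s1 <= s2} -> (forall i, 0 <= f i) ->
  \sum_(i <- s1) f i <= \sum_(i <- s2) f i.
Proof.
move=> u1 u2 s12 f0; rewrite [leRHS](bigID (mem s1)) /= -[X in X + _]big_filter.
rewrite [X in _ <= X + _](perm_big s1) /=; last first.
  apply: uniq_perm; rewrite ?filter_uniq // => i.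
  by rewrite mem_filter; apply/andP/idP => [[]//|is1]; split => //; exact: s12.
by rewrite lerDl sumr_ge0.
Qed.

Section TransitionLimit.
Context {R : realType}.
Variables (X : root_type) (q : R) (w : Omega R).
Notation e := (dbl_eps X).
Hypothesis q01 : 0 < q < 1.
Hypothesis alpha0 : forall i, alpha w i = 0.
Let e12 := dbl_eps12 X.
Notation p := (qroot q).
Let p01 := qroot01 q01.
Let p0 : 0 < p. Proof. by case/andP: p01. Qed.
Notation T := (range_transition X q).

Lemma range_transition_esum (bs : seq R) N (lam : signature N) :
  {in bs, forall c, 0 <= c <= 2^-1} ->
  (\esum_(mu in [set: signature N]) (T bs lam mu)%:E = 1)%E.
Proof.
move=> hb; have [n hn] := exists_label_bound lam (size bs).
rewrite (esum_fin (signatures_below_uniq N n)).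
- by rewrite range_transition_sum.
- move=> mu mun; rewrite /range_transition /transition (@minor_steps_support N R e bs lam mu n hn mun).
  by rewrite mulr0 mul0r.
- by move=> mu; exact: range_transition_ge0.
Qed.

(** Markov's inequality for the growth function, whose mean stays bounded along the
    approximations. *)
Lemma range_transition_tight N (lam : signature N.+1) (eps : R) : 0 < eps ->
  exists2 s, uniq s & forall n, 1 - eps <= \sum_(mu <- s) T (approx w n) lam mu.
Proof.
move=> eps0; pose P n := \prod_(j < N.+1) steps_poly (approx w n) (two_cosh (node e (p ^+ 2) j) / 2).
have [B B0 hB] : exists2 B, 0 < B & forall n, P n <= B.
  have cP : cvgn P by apply: cvgP; apply: cvg_prodr => j; exact: approx_cvg.
  have [B [_ hB]] := cvg_seq_bounded cP.
  exists (`|B| + 1); first by rewrite ltr_wpDl.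
  move=> n; apply: le_trans (ler_norm _) (hB _ _ n I).
  by rewrite (le_lt_trans (ler_norm _)) // ltrDl.
pose G := weyl_growth e p (labels lam).
have G0 : 0 < G by apply: lt_le_trans (weyl_growth_ge e12 p01 (labels lam) ord0); rewrite invr_gt0 exprn_gt0.
have GB0 : 0 < G * B := mulr_gt0 G0 B0.
have [k hk] : exists k, p ^+ k * (G * B) <= eps.
  have p1 : `|p| < 1 by rewrite gtr0_norm //; case/andP: p01.
  have /cvgR_absP := cvg_expr p1.
  move=> /(_ (eps / (G * B))) []; first exact: divr_gt0.
  move=> k /(_ k (leqnn _)); rewrite subr0 ger0_norm ?exprn_ge0 ?(ltW p0) //.
  by rewrite (ler_pdivlMr _ _ GB0) => hk; exists k.
exists (signatures_below N.+1 k); first exact: signatures_below_uniq.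
move=> n; have hb := approx_bounds (w := w) (n := n); have [m hm] := exists_label_bound lam (size (approx w n)).
have T0 mu : 0 <= T (approx w n) lam mu by apply: range_transition_ge0.
have pk0 : 0 < p ^+ k by rewrite exprn_gt0.
rewrite lerBlDr -[leLHS](range_transition_sum X q01 hb hm).
rewrite (bigID (mem (signatures_below N.+1 k))) /= lerD //.
  rewrite -big_filter; apply: sum_subset_le; rewrite ?filter_uniq ?signatures_below_uniq //.
  by move=> mu; rewrite mem_filter => /andP[].
apply: le_trans hk; apply: (@le_trans _ _ (p ^+ k * \sum_(mu <- signatures_below N.+1 m)
    T (approx w n) lam mu * weyl_growth e p (labels mu))).
  rewrite mulr_sumr [leRHS](bigID (mem (signatures_below N.+1 k))) /=.
  rewrite -[leLHS]add0r lerD //.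
    apply: sumr_ge0 => mu _; apply: mulr_ge0; first exact: ltW.
    apply: mulr_ge0 => //; apply: le_trans (weyl_growth_ge e12 p01 (labels mu) ord0).
    by rewrite invr_ge0 exprn_ge0 // ltW.
  apply: ler_sum => mu; rewrite mem_signatures_below => /forallPn[j]; rewrite -leqNgt => kj.
  rewrite mulrCA ler_peMr // -ler_pdivrMl // mulr1.
  apply: le_trans (weyl_growth_ge e12 p01 (labels mu) j).
  by rewrite lef_pV2 ?posrE ?exprn_gt0 // ler_wiXn2l ?(ltW p0) //; case/andP: p01 => _ /ltW.
rewrite ler_pM2l // (range_transition_growth X q01 hb hm) -mulrA ler_pM2l //.
have Q1 := @poly_nodes_gt0 R X N.+1 (approx w n) p hb p0.
apply: le_trans (hB n); rewrite ler_pdivrMr ?(lt_le_trans ltr01) // ler_peMr //.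
exact: le_trans ler01 (@poly_nodes_gt0 R X N.+1 (approx w n) (p ^+ 2) hb (exprn_gt0 2 p0)).
Qed.

Lemma jump_transition_ge0 N (lam mu : signature N) : 0 <= jump_transition X q w lam mu.
Proof.
have h := @range_transition_cvg R X q w q01 alpha0 N lam mu.
rewrite -(cvg_lim (@Rhausdorff R) h); apply: limr_ge; first exact: cvgP h.
by apply: nearW => n; apply: range_transition_ge0 => //; exact: approx_bounds.
Qed.

Lemma jump_transition_esum_cvg N (lam : signature N.+1) (c : signature N.+1 -> R) :
  (forall mu, 0 <= c mu <= 1) ->
  (\esum_(mu in [set: signature N.+1]) (jump_transition X q w lam mu)%:E = 1)%E /\
  fine (\esum_(mu in [set: signature N.+1]) (T (approx w n) lam mu * c mu)%:E) @[n --> \oo] -->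
  fine (\esum_(mu in [set: signature N.+1]) (jump_transition X q w lam mu * c mu)%:E).
Proof.
move=> c01; apply: (tannery (c := fun=> c)).
- by move=> n mu; apply: range_transition_ge0 => //; exact: approx_bounds.
- by move=> n; apply: range_transition_esum; exact: approx_bounds.
- by move=> mu; exact: range_transition_cvg.
- by move=> eps; exact: range_transition_tight.
- by [].
- by move=> mu; exact: cvg_cst.
Qed.

Lemma jump_transition_esum N (lam : signature N.+1) :
  (\esum_(mu in [set: signature N.+1]) (jump_transition X q w lam mu)%:E = 1)%E.
Proof.
have c01 (mu : signature N.+1) : 0 <= (0 : R) <= 1 by rewrite lexx ler01.
by case: (jump_transition_esum_cvg lam c01).
Qed.

End TransitionLimit.

(** * Fourier coefficients on the torus *)

Lemma cvg_lincomb {R : realType} {T : Type} (F : set_system T) {FF : Filter F} (J : Type)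
    (s : seq J) (a : J -> R[i]) (g : J -> T -> R[i]) (l : J -> R[i]) :
  (forall j, g j @ F --> l j) ->
  (fun x => \sum_(j <- s) a j * g j x) @ F --> \sum_(j <- s) a j * l j.
Proof.
move=> gl; have h j : (fun x => a j * g j x) @ F --> a j * l j.
  by apply: (@cvgM R[i] T F); [exact: cvg_cst|exact: gl].
exact: (cvg_big (@add_continuous R[i]) FF (fun j _ => h j)).
Qed.

Lemma continuous_Re {R : realType} : continuous (@complex.Re R : R[i] -> R).
Proof.
move=> z A /nbhs_ballP[eps /= eps0 zA]; apply/nbhs_ballP.
exists eps%:C => /=; first by rewrite ltcR.
move=> t; rewrite -ball_normE /ball_ /= normC_nrm ltcR => h; apply: zA.
rewrite -ball_normE /ball_ /=; apply: le_lt_trans h.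
by rewrite -raddfB; exact: Re_le_nrm.
Qed.

Lemma increasing_perm N (a b : 'I_N -> nat) (s : {perm 'I_N}) :
  strictly_decreasing a -> strictly_decreasing b -> (forall j, a (s j) = b j) -> s = 1%g.
Proof.
move=> ad bd ab; pose P (t : {perm 'I_N}) := strictly_decreasing (fun i => a (t i)).
have Ps : P s.
  move/strictly_decreasingP: bd => bd; apply/strictly_decreasingP => i j ij.
  by rewrite !ab bd.
have P1 : P 1%g.
  move/strictly_decreasingP: ad => ad; apply/strictly_decreasingP => i j ij.
  by rewrite !perm1 ad.
have := @sum_sorting_perm nat N a 1%N (strictly_decreasing_inj ad).
rewrite sum1_card => /eqP /card1P [t ht].
have /eqP st : s \in pred1 t by rewrite -ht; exact: Ps.
have /eqP t1 : 1%g \in pred1 t by rewrite -ht; exact: P1.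
by rewrite st -t1.
Qed.

Lemma torus_field (F : fieldType) (s A B L0 L1 P W M D : F) :
  s != 0 -> B != 0 -> L0 != 0 -> L1 != 0 ->
  s * A / L0 / P / M * (L1 / W) * (D / L1 / (s * B / L0)) = A / B / P / M * (D / W).
Proof.
move=> s0 B0 L00 L10.
have -> : D / L1 / (s * B / L0) = D * (L1^-1 * (s^-1 * B^-1 * L0)).
  by rewrite !invfM invrK; ring.
have -> : s * A / L0 / P / M * (L1 / W) * (D * (L1^-1 * (s^-1 * B^-1 * L0))) =
  (s * s^-1) * (L0^-1 * L0) * (L1 * L1^-1) * (A / B / P / M * (D / W)) by ring.
by rewrite mulVf // !divff // !mul1r.
Qed.

Section Torus.
Context {R : realType}.
Variables (X : root_type) (q : R).
Notation e := (dbl_eps X).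
Notation C := R[i].
Hypothesis q01 : 0 < q < 1.
Let e12 := dbl_eps12 X.
Notation p := (qroot q).
Let p01 := qroot01 q01.
Let p0 : 0 < p. Proof. by case/andP: p01. Qed.
Let q0 : 0 < q. Proof. by case/andP: q01. Qed.
Let e0 : (0 < e)%N. Proof. by case/orP: e12 => /eqP ->. Qed.

Variables (N : nat) (kappa : signature N).

Let r (j : 'I_N) : C := node e (p%:C : C) j.

Definition root_of_unity m : C := sval (cid (@exists_primitive_root R[i] m.+1 isT)).

Lemma root_of_unityP m : m.+1.-primitive_root (root_of_unity m).
Proof. by rewrite /root_of_unity; case: cid. Qed.

Lemma root_of_unity_neq0 m : root_of_unity m != 0.
Proof. exact: prim_root_unity_neq0 (root_of_unityP m). Qed.

Lemma nrm_root_of_unity m : `|root_of_unity m| = 1.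
Proof.
apply/eqP; rewrite -(@eqrXn2 _ m.+1) // -normrX (prim_expr_order (root_of_unityP m)).
by rewrite normr1 expr1n.
Qed.

Definition torus_point m (f : {ffun 'I_N -> 'I_m.+1}) (j : 'I_N) : C :=
  root_of_unity m ^+ f j.

Lemma torus_point_neq0 m f j : @torus_point m f j != 0.
Proof. by rewrite expf_neq0 // root_of_unity_neq0. Qed.

Lemma nrm_torus_point m f j : `|@torus_point m f j| = 1.
Proof. by rewrite normrX nrm_root_of_unity expr1n. Qed.

Definition target_exponent (j : 'I_N) : nat := ((labels kappa j).*2 + e)%N.

Definition torus_coef m (f : {ffun 'I_N -> 'I_m.+1}) : C :=
  weyl_sign C N * (weyl_product e p (labels kappa))%:C / laurent_denom X r
    / (\prod_j r j ^+ target_exponent j) / m.+1%:R ^+ N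
    * (laurent_denom X (fun j => r j * torus_point f j)
       / \prod_j torus_point f j ^+ target_exponent j).

(** Extraction of the coefficient of g_kappa in an expansion over the g_mu: after
    multiplication by the denominator, a discrete Fourier coefficient over a
    finite subgroup of the torus. *)
Definition torus_average m (h : ('I_N -> C) -> C) : C :=
  \sum_(f : {ffun 'I_N -> 'I_m.+1}) torus_coef f * h (fun j => torus_point f j ^+ 2).

Lemma real_node j : `|r j| = (node e p j)%:C.
Proof.
rewrite /r node_real ger0_norm // -(rmorph0 (real_complex R)) lecR ltW //.
exact: node_gt0.
Qed.

Lemma rneq0 j : r j != 0.
Proof. by rewrite /r node_real real_neq0 // gt_eqF // node_gt0. Qed.

Lemma node_lt (i j : nat) : (i < j)%N -> node e p j < node e p i.
Proof.
by move=> ij; rewrite /node ltr_iXn2l //; [rewrite ltn_add2r ltn_double|case/andP: p01].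
Qed.

(** The points r_j u_j have distinct moduli, all smaller than one. *)
Lemma torus_denom_neq0 m (f : {ffun 'I_N -> 'I_m.+1}) :
  laurent_denom X (fun j => r j * torus_point f j) != 0.
Proof.
have nv j : `|r j * torus_point f j| = (node e p j)%:C.
  by rewrite normrM nrm_torus_point mulr1 real_node.
have v0 j : r j * torus_point f j != 0 by rewrite mulf_neq0 ?rneq0 ?torus_point_neq0.
have n1 (j : nat) : node e p j < 1.
  rewrite exprn_ilt1 ?ltW //; last by case/andP: p01.
  by rewrite addn_eq0 negb_and -!lt0n e0 orbT.
have lt1 j n : (0 < n)%N -> `|r j * torus_point f j| ^+ n != 1.
  move=> n0; rewrite nv -rmorphXn /= -(rmorph1 (real_complex R)) (inj_eq (@complexI R)).
  by rewrite lt_eqF // exprn_ilt1 ?n1 // ?ltW ?node_gt0 // -lt0n.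
rewrite mulf_neq0 // prodf_seq_neq0; apply/allP => i _ /=.
  rewrite /odd_laurent double0 add0n; have := v0 i; have := lt1 i (e + e)%N.
  move: (r i * _) => v; rewrite addn_gt0 e0 => /(_ isT) h vn0.
  rewrite subr_eq0; apply: contra h => /eqP ve.
  by rewrite -normrX exprD {1}ve mulVf ?normr1 // expf_neq0.
rewrite prodf_seq_neq0; apply/allP => j _; apply/implyP => ij.
have := v0 i; have := v0 j; have := nv i; have := nv j.
move: (r i * _) (r j * _) => v v' nv' nvv v'0 vv0.
have -> : two_cosh v - two_cosh v' = (v ^+ 2 - v' ^+ 2) * (1 - (v * v') ^- 2).
  by rewrite /two_cosh; field; rewrite vv0 v'0.
rewrite mulf_neq0 // subr_eq0.
  apply/eqP => vv; have : `|v| ^+ 2 = `|v'| ^+ 2 by rewrite -!normrX vv.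
  rewrite nv' nvv -!rmorphXn /= => /complexI/eqP.
  by rewrite eqrXn2 ?ltW ?node_gt0 // gt_eqF // node_lt.
apply/eqP => /esym vv; have : `|v * v'| ^+ 2 = 1.
  by rewrite -normrX -[LHS]invrK -normfV vv normr1 invr1.
rewrite normrM nv' nvv -rmorphM -rmorphXn /= -(rmorph1 (real_complex R)) => /complexI/eqP.
rewrite pexpr_eq1 ?mulr_ge0 ?(ltW (node_gt0 _ _ _)) //.
by rewrite lt_eqF // mulr_ilt1 ?n1 ?ltW ?node_gt0.
Qed.

Lemma gX_sqrE M (lam : signature M) (u : 'I_M -> C) :
  gX X q lam (fun j => u j ^+ 2) =
  \det (\matrix_(i, j) odd_laurent e (node e (p%:C : C) j * u j) (labels lam i)) /
    laurent_denom X (fun j => node e (p%:C : C) j * u j) /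
  (weyl_sign C M * (weyl_product e p (labels lam))%:C /
    laurent_denom X (fun j : 'I_M => node e (p%:C : C) j)).
Proof.
rewrite /gX fX_qcE // (_ : (fun j => _) = fun j : 'I_M => (node e (p%:C : C) j * u j) ^+ 2).
  by rewrite fXE.
by apply/funext => j; rewrite qcXE // exprMn.
Qed.

Lemma weyl_product_neq0 M (mu : signature M) : (weyl_product e p (labels mu))%:C != 0 :> C.
Proof. by rewrite real_neq0 // gt_eqF // weyl_product_labels_gt0. Qed.

Lemma torus_average_gXE m (mu : signature N) :
  torus_average m (gX X q mu) =
  (weyl_product e p (labels kappa))%:C / (weyl_product e p (labels mu))%:C
    / (\prod_j r j ^+ target_exponent j) / m.+1%:R ^+ N *
  \sum_(f : {ffun 'I_N -> 'I_m.+1})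
    \det (\matrix_(i, j) odd_laurent e (r j * torus_point f j) (labels mu i)) /
    \prod_j torus_point f j ^+ target_exponent j.
Proof.
rewrite /torus_average mulr_sumr; apply: eq_bigr => f _.
rewrite gX_sqrE /torus_coef.
apply: torus_field; rewrite ?torus_denom_neq0 ?weyl_sign_neq0 ?weyl_product_neq0 //.
exact: laurent_denom_neq0.
Qed.

Lemma det_odd_laurent_expand (v : 'I_N -> C) (a : 'I_N -> nat) :
  \det (\matrix_(i, j) odd_laurent e (v j) (a i)) =
  \sum_(s : {perm 'I_N}) (-1) ^+ s * \prod_j odd_laurent e (v j) (a (s j)).
Proof.
rewrite -det_tr; apply: eq_bigr => s _; congr (_ * _).
by apply: eq_bigr => j _; rewrite !mxE.
Qed.

Lemma sum_odd_laurent_root m (x : C) a K : (0 < K)%N -> (a.*2 + e + K < m.+1)%N ->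
  \sum_(k < m.+1) odd_laurent e (x * root_of_unity m ^+ k) a / (root_of_unity m ^+ k) ^+ K =
  m.+1%:R * (if (a.*2 + e)%N == K then x ^+ K else 0).
Proof.
set z := root_of_unity m; set L := (a.*2 + e)%N => K0 LK.
have pz : m.+1.-primitive_root z := root_of_unityP m.
have z0 : z != 0 := root_of_unity_neq0 m.
rewrite (eq_bigr (fun k : 'I_m.+1 => x ^+ L * (z ^+ (L * k) / z ^+ (K * k)) -
   x ^- L * (z ^+ (0 * k) / z ^+ ((L + K) * k)))) => [|k _].
  have S1 := sum_prim_root pz (leq_ltn_trans (leq_addr K L) LK) (leq_ltn_trans (leq_addl L K) LK).
  have S2 := sum_prim_root pz (ltn0Sn m) LK.
  rewrite sumrB -mulr_sumr S1 -mulr_sumr S2.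
  have -> : (0 == L + K)%N = false by apply/negbTE; rewrite eq_sym -lt0n addn_gt0 K0 orbT.
  rewrite mulr0 subr0 mulrC; case: eqP => [->|_]; first by [].
  by rewrite !mulr0 mul0r.
rewrite /odd_laurent -/L mulrBl !exprMn invfM -!exprM mul0n expr0 mul1r.
rewrite mulnDl exprD invfM ![(k * _)%N]mulnC !mulrA.
by rewrite -!mulrA.
Qed.

(** The discrete Fourier coefficient is exact once m exceeds all exponents, and
    then only a permutation that matches the two families of labels contributes. *)
Lemma torus_average_gX_large m (mu : signature N) :
  (forall i j, (labels mu i).*2 + e + target_exponent j < m.+1)%N ->
  torus_average m (gX X q mu) = (mu == kappa)%:R.
Proof.
move=> hm; rewrite torus_average_gXE.
have M0 : m.+1%:R ^+ N != 0 :> C by rewrite expf_neq0 // pnatr_eq0.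
pose W := \prod_j r j ^+ target_exponent j.
have W0 : W != 0 by rewrite prodf_seq_neq0; apply/allP => j _; rewrite /= expf_neq0 // rneq0.
have -> : \sum_(f : {ffun 'I_N -> 'I_m.+1})
    \det (\matrix_(i, j) odd_laurent e (r j * torus_point f j) (labels mu i)) /
    \prod_j torus_point f j ^+ target_exponent j =
  m.+1%:R ^+ N * ((mu == kappa)%:R * W).
  transitivity (\sum_(f : {ffun 'I_N -> 'I_m.+1}) \sum_(s : {perm 'I_N}) (-1) ^+ s *
      \prod_j (odd_laurent e (r j * root_of_unity m ^+ f j) (labels mu (s j)) /
        (root_of_unity m ^+ f j) ^+ target_exponent j)).
    apply: eq_bigr => f _; rewrite det_odd_laurent_expand mulr_suml.
    by apply: eq_bigr => s _; rewrite prodf_div mulrA.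
  rewrite exchange_big /=.
  transitivity (\sum_(s : {perm 'I_N}) m.+1%:R ^+ N * ((-1) ^+ s *
      \prod_j (if ((labels mu (s j)).*2 + e)%N == target_exponent j
               then r j ^+ target_exponent j else 0) : C)).
    apply: eq_bigr => s _; rewrite -mulr_sumr mulrCA; congr (_ * _).
    rewrite -(bigA_distr_bigA (fun j (k : 'I_m.+1) =>
      odd_laurent e (r j * root_of_unity m ^+ k) (labels mu (s j)) /
        (root_of_unity m ^+ k) ^+ target_exponent j)) /=.
    rewrite -[X in _ = X * _](_ : \prod_(j < N) m.+1%:R = m.+1%:R ^+ N); last first.
      by rewrite prodr_const card_ord.
    rewrite -big_split; apply: eq_bigr => j _ /=.
    by rewrite sum_odd_laurent_root // /target_exponent addn_gt0 e0 orbT.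
  rewrite -mulr_sumr; congr (_ * _).
  have prod0 (s : {perm 'I_N}) : (exists j, labels mu (s j) != labels kappa j) ->
      \prod_j (if ((labels mu (s j)).*2 + e)%N == target_exponent j
               then r j ^+ target_exponent j else 0) = 0 :> C.
    move=> [j /negPf hj]; rewrite (bigD1 j) //= /target_exponent eqn_add2r.
    by rewrite (inj_eq double_inj) hj mul0r.
  have [mk|mk] := eqVneq mu kappa.
    rewrite (bigD1 1%g) //= [X in _ + X]big1 ?addr0 => [|s s1].
      rewrite odd_perm1 expr0 !mul1r; apply: eq_bigr => j _.
      by rewrite perm1 mk /target_exponent eqxx.
    rewrite prod0 ?mulr0 //; apply/existsP; apply: contraNT s1 => /existsPn h.
    apply/eqP; apply: (increasing_perm (labels_decreasing mu) (labels_decreasing kappa)).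
    by move=> j; apply/eqP; move: (h j); rewrite negbK.
  rewrite mul0r big1 // => s _; rewrite prod0 ?mulr0 //.
  apply/existsP; apply: contraNT mk => /existsPn h; apply/eqP.
  have lk j : labels mu (s j) = labels kappa j by apply/eqP; move: (h j); rewrite negbK.
  have s1 := increasing_perm (labels_decreasing mu) (labels_decreasing kappa) lk.
  by apply: labels_inj => j; rewrite -lk s1 perm1.
rewrite -/W; have wk := weyl_product_neq0 kappa.
have [->|_] := eqVneq mu kappa; last by rewrite !mul0r !mulr0.
by rewrite divff // !mul1r mulrA divfK // mulVf.
Qed.

(** The bound on odd determinants by Weyl products makes the functions g_mu bounded
    on the torus uniformly in mu, and with them all the averages. *)
Lemma torus_average_bounded : exists D : R, forall m (mu : signature N),
  nrm (torus_average m (gX X q mu)) <= D.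
Proof.
have pC : (0 : C) < p%:C < 1 by rewrite -[0 : C]/(0%:C) -[1 : C]/(1%:C) !ltcR.
have [c c0 hc] := odd_laurent_det_bound e12 pC N.
pose W := \prod_j r j ^+ target_exponent j.
have W0 : W != 0 by rewrite prodf_seq_neq0; apply/allP => j _; rewrite /= expf_neq0 // rneq0.
pose D : C := (weyl_product e p (labels kappa))%:C / `|W| * c.
have D0 : 0 <= D.
  rewrite mulr_ge0 ?(ltW c0) // divr_ge0 ?normr_ge0 //.
  by rewrite -[0 : C]/(0%:C) lecR ltW // weyl_product_labels_gt0.
exists (complex.Re D) => m mu.
rewrite -lecR RRe_real ?ger0_real // -normC_nrm torus_average_gXE.
have wm : 0 < (weyl_product e p (labels mu))%:C :> C.
  by rewrite -[0 : C]/(0%:C) ltcR weyl_product_labels_gt0.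
have wk : 0 < (weyl_product e p (labels kappa))%:C :> C.
  by rewrite -[0 : C]/(0%:C) ltcR weyl_product_labels_gt0.
rewrite -/W normrM !normrM !normfV normrX normr_nat (gtr0_norm wm) (gtr0_norm wk).
apply: (@le_trans _ _ ((weyl_product e p (labels kappa))%:C / (weyl_product e p (labels mu))%:C /
   `|W| / m.+1%:R ^+ N * (\sum_(f : {ffun 'I_N -> 'I_m.+1}) c * (weyl_product e p (labels mu))%:C))).
  rewrite ler_wpM2l //.
    by rewrite !divr_ge0 ?exprn_ge0 ?(ltW wk) ?(ltW wm).
  apply: (le_trans (ler_norm_sum _ _ _)); apply: ler_sum => f _.
  rewrite normrM normfV normr_prod big1 ?invr1 ?mulr1 => [|j _]; last first.
    by rewrite normrX nrm_torus_point expr1n.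
  rewrite -weyl_product_real; apply: hc; first exact: labels_decreasing.
  by move=> j; rewrite normrM nrm_torus_point mulr1 real_node /r node_real.
rewrite sumr_const card_ffun !card_ord -[X in _ * X]mulr_natr natrX /D.
have M0 : m.+1%:R ^+ N != 0 :> C by rewrite expf_neq0 // pnatr_eq0.
have nW0 : `|W| != 0 by rewrite normr_eq0.
by rewrite le_eqVlt; apply/orP; left; apply/eqP; field; rewrite M0 nW0 gt_eqF.
Qed.

Lemma torus_average_lin m J (s : seq J) (a : J -> C) (h : J -> ('I_N -> C) -> C) :
  torus_average m (fun z => \sum_(j <- s) a j * h j z) =
  \sum_(j <- s) a j * torus_average m (h j).
Proof.
rewrite /torus_average; under eq_bigr => f _ do rewrite mulr_sumr.
rewrite exchange_big; apply: eq_bigr => j _; rewrite mulr_sumr.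
by apply: eq_bigr => f _; rewrite mulrCA.
Qed.

Lemma torus_average_ext m (h h' : ('I_N -> C) -> C) :
  (forall u : 'I_N -> C, (forall j, `|u j| = 1) ->
     h (fun j => u j ^+ 2) = h' (fun j => u j ^+ 2)) ->
  torus_average m h = torus_average m h'.
Proof.
move=> hh'; apply: eq_bigr => f _; rewrite hh' // => j; exact: nrm_torus_point.
Qed.

Lemma torus_average_partial_sum m (I : choiceType) (a : I -> C)
    (h : I -> ('I_N -> C) -> C) (H : ('I_N -> C) -> C) :
  (forall z, (forall j, `|z j| = 1) -> partial_sum (fun i => a i * h i z) @ totally --> H z) ->
  partial_sum (fun i => a i * torus_average m (h i)) @ totally --> torus_average m H.
Proof.
move=> hH; rewrite (_ : partial_sum _ = fun A => \sum_(f : {ffun 'I_N -> 'I_m.+1})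
    torus_coef f * partial_sum (fun i => a i * h i (fun j => torus_point f j ^+ 2)) A).
  apply: cvg_lincomb => f; apply: hH => j.
  by rewrite normrX nrm_torus_point expr1n.
apply/funext => A; rewrite /partial_sum -torus_average_lin.
by apply: eq_bigr.
Qed.

End Torus.

(** * The transition matrices commute with the links *)

Lemma tannery_signed (R : realType) (I : choiceType) (p : I -> R) (D : R)
    (c : nat -> I -> R) (c0 : I -> R) (r : nat -> R) (l : R) :
  (forall i, 0 <= p i) -> (\esum_(i in [set: I]) (p i)%:E = 1)%E ->
  (forall n i, `|c n i| <= D) -> (forall i, c n i @[n --> \oo] --> c0 i) ->
  (forall n, partial_sum (fun i => p i * c n i) @ totally --> r n) ->
  partial_sum (fun i => p i * c0 i) @ totally --> l ->
  r @ \oo --> l.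
Proof.
move=> p0 p1 cD cc0 cr c0l; pose B := `|D| + 1.
have B0 : 0 < B by rewrite ltr_wpDl.
have cB n i : `|c n i| <= B by rewrite (le_trans (cD n i)) // (le_trans (ler_norm _)) // lerDl.
pose s x := (x / B + 1) / 2.
have s01 n i : 0 <= s (c n i) <= 1.
  have : -1 <= c n i / B <= 1.
    by rewrite -ler_norml normrM normfV (gtr0_norm B0) ler_pdivrMr // mul1r.
  by rewrite /s => /andP[? ?]; apply/andP; split; lra.
have s_cvg (u : nat -> R) x : u @ \oo --> x -> s (u n) @[n --> \oo] --> s x.
  move=> ux; rewrite /s; apply: cvgMl; apply: cvgD; last exact: cvg_cst.
  exact: cvgMl.
have S1 : partial_sum p @ totally --> (1 : R) by apply/esum_partial_sum.
have ps_s (u : I -> R) x : partial_sum (fun i => p i * u i) @ totally --> x ->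
    partial_sum (fun i => p i * s (u i)) @ totally --> s x.
  move=> ux; rewrite (_ : partial_sum _ = fun A =>
      (partial_sum (fun i => p i * u i) A / B + partial_sum p A) / 2); last first.
    apply/funext => A; rewrite /partial_sum mulr_suml -big_split mulr_suml /=.
    by apply: eq_bigr => i _; rewrite /s; ring.
  by rewrite /s; apply: cvgMl; apply: cvgD => //; exact: cvgMl.
have c0s i : 0 <= s (c0 i).
  have h := s_cvg _ _ (cc0 i); rewrite -(cvg_lim (@Rhausdorff R) h).
  apply: limr_ge; first exact: cvgP h.
  by apply: nearW => n; case/andP: (s01 n i).
have tight (eps : R) : 0 < eps -> exists2 t, uniq t & forall n : nat, 1 - eps <= \sum_(i <- t) p i.
  move=> eps0; have /cvgrPdist_le/(_ _ eps0)[A _ hA] := S1.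
  exists A; first exact: fset_uniq.
  move=> n; have := hA A (fsubset_refl A); rewrite partial_sumE ler_norml => /andP[_].
  lra.
have [_ h] := @tannery R I (fun=> p) p (fun n i => s (c n i)) (fun i => s (c0 i))
  (fun=> p0) (fun=> p1) (fun i => cvg_cst (p i)) tight s01 (fun i => s_cvg _ _ (cc0 i)).
have h1 n : fine (\esum_(i in [set: I]) (p i * s (c n i))%:E) = s (r n).
  have /esum_partial_sum -> // := ps_s _ _ (cr n).
  by move=> i; rewrite mulr_ge0 //; case/andP: (s01 n i).
have h2 : fine (\esum_(i in [set: I]) (p i * s (c0 i))%:E) = s l.
  have /esum_partial_sum -> // := ps_s _ _ c0l.
  by move=> i; rewrite mulr_ge0.
have {}h : s (r n) @[n --> \oo] --> s l by move: h; rewrite h2 (eq_cvg _ _ h1).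
have sK x : (s x * 2 - 1) * B = x by rewrite /s; field; rewrite gt_eqF.
rewrite -(sK l) (_ : r = fun n => (s (r n) * 2 - 1) * B); last first.
  by apply/funext => n; rewrite sK.
by apply: cvgMl; apply: cvgB; [exact: cvgMl|exact: cvg_cst].
Qed.

Lemma multiplier_field (F : fieldType) (s A B L0 L1 P m D : F) :
  s != 0 -> L0 != 0 -> A != 0 -> B != 0 ->
  m * D / P / L1 / (s * A / L0) = B / A * m / P * (D / L1 / (s * B / L0)).
Proof.
move=> s0 L00 A0 B0; rewrite !invfM invrK.
have -> : B * A^-1 * m * P^-1 * (D * L1^-1 * (s^-1 * B^-1 * L0)) =
  (B * B^-1) * (m * D * P^-1 * L1^-1 * (s^-1 * A^-1 * L0)) by ring.
by rewrite divff // mul1r.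
Qed.

Section Commutation.
Context {R : realType}.
Variables (X : root_type) (q : R) (w : Omega R).
Notation e := (dbl_eps X).
Notation C := R[i].
Hypothesis q01 : 0 < q < 1.
Hypothesis alpha0 : forall i, alpha w i = 0.
Let e12 := dbl_eps12 X.
Notation p := (qroot q).
Let p01 := qroot01 q01.
Let p0 : 0 < p. Proof. by case/andP: p01. Qed.
Let q0 : 0 < q. Proof. by case/andP: q01. Qed.
Notation T := (range_transition X q).

Variable Lam : forall N, signature N.+2 -> signature N.+1 -> R.
Hypothesis hLam : is_link X q Lam.

Let toC := real_complex R.
Let two_neq0 : 2%:R != 0 :> C. Proof. by rewrite pnatr_eq0. Qed.

(** The normalized multiplier of the expansion, as a function of the squares. *)
Definition multiplier (bs : seq R) M (z : 'I_M -> C) : C :=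
  (\prod_(j < M) steps_poly (map toC bs)
     ((node e p%:C j ^+ 2 * z j + (node e p%:C j ^+ 2 * z j)^-1) / 2)) /
  (\prod_(j < M) steps_poly bs (two_cosh (node e p j) / 2))%:C.

Lemma multiplier_gX (bs : seq R) M (lam : signature M) n (u : 'I_M -> C) :
  (forall i, (labels lam i + size bs < n)%N) -> (forall j, `|u j| = 1) ->
  multiplier bs (fun j => u j ^+ 2) * gX X q lam (fun j => u j ^+ 2) =
  \sum_(mu <- signatures_below M n) (T bs lam mu)%:C * gX X q mu (fun j => u j ^+ 2).
Proof.
move=> ln u1; have u0 j : u j != 0 by rewrite -normr_eq0 u1 oner_eq0.
have v0 (j : 'I_M) : node e (p%:C : C) j * u j != 0.
  by rewrite mulf_neq0 // node_real real_neq0 // gt_eqF // node_gt0.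
have := @steps_signature_sum M C e (fun j => node e (p%:C : C) j * u j) (map toC bs) lam n two_neq0 v0 e12.
rewrite size_map => /(_ ln) E.
have mE : multiplier bs (fun j => u j ^+ 2) =
    (\prod_(j < M) steps_poly (map toC bs) (two_cosh (node e (p%:C : C) j * u j) / 2)) /
    (\prod_(j < M) steps_poly bs (two_cosh (node e p j) / 2))%:C.
  by congr (_ / _); apply: eq_bigr => j _; rewrite /two_cosh exprMn.
rewrite mE gX_sqrE //.
have -> : forall a b c d f : C, a / b * (c / d / f) = a * c / b / d / f.
  by move=> a b c d f; rewrite -!mulrA; congr (_ * _); exact: mulrCA.
rewrite E !mulr_suml; apply: eq_bigr => mu _; rewrite gX_sqrE //.
have -> : minor (steps e (map toC bs)) (labels lam) (labels mu) =
    (minor (steps e bs) (labels lam) (labels mu))%:C.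
  rewrite /minor -[RHS](det_map_mx toC); congr determinant.
  by apply/matrixP => i j; rewrite !mxE steps_rmorph.
have -> : (T bs lam mu)%:C = (weyl_product e p (labels mu))%:C /
    (weyl_product e p (labels lam))%:C * (minor (steps e bs) (labels lam) (labels mu))%:C /
    (\prod_(j < M) steps_poly bs (two_cosh (node e p j) / 2))%:C.
  rewrite -real_div /range_transition /transition real_div; congr (_ / _); exact: rmorphM.
apply: multiplier_field; rewrite ?weyl_sign_neq0 ?weyl_product_neq0 //.
exact: laurent_denom_neq0.
Qed.

Lemma extend1_max N (z : 'I_N -> C) : extend1 z ord_max = 1.
Proof. by rewrite /extend1 unlift_none. Qed.

Lemma extend1_widen N (z : 'I_N -> C) (i : 'I_N) : extend1 z (widen_ord (leqnSn N) i) = z i.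
Proof.
rewrite /extend1; have -> : widen_ord (leqnSn N) i = lift ord_max i.
  by apply: ord_inj; rewrite lift_max.
by rewrite liftK.
Qed.

Lemma extend1_sqr N (u : 'I_N -> C) :
  extend1 (fun j => u j ^+ 2) = fun j => extend1 u j ^+ 2.
Proof.
by apply/funext => j; rewrite /extend1; case: unlift => [i|] //=; rewrite expr1n.
Qed.

Lemma extend1_unit N (u : 'I_N -> C) j : (forall i, `|u i| = 1) -> `|extend1 u j| = 1.
Proof. by move=> u1; rewrite /extend1; case: unlift => [i|] /=; rewrite ?normr1. Qed.

(** The last node contributes the same factor to both products when its variable
    is set to 1. *)
Lemma multiplier_extend1 (bs : seq R) N (z : 'I_N -> C) : {in bs, forall c, 0 <= c <= 2^-1} ->
  multiplier bs (extend1 z) = multiplier bs z.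
Proof.
move=> hb; rewrite /multiplier !big_ord_recr /= extend1_max.
under eq_bigr => i _ do rewrite extend1_widen.
rewrite rmorphM mulr1 -[in RHS](mulr1 (_ / _)) -mulf_div; congr (_ * _).
have P1 : 1 <= steps_poly bs (two_cosh (node e p N) / 2).
  by apply: steps_poly_ge1 hb _; rewrite two_cosh_ge2 // node_gt0.
rewrite -/(two_cosh _) node_real two_cosh_real -[2]/(2%:R) -(rmorph_nat toC) -real_div steps_poly_rmorph.
by rewrite divff // real_neq0 // gt_eqF // (lt_le_trans ltr01).
Qed.

Lemma link_average N (kappa : signature N.+1) (lam : signature N.+2) m :
  partial_sum (fun mu => (Lam lam mu)%:C * torus_average X q kappa m (gX X q mu)) @ totally -->
  torus_average X q kappa m (fun z => gX X q lam (extend1 z)).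
Proof.
apply: torus_average_partial_sum => // z z1.
by case: (hLam lam) => _ _; apply.
Qed.

Lemma partial_sum_Re (I : choiceType) (a : I -> R) (g : I -> C) (l : C) :
  partial_sum (fun i => (a i)%:C * g i) @ totally --> l ->
  partial_sum (fun i => a i * complex.Re (g i)) @ totally --> complex.Re l.
Proof.
move=> h; rewrite (_ : partial_sum _ =
    @complex.Re R \o partial_sum (fun i => (a i)%:C * g i)).
  by apply: (cvg_comp _ _ h); exact: continuous_Re.
apply/funext => A; rewrite /partial_sum /= raddf_sum; apply: eq_bigr => i _.
by case: (g _) => x y /=; rewrite mul0r subr0.
Qed.

Lemma average_gX_cvg N (kappa mu : signature N) :
  complex.Re (torus_average X q kappa m (gX X q mu)) @[m --> \oo] --> ((mu == kappa)%:R : R).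
Proof.
apply/cvgR_absP => eps eps0.
exists (\max_i \max_j ((labels mu i).*2 + dbl_eps X + target_exponent X kappa j)) => m hm.
rewrite torus_average_gX_large => //; last first.
  move=> i j; rewrite ltnS; apply: leq_trans hm.
  have hF := @leq_bigmax _ (fun i => \max_j ((labels mu i).*2 + dbl_eps X + target_exponent X kappa j)).
  apply: leq_trans (hF i).
  exact: (@leq_bigmax _ (fun j => ((labels mu i).*2 + dbl_eps X + target_exponent X kappa j)%N) j).
by rewrite -(rmorph_nat (real_complex R)) /= subrr normr0 ltW.
Qed.

Lemma partial_sum_delta (I : choiceType) (a : I -> R) (k : I) :
  partial_sum (fun i => a i * (i == k)%:R) @ totally --> a k.
Proof.
apply/cvgrPdist_le => eps eps0; exists [fset k]%fset => // A kA.
rewrite partial_sumE (bigD1_seq k) ?fset_uniq //=; last by apply: (fsubsetP kA); rewrite inE.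
rewrite eqxx mulr1 big1 ?addr0 ?subrr ?normr0 ?ltW // => i /negPf ->.
by rewrite mulr0.
Qed.

Lemma extended_average_cvg N (kappa : signature N.+1) (lam : signature N.+2) :
  complex.Re (torus_average X q kappa m (fun z => gX X q lam (extend1 z))) @[m --> \oo] -->
  Lam lam kappa.
Proof.
have [D hD] := torus_average_bounded X q01 kappa.
have [L0 L1 _] := hLam lam.
apply: (@tannery_signed R _ (Lam lam) D
  (fun m mu => complex.Re (torus_average X q kappa m (gX X q mu))) (fun mu => (mu == kappa)%:R)) => //.
- by move=> n mu; apply: le_trans (Re_le_nrm _) (hD _ _).
- by move=> mu; exact: average_gX_cvg.
- by move=> n; apply: partial_sum_Re; exact: link_average.
- exact: partial_sum_delta.
Qed.

(** Both sides are the coefficient of g_kappa in the product of the multiplier with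
    g_lam (z, 1): either g_lam is expanded before its last variable is set to 1,
    or the restriction is expanded by the link and then multiplied. *)
Lemma range_commutation (bs : seq R) N (kappa : signature N.+1) (lam : signature N.+2) :
  {in bs, forall c, 0 <= c <= 2^-1} ->
  fine (\esum_(rho in [set: signature N.+2]) (T bs lam rho * Lam rho kappa)%:E) =
  fine (\esum_(mu in [set: signature N.+1]) (Lam lam mu * T bs mu kappa)%:E).
Proof.
move=> hb; have [n hn] := exists_label_bound lam (size bs).
have T0 M (x y : signature M) : 0 <= T bs x y by exact: range_transition_ge0.
have Tsupp M (x y : signature M) k : (forall i, (labels x i + size bs < k)%N) ->
    y \notin signatures_below M k -> T bs x y = 0.
  move=> hk yk; rewrite /range_transition /transition (@minor_steps_support M R e bs x y k hk yk).
  by rewrite mulr0 mul0r.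
have [L0 L1 Lz] := hLam lam.
pose r m := complex.Re (torus_average X q kappa m
  (fun z => multiplier bs (extend1 z) * gX X q lam (extend1 z))).
have r1 : r @ \oo --> \sum_(rho <- signatures_below N.+2 n) T bs lam rho * Lam rho kappa.
  rewrite (_ : r = fun m => \sum_(rho <- signatures_below N.+2 n) T bs lam rho *
      complex.Re (torus_average X q kappa m (fun z => gX X q rho (extend1 z)))).
    by apply: cvg_sumr => rho; apply: cvgM; [exact: cvg_cst|exact: extended_average_cvg].
  apply/funext => m; rewrite /r.
  rewrite (@torus_average_ext R X q _ kappa m _ (fun z => \sum_(rho <- signatures_below N.+2 n)
      (T bs lam rho)%:C * gX X q rho (extend1 z))) => [|u u1]; last first.
    rewrite extend1_sqr (@multiplier_gX bs _ lam n) // => j; exact: extend1_unit.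
  rewrite torus_average_lin raddf_sum; apply: eq_bigr => rho _.
  by case: (torus_average _ _ _) => x y /=; rewrite mul0r subr0.
have Tfin (mu : signature N.+1) : exists k, forall i, (labels mu i + size bs < k)%N := exists_label_bound mu (size bs).
have avg_mult m (mu : signature N.+1) k : (forall i, (labels mu i + size bs < k)%N) ->
    complex.Re (torus_average X q kappa m (fun z => multiplier bs z * gX X q mu z)) =
    \sum_(nu <- signatures_below N.+1 k) T bs mu nu * complex.Re (torus_average X q kappa m (gX X q nu)).
  move=> hk; rewrite (@torus_average_ext R X q _ kappa m _ (fun z => \sum_(nu <- signatures_below N.+1 k)
      (T bs mu nu)%:C * gX X q nu z)) => [|u u1]; last by rewrite (@multiplier_gX bs _ mu k).
  rewrite torus_average_lin raddf_sum; apply: eq_bigr => nu _.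
  by case: (torus_average _ _ _) => x y /=; rewrite mul0r subr0.
have [D hD] := torus_average_bounded X q01 kappa.
have LT1 : (\esum_(mu in [set: signature N.+1]) (Lam lam mu * T bs mu kappa)%:E <= 1)%E.
  rewrite -L1; apply: le_esum => mu _; rewrite lee_fin ler_piMr //.
  have [k hk] := Tfin mu; have [kk|kk] := boolP (kappa \in signatures_below N.+1 k).
    rewrite -(range_transition_sum X q01 hb hk) (bigD1_seq kappa) ?signatures_below_uniq //=.
    by rewrite lerDl sumr_ge0.
  by rewrite (Tsupp _ _ _ _ hk kk) ler01.
have r2 : r @ \oo --> fine (\esum_(mu in [set: signature N.+1]) (Lam lam mu * T bs mu kappa)%:E).
  apply: (@tannery_signed R _ (Lam lam) D
    (fun m mu => complex.Re (torus_average X q kappa m (fun z => multiplier bs z * gX X q mu z)))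
    (fun mu => T bs mu kappa)) => //.
  - move=> m mu; have [k hk] := Tfin mu; rewrite (avg_mult m mu k hk).
    apply: (le_trans (ler_norm_sum _ _ _)).
    apply: (@le_trans _ _ (\sum_(nu <- signatures_below N.+1 k) T bs mu nu * D)).
      apply: ler_sum => nu _; rewrite normrM ger0_norm // ler_wpM2l //.
      exact: le_trans (Re_le_nrm _) (hD _ _).
    by rewrite -mulr_suml (range_transition_sum X q01 hb hk) mul1r.
  - move=> mu; have [k hk] := Tfin mu.
    rewrite (_ : (fun m => _) = fun m => \sum_(nu <- signatures_below N.+1 k) T bs mu nu *
       complex.Re (torus_average X q kappa m (gX X q nu))); last first.
      by apply/funext => m; exact: avg_mult.
    have -> : T bs mu kappa = \sum_(nu <- signatures_below N.+1 k) T bs mu nu * (nu == kappa)%:R.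
      have [kk|kk] := boolP (kappa \in signatures_below N.+1 k).
        rewrite (bigD1_seq kappa) ?signatures_below_uniq //= eqxx mulr1 big1 ?addr0 // => nu /negPf ->.
        by rewrite mulr0.
      rewrite (Tsupp _ _ _ _ hk kk) big_seq big1 // => nu nuk.
      by case: eqP => [E|_]; rewrite ?mulr0 //; move: kk; rewrite -E nuk.
    by apply: cvg_sumr => nu; apply: cvgM; [exact: cvg_cst|exact: average_gX_cvg].
  - move=> m; apply: (@partial_sum_Re _ (Lam lam)
      (fun mu => torus_average X q kappa m (fun z => multiplier bs z * gX X q mu z))).
    apply: (@torus_average_partial_sum R X q _ kappa m _ (fun mu => (Lam lam mu)%:C)
      (fun mu z => multiplier bs z * gX X q mu z)
      (fun z => multiplier bs (extend1 z) * gX X q lam (extend1 z))) => z z1.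
    rewrite multiplier_extend1 //.
    rewrite (_ : partial_sum _ = fun A => multiplier bs z *
        partial_sum (fun mu => (Lam lam mu)%:C * gX X q mu z) A); last first.
      apply/funext => A; rewrite /partial_sum mulr_sumr; apply: eq_bigr => mu _.
      by rewrite mulrCA.
    apply: (@cvgM R[i] _ totally); first exact: cvg_cst.
    exact: Lz.
  - apply/esum_partial_sum; first by move=> mu; rewrite mulr_ge0.
    rewrite fineK // ge0_fin_numE ?(le_lt_trans LT1) ?ltry //.
    by apply: esum_ge0 => mu _; rewrite lee_fin mulr_ge0.
rewrite -(cvg_lim (@Rhausdorff R) r2) (cvg_lim (@Rhausdorff R) r1).
rewrite (esum_fin (signatures_below_uniq N.+2 n)) //.
  by move=> rho rhon; rewrite (Tsupp _ _ _ _ hn rhon) mul0r.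
by move=> rho; rewrite mulr_ge0 //; case: (hLam rho).
Qed.

Lemma link_le1 N (lam : signature N.+2) (mu : signature N.+1) : 0 <= Lam lam mu <= 1.
Proof.
have [L0 L1 _] := hLam lam; rewrite L0 /= -lee_fin -L1.
have := @sum_le_esum R _ (Lam lam) [:: mu] isT L0.
by rewrite big_seq1.
Qed.

(** The limit of the previous identity; the rows of the approximating matrices and
    the row of the link are both tight. *)
Lemma jump_commutation N (kappa : signature N.+1) (lam : signature N.+2) :
  (\esum_(rho in [set: signature N.+2]) (jump_transition X q w lam rho * Lam rho kappa)%:E =
   \esum_(mu in [set: signature N.+1]) (Lam lam mu * jump_transition X q w mu kappa)%:E)%E.
Proof.
have [L0 L1 _] := hLam lam.
have J0 M (x y : signature M) := jump_transition_ge0 X q01 alpha0 x y.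
have [J1 c1] := jump_transition_esum_cvg X q01 alpha0 lam (fun rho => link_le1 rho kappa).
have T01 n M (x y : signature M.+1) : 0 <= T (approx w n) x y <= 1.
  have hb := approx_bounds (w := w) (n := n).
  have T0 z : 0 <= T (approx w n) x z by exact: range_transition_ge0.
  rewrite T0 /= -lee_fin -(range_transition_esum X q01 x hb).
  by have := @sum_le_esum R _ (T (approx w n) x) [:: y] isT T0; rewrite big_seq1.
have tight (eps : R) : 0 < eps -> exists2 t, uniq t & forall n : nat, 1 - eps <= \sum_(i <- t) Lam lam i.
  move=> eps0; have /cvgrPdist_le/(_ _ eps0)[A _ hA] :
      partial_sum (Lam lam) @ totally --> (1 : R) by apply/esum_partial_sum.
  exists A; first exact: fset_uniq.
  move=> n; have := hA A (fsubset_refl A); rewrite partial_sumE ler_norml => /andP[_].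
  lra.
have [_ c2] := @tannery R _ (fun=> Lam lam) (Lam lam) (fun n mu => T (approx w n) mu kappa)
  (fun mu => jump_transition X q w mu kappa) (fun=> L0) (fun=> L1) (fun i => cvg_cst _) tight
  (fun n mu => T01 n _ mu kappa) (fun mu => @range_transition_cvg R X q w q01 alpha0 _ mu kappa).
have E : (fun n => fine (\esum_(rho in [set: signature N.+2]) (T (approx w n) lam rho * Lam rho kappa)%:E)) =
   fun n => fine (\esum_(mu in [set: signature N.+1]) (Lam lam mu * T (approx w n) mu kappa)%:E).
  by apply/funext => n; apply: range_commutation; exact: approx_bounds.
have fin_num1 (I : choiceType) (a b : I -> R) : (forall i, 0 <= a i <= b i) ->
    (\esum_(i in [set: I]) (b i)%:E = 1)%E -> \esum_(i in [set: I]) (a i)%:E \is a fin_num.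
  move=> ab b1; rewrite ge0_fin_numE; last first.
    by apply: esum_ge0 => i _; rewrite lee_fin; case/andP: (ab i).
  apply: (@le_lt_trans _ _ 1%E); rewrite ?ltry // -b1; apply: le_esum => i _.
  by rewrite lee_fin; case/andP: (ab i).
have J_le1 M (x y : signature M.+1) : jump_transition X q w x y <= 1.
  have h := @range_transition_cvg R X q w q01 alpha0 _ x y.
  rewrite -(cvg_lim (@Rhausdorff R) h); apply: limr_le; first exact: cvgP h.
  by apply: nearW => n; case/andP: (T01 n _ x y).
rewrite -[LHS]fineK -1?[RHS]fineK.
- congr _%:E; rewrite -(cvg_lim (@Rhausdorff R) c1) -(cvg_lim (@Rhausdorff R) c2).
  by rewrite E.
- apply: (fin_num1 _ _ _ _ L1) => mu; rewrite mulr_ge0 ?L0 ?J0 //=.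
  by rewrite ler_piMr.
- apply: (fin_num1 _ _ _ _ J1) => rho; have /andP[l0 l1] := link_le1 rho kappa.
  by rewrite mulr_ge0 //= ler_piMr.
Qed.

End Commutation.

(** * Nonnegative kernels between countable sets *)

Section NonnegativeKernels.
Context {R : realType}.
Local Open Scope ereal_scope.

Lemma ge0_esumZl {I : choiceType} (c : \bar R) (f : I -> \bar R) : 0 <= c ->
  (forall i, 0 <= f i) ->
  c * (\esum_(i in [set: I]) f i) = \esum_(i in [set: I]) (c * f i).
Proof.
move=> c0 f0.
have mono (d : \bar R) (g : I -> \bar R) : 0 <= d -> (forall i, 0 <= g i) ->
    \esum_(i in [set: I]) (d * g i) <= d * (\esum_(i in [set: I]) g i).
  move=> d0 g0; apply: ge_ereal_sup => _ [A [finA _] <-].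
  rewrite -ge0_mule_fsumr // lee_wpmul2l //.
  by apply: esum_ge; exists A.
case: c c0 => [r| |] //.
- rewrite lee_fin le_eqVlt => /predU1P[<-|r0].
    by rewrite mul0e esum1 // => i _; rewrite mul0e.
  apply/eqP; rewrite eq_le mono ?andbT ?lee_fin ?(ltW r0) //.
  rewrite -(@lee_pmul2l _ (r^-1)%:E) ?lte_fin ?invr_gt0 //.
  rewrite muleA -EFinM mulVf ?mul1e ?gt_eqF //.
  have -> : \esum_(i in [set: I]) f i = \esum_(i in [set: I]) (r^-1%:E * (r%:E * f i)).
    by apply: eq_esum => i _; rewrite muleA -EFinM mulVf ?mul1e ?gt_eqF.
  apply: mono => [|i]; first by rewrite lee_fin invr_ge0 ltW.
  by rewrite mule_ge0 // lee_fin ltW.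
- move=> _; have [fz|/existsNP[i /eqP fi]] := pselect (forall i, f i = 0).
    by rewrite !esum1 ?mule0 // => i _; rewrite fz mule0.
  have fi0 : 0 < f i by rewrite lt_neqAle eq_sym fi f0.
  have one (g : I -> \bar R) : (forall i, 0 <= g i) -> g i <= \esum_(i in [set: I]) g i.
    by move=> g0; apply: esum_ge; exists [set i] => //; rewrite fsbig_set1.
  have big : +oo <= \esum_(i in [set: I]) (+oo * f i).
    by have := one (fun j => +oo * f j) (fun j => mule_ge0 (leey 0) (f0 j)); rewrite gt0_mulye.
  rewrite gt0_mulye ?(lt_le_trans fi0 (one _ f0)) //.
  by apply/eqP; rewrite eq_le big leey.
Qed.

Lemma exchange_esum {I J : choiceType} (f : I -> J -> \bar R) : (forall i j, 0 <= f i j) ->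
  \esum_(i in [set: I]) \esum_(j in [set: J]) f i j =
  \esum_(j in [set: J]) \esum_(i in [set: I]) f i j.
Proof.
move=> f0; rewrite !esum_esum //; apply: (reindex_esum _ _ (fun x : J * I => (x.2, x.1))); split => //.
- by move=> [a b] [c d] _ _ /= [-> ->].
- by move=> [a b] _; exists (b, a).
Qed.

Definition ecomp {I J K : choiceType} (A : I -> J -> \bar R) (B : J -> K -> \bar R) i k :=
  \esum_(j in [set: J]) (A i j * B j k).

Lemma ecomp_ge0 {I J K : choiceType} (A : I -> J -> \bar R) (B : J -> K -> \bar R) i k :
  (forall i j, 0 <= A i j) -> (forall j k, 0 <= B j k) -> 0 <= ecomp A B i k.
Proof. by move=> A0 B0; apply: esum_ge0 => j _; rewrite mule_ge0. Qed.

Lemma ecompA {I J K L : choiceType} (A : I -> J -> \bar R) (B : J -> K -> \bar R)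
  (C : K -> L -> \bar R) i l :
  (forall i j, 0 <= A i j) -> (forall j k, 0 <= B j k) -> (forall k l, 0 <= C k l) ->
  ecomp (ecomp A B) C i l = ecomp A (ecomp B C) i l.
Proof.
move=> A0 B0 C0; rewrite /ecomp.
have -> : \esum_(k in [set: K]) ((\esum_(j in [set: J]) (A i j * B j k)) * C k l) =
    \esum_(k in [set: K]) \esum_(j in [set: J]) (A i j * (B j k * C k l)).
  apply: eq_esum => k _; rewrite muleC ge0_esumZl // => [|j]; last by rewrite mule_ge0.
  by apply: eq_esum => j _; rewrite muleC muleA.
rewrite exchange_esum => [|k j]; last by rewrite !mule_ge0.
by apply: eq_esum => j _; rewrite ge0_esumZl // => k; rewrite mule_ge0.
Qed.

Definition kdelta {I : choiceType} (i k : I) : \bar R := (i == k)%:R%:E.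

Lemma esum_kdelta {I : choiceType} (f : I -> \bar R) k : (forall i, 0 <= f i) ->
  \esum_(i in [set: I]) (f i * kdelta i k) = f k.
Proof.
move=> f0; rewrite (@esum_finite_support _ _ _ [:: k]) //.
- by rewrite big_seq1 /kdelta eqxx mule1.
- by move=> i; rewrite mule_ge0 // lee_fin ler0n.
- by move=> i; rewrite inE => /negPf ik; rewrite /kdelta ik mule0.
Qed.

Fixpoint kpow {I : choiceType} (T : I -> I -> \bar R) n : I -> I -> \bar R :=
  if n is n'.+1 then ecomp (kpow T n') T else kdelta.

Section Powers.
Context {I : choiceType} (T : I -> I -> \bar R).
Hypothesis T_ge0 : forall i k, 0 <= T i k.

Lemma kpow_ge0 n i k : 0 <= kpow T n i k.
Proof.
elim: n i k => [|n IH] i k /=; first by rewrite lee_fin ler0n.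
exact: ecomp_ge0.
Qed.

Lemma kpow_add m n i k : ecomp (kpow T m) (kpow T n) i k = kpow T (m + n) i k.
Proof.
elim: n i k => [|n IH] i k.
  by rewrite addn0; apply: esum_kdelta => j; exact: kpow_ge0.
rewrite addnS /= -ecompA //; try exact: kpow_ge0.
by apply: eq_esum => j _; rewrite IH.
Qed.

Lemma ecomp_esum1 {J K : choiceType} (A : J -> K -> \bar R) {L : choiceType} (B : K -> L -> \bar R) i :
  (forall i j, 0 <= A i j) -> (forall i j, 0 <= B i j) ->
  (forall i, \esum_(j in [set: K]) A i j = 1) -> (forall i, \esum_(j in [set: L]) B i j = 1) ->
  \esum_(l in [set: L]) ecomp A B i l = 1.
Proof.
move=> A0 B0 A1 B1; rewrite exchange_esum => [|l k]; last by rewrite mule_ge0.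
rewrite -(A1 i); apply: eq_esum => k _.
by rewrite -ge0_esumZl // B1 mule1.
Qed.

Lemma kpow_esum1 n i : (forall i, \esum_(k in [set: I]) T i k = 1) ->
  \esum_(k in [set: I]) kpow T n i k = 1.
Proof.
move=> T1; elim: n i => [|n IH] i /=; last first.
  by apply: ecomp_esum1 => //; exact: kpow_ge0.
rewrite -[RHS](@esum_kdelta _ (fun=> 1) i) //; apply: eq_esum => k _.
by rewrite mul1e /kdelta eq_sym.
Qed.

Lemma kpow_commute {J : choiceType} (S : J -> J -> \bar R) (A : I -> J -> \bar R) n i j :
  (forall i j, 0 <= S i j) -> (forall i j, 0 <= A i j) ->
  (forall i j, ecomp T A i j = ecomp A S i j) ->
  ecomp (kpow T n) A i j = ecomp A (kpow S n) i j.
Proof.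
move=> S0 A0 h; have Sn0 m a b : 0 <= kpow S m a b.
  by elim: m a b => [|m IH] a b /=; [rewrite lee_fin ler0n|exact: ecomp_ge0].
elim: n i j => [|n IH] i j /=.
  rewrite [RHS]esum_kdelta // -[RHS](@esum_kdelta _ (fun k => A k j) i) //.
  by apply: eq_esum => k _; rewrite muleC /kdelta eq_sym.
rewrite ecompA //; last exact: kpow_ge0.
transitivity (ecomp (kpow T n) (ecomp A S) i j); first by apply: eq_esum => k _; rewrite h.
rewrite -ecompA //; last exact: kpow_ge0.
rewrite -ecompA //; by apply: eq_esum => k _; rewrite IH.
Qed.

End Powers.

(** * Poisson mixtures of the powers of a stochastic kernel *)

(** The Poisson probability of n with mean t; the mixture of the powers of T with
    these weights is the exponential of t (T - 1), written without subtraction. *)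
Definition poisson_weight (t : R) n : R := (expR (- t) * (t ^+ n / n`!%:R))%R.

Lemma poisson_weight_ge0 t n : (0 <= t)%R -> (0 <= poisson_weight t n)%R.
Proof. by move=> t0; rewrite mulr_ge0 ?expR_ge0 // divr_ge0 ?exprn_ge0 ?ler0n. Qed.

Lemma nat_esum_cvg (f : nat -> R) (l : R) : (forall n, 0 <= f n)%R ->
  series f @ \oo --> l -> \esum_(n in [set: nat]) (f n)%:E = l%:E.
Proof.
move=> f0 fl; rewrite -nneseries_esumT; last by move=> n; rewrite lee_fin.
apply: cvg_lim => //; rewrite (_ : (fun n => _) = EFin \o series f).
  by apply: cvg_EFin; [exact: nearW|exact: fl].
by apply/funext => n /=; rewrite sumEFin /series.
Qed.

Lemma poisson_weight_sum t : (0 <= t)%R ->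
  \esum_(n in [set: nat]) (poisson_weight t n)%:E = 1.
Proof.
move=> t0; apply: nat_esum_cvg => [n|]; first exact: poisson_weight_ge0.
have h : series (exp_coeff t) @ \oo --> expR t by exact: is_cvg_series_exp_coeff.
rewrite (_ : series _ = fun n => expR (- t) * series (exp_coeff t) n)%R; last first.
  by apply/funext => n; rewrite /series /= mulr_sumr.
rewrite -[X in _ --> X](mulVf (lt0r_neq0 (expR_gt0 t))) -expRN.
by apply: cvgM; [exact: cvg_cst|exact: h].
Qed.

Lemma poisson_weight_add s t n :
  (\sum_(a < n.+1) poisson_weight s a * poisson_weight t (n - a) = poisson_weight (s + t) n)%R.
Proof.
rewrite /poisson_weight opprD expRD [(s + t)%R]addrC exprDn mulr_suml mulr_sumr; apply: eq_bigr => a _.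
have an : (a <= n)%N by rewrite -ltnS.
have f0 k : (k`!%:R != 0 :> R)%R by rewrite pnatr_eq0 -lt0n fact_gt0.
have E : ('C(n, a)%:R * (a`!%:R * (n - a)`!%:R) = n`!%:R :> R)%R by rewrite -!natrM bin_fact.
rewrite -mulr_natr -E.
have c0 : ('C(n, a)%:R != 0 :> R)%R by rewrite pnatr_eq0 -lt0n bin_gt0.
by field; rewrite !f0 c0.
Qed.

Lemma esum_antidiagonal (f : nat -> nat -> \bar R) : (forall a b, 0 <= f a b) ->
  \esum_(a in [set: nat]) \esum_(b in [set: nat]) f a b =
  \esum_(n in [set: nat]) \sum_(a < n.+1) f a (n - a)%N.
Proof.
move=> f0; transitivity (\esum_(n in [set: nat]) \esum_(a in `I_n.+1) f a (n - a)%N); last first.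
  by apply: eq_esum => n _; rewrite esum_fset // -fsbig_ord.
rewrite !esum_esum //.
apply: (reindex_esum _ _ (fun x : nat * nat => (x.2, (x.1 - x.2)%N))); split => //.
- move=> [n a] [m b]; rewrite !inE /= => -[_ /= an] [_ /= bm] /= [E].
  rewrite -E in bm *; move: an bm; rewrite !ltnS => an bm h.
  by rewrite -(subnK an) h subnK.
- move=> [a b] _; exists ((a + b)%N, a); rewrite /= ?addKn //.
  by split=> //=; rewrite ltnS leq_addr.
Qed.

Definition poisson_mixture {I : choiceType} (T : I -> I -> \bar R) (t : R) i k :=
  \esum_(n in [set: nat]) ((poisson_weight t n)%:E * kpow T n i k).

Section Mixture.
Context {I : choiceType} (T : I -> I -> \bar R).
Hypothesis T_ge0 : forall i k, 0 <= T i k.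

Lemma poisson_mixture_ge0 t i k : (0 <= t)%R -> 0 <= poisson_mixture T t i k.
Proof.
by move=> t0; apply: esum_ge0 => n _; rewrite mule_ge0 ?kpow_ge0 // lee_fin poisson_weight_ge0.
Qed.

Lemma poisson_mixture_esum1 t i : (0 <= t)%R -> (forall i, \esum_(k in [set: I]) T i k = 1) ->
  \esum_(k in [set: I]) poisson_mixture T t i k = 1.
Proof.
move=> t0 T1; rewrite exchange_esum => [|k n]; last first.
  by rewrite mule_ge0 ?kpow_ge0 // lee_fin poisson_weight_ge0.
rewrite -(poisson_weight_sum t0); apply: eq_esum => n _.
rewrite -ge0_esumZl ?kpow_esum1 ?mule1 ?lee_fin ?poisson_weight_ge0 //.
by move=> k; exact: kpow_ge0.
Qed.

Lemma poisson_mixture0 i k : poisson_mixture T 0 i k = kdelta i k.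
Proof.
rewrite /poisson_mixture (@esum_finite_support _ _ _ [:: 0%N]) //.
- by rewrite big_seq1 /poisson_weight oppr0 expR0 expr0 fact0 divr1 mulr1 mul1e.
- by move=> n; rewrite mule_ge0 ?kpow_ge0 // lee_fin poisson_weight_ge0.
- move=> [|n]; rewrite ?inE // => _.
  by rewrite /poisson_weight expr0n mul0r mulr0 mul0e.
Qed.

Lemma poisson_mixture_add s t i k : (0 <= s)%R -> (0 <= t)%R ->
  ecomp (poisson_mixture T s) (poisson_mixture T t) i k = poisson_mixture T (s + t) i k.
Proof.
move=> s0 t0; have ws n := poisson_weight_ge0 n s0; have wt n := poisson_weight_ge0 n t0.
have p0 n a b : 0 <= kpow T n a b by exact: kpow_ge0.
pose F a b j := (poisson_weight s a * poisson_weight t b)%:E * (kpow T a i j * kpow T b j k).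
have F0 a b j : 0 <= F a b j by rewrite !mule_ge0 // lee_fin mulr_ge0.
transitivity (\esum_(j in [set: I]) \esum_(a in [set: nat]) \esum_(b in [set: nat]) F a b j).
  apply: eq_esum => j _; rewrite [LHS]muleC ge0_esumZl; last 2 first.
  - exact: poisson_mixture_ge0.
  - by move=> n; rewrite mule_ge0 // lee_fin.
  apply: eq_esum => a _; rewrite muleC ge0_esumZl; last 2 first.
  - by rewrite mule_ge0 // lee_fin.
  - by move=> n; rewrite mule_ge0 // lee_fin.
  by apply: eq_esum => b _; rewrite /F EFinM muleACA.
rewrite exchange_esum; last by move=> j a; apply: esum_ge0.
transitivity (\esum_(a in [set: nat]) \esum_(b in [set: nat])
    ((poisson_weight s a * poisson_weight t b)%:E * kpow T (a + b) i k)).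
  apply: eq_esum => a _; rewrite exchange_esum //; apply: eq_esum => b _.
  rewrite -ge0_esumZl; first by rewrite -kpow_add.
    by rewrite lee_fin mulr_ge0.
  by move=> j; rewrite mule_ge0.
rewrite esum_antidiagonal; last by move=> a b; rewrite mule_ge0 // lee_fin mulr_ge0.
apply: eq_esum => n _; rewrite -poisson_weight_add -sumEFin ge0_sume_distrl; last first.
  by move=> a _; rewrite lee_fin mulr_ge0.
by apply: eq_bigr => a _; rewrite subnKC // -ltnS.
Qed.

Lemma poisson_mixture_commute {J : choiceType} (S : J -> J -> \bar R) (A : I -> J -> \bar R) t i j :
  (forall i j, 0 <= S i j) -> (forall i j, 0 <= A i j) ->
  (forall i j, ecomp T A i j = ecomp A S i j) -> (0 <= t)%R ->
  ecomp (poisson_mixture T t) A i j =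
  ecomp A (poisson_mixture S t) i j.
Proof.
move=> S0 A0 h t0; have w0 n := poisson_weight_ge0 n t0.
have Tn0 n a b : 0 <= kpow T n a b by exact: kpow_ge0.
have Sn0 m a b : 0 <= kpow S m a b.
  by elim: m a b => [|m IH] a b /=; [rewrite lee_fin ler0n|exact: ecomp_ge0].
transitivity (\esum_(k in [set: I]) \esum_(n in [set: nat]) ((poisson_weight t n)%:E * (kpow T n i k * A k j))).
  apply: eq_esum => k _; rewrite [LHS]muleC ge0_esumZl // => [|n]; last by rewrite mule_ge0 // lee_fin.
  by apply: eq_esum => n _; rewrite [LHS]muleC muleA.
rewrite exchange_esum => [|k n]; last by rewrite !mule_ge0 // lee_fin.
transitivity (\esum_(k in [set: J]) \esum_(n in [set: nat]) ((poisson_weight t n)%:E * (A i k * kpow S n k j))).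
  rewrite [RHS]exchange_esum => [|k n]; last by rewrite !mule_ge0 // lee_fin.
  apply: eq_esum => n _; rewrite -!ge0_esumZl ?lee_fin //.
  - by congr (_ * _); exact: kpow_commute.
  - by move=> k; rewrite mule_ge0.
  - by move=> k; rewrite mule_ge0.
apply: eq_esum => k _; rewrite ge0_esumZl // => [|n]; last by rewrite mule_ge0 // lee_fin.
by apply: eq_esum => n _; rewrite muleCA.
Qed.

End Mixture.
End NonnegativeKernels.

(** * The exponential of a stochastic matrix minus the identity *)

Section CauchyProduct.
Context {R : realType}.

Lemma sum_antidiagonals (V : zmodType) (F : nat -> nat -> V) n :
  \sum_(m < n) \sum_(a < m.+1) F a (m - a)%N = \sum_(a < n) \sum_(b < n - a) F a b.
Proof.
elim: n => [|n IH]; first by rewrite !big_ord0.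
rewrite big_ord_recr /= IH [RHS]big_ord_recr /= subSnn big_ord1.
rewrite [X in _ + X]big_ord_recr /= subnn addrA -big_split; congr (_ + _).
by apply: eq_bigr => a _; rewrite subSn ?(ltnW (ltn_ord a)) // big_ord_recr.
Qed.

Lemma sum_antidiagonals_gap (V : zmodType) (F : nat -> nat -> V) n :
  \sum_(a < n) \sum_(b < n) F a b - \sum_(m < n) \sum_(a < m.+1) F a (m - a)%N =
  \sum_(a < n) \sum_(n - a <= b < n) F a b.
Proof.
rewrite sum_antidiagonals -sumrB; apply: eq_bigr => a _.
rewrite -[X in X - _](big_mkord xpredT (fun b => F a b)).
rewrite (@big_cat_nat _ _ _ (n - a)) ?leq_subr //= big_mkord.
by rewrite [X in X - _]addrC addrK.
Qed.

(** Dominating both factors by exponential series bounds the terms that the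
    Cauchy product misses by those missed in exp(s) exp(s) = exp(2s). *)
Lemma cauchy_product (s : R) (x y : nat -> R) (lx ly : R) :
  (forall a, `|x a| <= s ^+ a / a`!%:R) -> (forall a, `|y a| <= s ^+ a / a`!%:R) ->
  series x @ \oo --> lx -> series y @ \oo --> ly ->
  series (fun m => \sum_(a < m.+1) x a * y (m - a)%N) @ \oo --> lx * ly.
Proof.
move=> hx hy cx cy; pose u a : R := s ^+ a / a`!%:R.
have expc (t : R) : series (exp_coeff t) @ \oo --> expR t by exact: is_cvg_series_exp_coeff.
have u0 a : 0 <= u a by apply: le_trans (hx a).
have f0 k : (k`!%:R != 0 :> R) by rewrite pnatr_eq0 -lt0n fact_gt0.
have uu m : \sum_(a < m.+1) u a * u (m - a)%N = exp_coeff (s + s) m.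
  rewrite /exp_coeff /= exprDn mulr_suml; apply: eq_bigr => a _.
  have E : ('C(m, a)%:R * (a`!%:R * (m - a)`!%:R) = m`!%:R :> R).
    by rewrite -!natrM bin_fact // -ltnS.
  rewrite -mulr_natr -E /u; field; rewrite !f0 /=.
  by rewrite pnatr_eq0 -lt0n bin_gt0 -ltnS.
pose gap (F : nat -> nat -> R) n := \sum_(a < n) \sum_(n - a <= b < n) F a b.
have gapE (f g : nat -> R) n : gap (fun a b => f a * g b) n =
    series f n * series g n - series (fun m => \sum_(a < m.+1) f a * g (m - a)%N) n.
  rewrite /gap -(sum_antidiagonals_gap (fun a b => f a * g b)) /series /= !big_mkord mulr_suml.
  by congr (_ - _); apply: eq_bigr => a _; rewrite mulr_sumr.
have gap_u : gap (fun a b => u a * u b) @ \oo --> (0 : R).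
  rewrite (_ : gap _ = fun n => series (exp_coeff s) n * series (exp_coeff s) n -
      series (exp_coeff (s + s)) n); last first.
    apply/funext => n; rewrite gapE; congr (_ - series _ n).
    by apply/funext.
  rewrite -(subrr (expR (s + s))) {1}expRD.
  by apply: cvgB; [apply: cvgM|]; exact: expc.
have gap_xy : gap (fun a b => x a * y b) @ \oo --> (0 : R).
  apply: (@squeeze_cvgr _ _ _ _ (fun n => - gap (fun a b => u a * u b) n) (fun n => gap (fun a b => u a * u b) n)).
  - apply: nearW => n; rewrite -ler_norml /gap; apply: (le_trans (ler_norm_sum _ _ _)).
    apply: ler_sum => a _; apply: (le_trans (ler_norm_sum _ _ _)).
    by apply: ler_sum => b _; rewrite normrM ler_pM.
  - by rewrite -oppr0; apply: cvgN.
  - exact: gap_u.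
rewrite (_ : series _ = fun n => series x n * series y n - gap (fun a b => x a * y b) n).
  by rewrite -[X in _ --> X]subr0; apply: cvgB gap_xy; exact: cvgM.
by apply/funext => n; rewrite gapE opprB addrC subrK.
Qed.

End CauchyProduct.

Section StochasticExponential.
Context {R : realType} {I : choiceType}.
Variable T : I -> I -> R.
Hypothesis T_ge0 : forall i k, 0 <= T i k.
Hypothesis T_sum : forall i, (\esum_(k in [set: I]) (T i k)%:E = 1)%E.
Let kT i k : \bar R := (T i k)%:E.
Let kT_ge0 i k : (0 <= kT i k)%E. Proof. by rewrite lee_fin. Qed.
Let tpow n i k : R := fine (kpow kT n i k).

Lemma kernel_le1 (A : I -> I -> \bar R) i k : (forall i k, 0 <= A i k)%E ->
  (forall i, \esum_(k in [set: I]) A i k = 1)%E -> (A i k <= 1)%E.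
Proof.
move=> A0 A1; rewrite -(A1 i); apply: esum_ge; exists [set k] => //.
by rewrite fsbig_set1.
Qed.

Let tpowE n i k : (tpow n i k)%:E = kpow kT n i k.
Proof.
rewrite fineK // ge0_fin_numE ?kpow_ge0 //; apply: (@le_lt_trans _ _ 1%E); last exact: ltry.
by apply: kernel_le1 => *; [exact: kpow_ge0|exact: kpow_esum1].
Qed.

Let tpow01 n i k : 0 <= tpow n i k <= 1.
Proof.
rewrite -!lee_fin tpowE kpow_ge0 //=.
by apply: kernel_le1 => *; [exact: kpow_ge0|exact: kpow_esum1].
Qed.

Let tpowS n i k : partial_sum (fun j => tpow n i j * T j k) @ totally --> tpow n.+1 i k.
Proof.
apply/esum_partial_sum; first by move=> j; rewrite mulr_ge0 //; case/andP: (tpow01 n i j).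
by rewrite tpowE /= /ecomp; apply: eq_esum => j _; rewrite EFinM tpowE.
Qed.

Notation L := (fun i k => T i k - (i == k)%:R).

(** The binomial theorem for (T - 1)^n. *)
Lemma mpow_binomial n i k :
  mpow L n i k = \sum_(a < n.+1) (-1) ^+ (n + a) * 'C(n, a)%:R * tpow a i k.
Proof.
elim: n i k => [|n IH] i k.
  by rewrite big_ord1 /= bin0 expr0 !mul1r /tpow.
pose c n a : R := (-1) ^+ (n + a) * 'C(n, a)%:R.
have -> : mpow L n.+1 i k = \sum_(a < n.+1) c n a * (tpow a.+1 i k - tpow a i k).
  apply: cvg_lim; first exact: norm_hausdorff.
  rewrite (_ : partial_sum _ = fun A => \sum_(a < n.+1) c n a *
      (partial_sum (fun j => tpow a i j * T j k) A - partial_sum (fun j => tpow a i j * (j == k)%:R) A)).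
    apply: cvg_sumr => a; apply: cvgM; first exact: cvg_cst.
    by apply: cvgB; [exact: tpowS|exact: partial_sum_delta].
  apply/funext => A; rewrite /partial_sum.
  transitivity (\sum_(j : A) \sum_(a < n.+1) c n a * tpow a i (val j) * (T (val j) k - (val j == k)%:R)).
    by apply: eq_bigr => j _; rewrite -mulr_suml -IH.
  rewrite exchange_big; apply: eq_bigr => a _ /=.
  rewrite -sumrB mulr_sumr; apply: eq_bigr => j _.
  by rewrite -mulrBr mulrA.
have cS a : c n.+1 a.+1 = c n a - c n a.+1.
  by rewrite /c binS natrD !addSn !addnS !exprS; ring.
transitivity (c n.+1 0%N * tpow 0 i k + \sum_(a < n.+1) (c n a - c n a.+1) * tpow a.+1 i k); last first.
  by rewrite [RHS]big_ord_recl; congr (_ + _); apply: eq_bigr => a _; rewrite -cS.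
under eq_bigr do rewrite mulrBr.
under [in RHS]eq_bigr do rewrite mulrBl.
rewrite !sumrB addrCA; congr (_ + _).
have cn : c n n.+1 = 0 by rewrite /c bin_small // mulr0.
rewrite big_ord_recl [in RHS]big_ord_recr /= cn mul0r addr0 opprD; congr (_ + _).
by rewrite /c !addn0 !bin0 exprS mulN1r !mulr1 mulNr.
Qed.

(** The Cauchy product of the series of exp (t T) and exp (-t). *)
Lemma mexp_poisson t i k : 0 <= t -> (mexp L t i k)%:E = poisson_mixture kT t i k.
Proof.
move=> t0; pose x a := t ^+ a / a`!%:R * tpow a i k; pose y b : R := (- t) ^+ b / b`!%:R.
have c0 a : 0 <= t ^+ a / a`!%:R by rewrite divr_ge0 ?exprn_ge0 ?ler0n.
have expc (s : R) : series (exp_coeff s) @ \oo --> expR s by exact: is_cvg_series_exp_coeff.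
have x0 a : 0 <= x a by rewrite mulr_ge0 //; case/andP: (tpow01 a i k).
have xle a : x a <= t ^+ a / a`!%:R by rewrite ler_piMr //; case/andP: (tpow01 a i k).
have [lx cx] : exists l : R, series x @ \oo --> l.
  exists (limn (series x)).
  have : cvgn (series x) by apply: (series_le_cvg x0 c0 xle); exact: cvgP (expc t).
  by [].
have cy : series y @ \oo --> expR (- t) by exact: expc.
have h : series (fun m => t ^+ m / m`!%:R * mpow L m i k) @ \oo --> lx * expR (- t).
  rewrite (_ : (fun m => _) = fun m => \sum_(a < m.+1) x a * y (m - a)%N).
    apply: (@cauchy_product R t) => // a; first by rewrite ger0_norm.
    by rewrite /y normrM normrX normrN normfV !ger0_norm ?ler0n.
  apply/funext => m; rewrite mpow_binomial mulr_sumr; apply: eq_bigr => a _.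
  have am : (a <= m)%N by rewrite -ltnS.
  have f0 j : (j`!%:R != 0 :> R) by rewrite pnatr_eq0 -lt0n fact_gt0.
  have E : ('C(m, a)%:R * (a`!%:R * (m - a)`!%:R) = m`!%:R :> R) by rewrite -!natrM bin_fact.
  have tE : t ^+ m = t ^+ a * t ^+ (m - a) by rewrite -exprD subnKC.
  have sE : (-1) ^+ (m + a) = (-1) ^+ (m - a) :> R.
    by rewrite -{1}(subnK am) -addnA addnn exprD -mul2n exprM sqrrN !expr1n mulr1.
  have C0 : ('C(m, a)%:R != 0 :> R) by rewrite pnatr_eq0 -lt0n bin_gt0.
  rewrite -E sE tE /x /y [(- t) ^+ _]exprNn; field.
  by rewrite !f0 C0.
rewrite /mexp (cvg_lim _ h) //.
apply/esym; rewrite mulrC -(@nat_esum_cvg R (fun n => expR (- t) * x n)).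
- apply: eq_esum => n _; by rewrite /poisson_weight /x [in RHS]mulrA [RHS]EFinM tpowE.
- by move=> n; rewrite mulr_ge0 ?expR_ge0.
- rewrite (_ : series _ = fun n => expR (- t) * series x n).
    by apply: cvgM; [exact: cvg_cst|exact: cx].
  by apply/funext => n; rewrite /series /= mulr_sumr.
Qed.

End StochasticExponential.

(** * Measures on countable discrete sets and on the path space *)

Section DiscreteMeasures.
Context {R : realType} {M : nat}.
Notation S := (signature M).
Local Open Scope ereal_scope.

Lemma signature_measurable (A : set (borel S)) : measurable A.
Proof. by apply: sub_sigma_algebra; exact: (discrete_open (A : set S)). Qed.

Lemma signature_measurable_fun d (Y : measurableType d) (D : set (borel S)) (f : borel S -> Y) :
  measurable_fun D f.
Proof. by move=> _ B _; exact: signature_measurable. Qed.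

Lemma signature_integral (mu : {measure set (borel S) -> \bar R}) (f : S -> \bar R) :
  (forall x, 0 <= f x) ->
  \int[mu]_x f x = \esum_(x in [set: S]) (mu [set x] * f x).
Proof.
move=> f0; pose F n : set (borel S) := [set x | choice.pickle (x : S) = n].
have tF : trivIset [set: nat] F by move=> i j _ _ [x [<- <-]].
have FT : \bigcup_n F n = [set: borel S].
  by apply/seteqP; split=> // x _; exists (choice.pickle (x : S)).
rewrite -[in LHS]FT ge0_integral_bigcup //; last 2 first.
- by move=> k; exact: signature_measurable.
- exact: signature_measurable_fun.
rewrite -[X in \esum_(x in X) _]FT esum_bigcupT => [||x]; [|exact: tF|by rewrite mule_ge0].
rewrite nneseries_esumT; last by move=> n; exact: integral_ge0.
apply: eq_esum => n _; have [[x Fx]|Fn] := pselect (exists x, F n x).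
  have -> : F n = [set (x : borel S)].
    apply/seteqP; split=> [y Fy|_ -> //].
    by apply: (pcan_inj choice.pickleK); rewrite Fy Fx.
  rewrite esum_set1 ?mule_ge0 // (eq_integral (cst (f x))) => [|y]; last by rewrite inE => ->.
  by rewrite integral_cst; [exact: muleC|exact: signature_measurable].
have -> : F n = set0 by apply/seteqP; split=> // x Fx; apply: Fn; exists x.
by rewrite integral_set0 esum_set0.
Qed.

Lemma signature_measureE (mu : {measure set (borel S) -> \bar R}) (A : set (borel S)) :
  mu A = \esum_(x in (A : set S)) mu [set x].
Proof.
have mA := signature_measurable A.
rewrite -[LHS]mul1e -integral_cst // integral_mkcond signature_integral => [|x]; last first.
  by rewrite patchE; case: ifP.
rewrite [RHS]esum_mkcond; apply: eq_esum => x _; rewrite patchE.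
by case: ifP => _; rewrite ?mule1 ?mule0.
Qed.

Lemma eq_measure_signature (P P' : Mp R S) : (forall x, mass P x = mass P' x) -> Defs.eq_measure P P'.
Proof.
by move=> h A _; rewrite !signature_measureE; apply: eq_esum => x _; exact: h.
Qed.

Lemma signature_mass_sum (P : Mp R S) : \esum_(x in [set: S]) mass P x = 1.
Proof. by rewrite -signature_measureE; exact: probability_setT. Qed.

End DiscreteMeasures.

Section WeightMeasure.
Context {R : realType} {M : nat}.
Notation S := (signature M).
Local Open Scope ereal_scope.
Variable a : S -> \bar R.
Hypothesis a_ge0 : forall x, 0 <= a x.
Hypothesis a_sum : \esum_(x in [set: S]) a x = 1.

Definition weight_measure of (forall x, 0 <= a x) & \esum_(x in [set: S]) a x = 1 :=
  fun A : set (borel S) => \esum_(x in (A : set S)) a x.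
Let W := weight_measure a_ge0 a_sum.

Let W0 : W set0 = 0. Proof. exact: esum_set0. Qed.

Let W_ge0 A : 0 <= W A. Proof. exact: esum_ge0. Qed.

Let W_sigma : semi_sigma_additive W.
Proof.
move=> U mU tU _; rewrite /W /weight_measure esum_bigcupT //.
rewrite -(nneseries_esumT (a := fun i => \esum_(x in U i) a x)) => [|n]; last exact: esum_ge0.
by apply: is_cvg_nneseries => n _ _; exact: esum_ge0.
Qed.

HB.instance Definition _ := isMeasure.Build _ _ R (weight_measure a_ge0 a_sum) W0 W_ge0 W_sigma.

Let WT : W [set: borel S] = 1. Proof. exact: a_sum. Qed.

HB.instance Definition _ := Measure_isProbability.Build _ _ R (weight_measure a_ge0 a_sum) WT.

Definition weight_probability : Mp R S := (weight_measure a_ge0 a_sum : probability (borel S) R).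

Lemma mass_weight_probability x : mass weight_probability x = a x.
Proof. exact: esum_set1. Qed.

End WeightMeasure.

Section PushForward.
Local Open Scope ereal_scope.

Lemma integral_kpush d d' (X : measurableType d) (Y : measurableType d') (R : realType)
    (P : probability X R) (k : R.-pker X ~> Y) (f : Y -> \bar R) :
  (forall y, 0 <= f y) -> measurable_fun [set: Y] f ->
  \int[kpush P k]_y f y = \int[P]_x \int[k x]_y f y.
Proof.
move=> f0 mf.
pose l := kprobability (measurable_cst (P : pprobability X R) : measurable_fun [set: unit] _).
have := @integral_kcomp _ _ _ _ _ _ R l (kernel.kernel_snd (T0 := unit) k) tt f f0 mf.
move=> /= <-; apply: eq_measure_integral => A mA _; by [].
Qed.

Definition dirac_Mp (R : realType) (T : ptopologicalType) (y : T) : Mp R T :=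
  (dirac (y : borel T) : probability (borel T) R).

Lemma pushMp_dirac (R : realType) (T U : ptopologicalType) (y : T)
    (k : R.-pker borel T ~> borel U) (A : set (borel U)) : measurable A ->
  (pushMp (dirac_Mp R y) k : probability (borel U) R) A = k y A.
Proof.
move=> mA; rewrite /= /kpush integral_dirac ?diracT ?mul1e //.
exact: measurable_kernel.
Qed.

End PushForward.

(** * Continuity and measurability in the weak topology *)

Lemma prod_cvg {I T : Type} (K : I -> topologicalType) (F : set_system T) {FF : Filter F}
    (f : T -> prod_topology K) (g : prod_topology K) :
  (forall i, f x i @[x --> F] --> g i) -> f @ F --> g.
Proof.
move=> h; apply/cvg_sup => i U [_ [[B oB <-] Bg] BU].
apply: filterS BU _; apply: (h i); exact: open_nbhs_nbhs.
Qed.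

Lemma prod_continuous {I : Type} {T : topologicalType} (K : I -> topologicalType)
    (f : T -> prod_topology K) : (forall i, continuous (fun x => f x i)) -> continuous f.
Proof. by move=> h x; apply: prod_cvg => i; exact: h. Qed.

Lemma prod_eval_continuous {I : Type} (K : I -> topologicalType) (i : I) :
  continuous (fun f : prod_topology K => f i).
Proof.
move=> f A fA; have /cvg_sup/(_ i) h : f --> f by apply: cvg_id.
exact: h (@initial_continuous _ _ (fun g : (forall i, K i) => g i) f A fA).
Qed.

Section WeakTopology.
Context {R : realType}.

Lemma continuous_Mp (T : topologicalType) (U : ptopologicalType) (f : T -> Mp R U) :
  (forall h, continuous (fun x => expectations (f x) h)) -> continuous f.
Proof.
move=> hf; apply: (@continuous_comp_initial (Mp R U) T _ (@expectations R U) f).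
exact: (@prod_continuous (bounded_continuous R U) T (fun=> R) (@expectations R U \o f)).
Qed.

Lemma continuous_expectation (U : ptopologicalType) (h : bounded_continuous R U) :
  continuous (fun P : Mp R U => expectations P h).
Proof.
have c1 : continuous (@expectations R U : Mp R U -> {ptws bounded_continuous R U -> R}).
  exact: initial_continuous.
move=> P A hA.
exact: (c1 P _ (@prod_eval_continuous (bounded_continuous R U) (fun=> R) h (expectations P) A hA)).
Qed.

Lemma continuous_borel_measurable (T : ptopologicalType) (f : T -> R) : continuous f ->
  measurable_fun [set: borel T] (f : borel T -> R).
Proof.
move=> cf; apply: (measurability _ (RGenOpens.measurableE R)) => _ [_ [a [b ->]] <-];
rewrite setTI; apply: sub_sigma_algebra.
by apply: open_comp; [move=> x _; exact: cf|exact: interval_open].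
Qed.

Lemma expectation_dirac (T : ptopologicalType) (y : T) (h : bounded_continuous R T) :
  expectations (dirac_Mp R y) h = sval h y.
Proof.
rewrite /expectations /Rintegral integral_dirac //; first by rewrite diracT mul1e.
by apply/measurable_EFinP; apply: continuous_borel_measurable; case: (svalP h).
Qed.

Lemma continuous_dirac_Mp (T : ptopologicalType) : continuous (@dirac_Mp R T).
Proof.
apply: continuous_Mp => h; rewrite (_ : (fun x => _) = sval h); last first.
  by apply/funext => x; exact: expectation_dirac.
by case: (svalP h).
Qed.

(** Shifting a bounded function by a bound makes it nonnegative, so that its
    integral becomes an unordered sum. *)
Lemma expectation_signature M (P : Mp R (signature M)) (h : bounded_continuous R (signature M)) (B : R) :
  (forall x, `|sval h x| <= B) ->
  expectations P h = fine (\esum_(x in [set: signature M]) (mass P x * (sval h x + B)%:E)%E) - B.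
Proof.
move=> hB; have h0 x : 0 <= sval h x + B.
  by have := hB x; rewrite ler_norml => /andP[h1 _]; lra.
have B0 : 0 <= B by apply: le_trans (hB point).
rewrite -(signature_integral (P : probability (borel (signature M)) R) (f := fun x => (sval h x + B)%:E)) //.
have fi : (P : probability (borel (signature M)) R).-integrable setT (EFin \o (sval h : borel _ -> R)).
  apply: (@le_integrable _ _ _ _ _ measurableT _ (cst B%:E)).
  - exact: signature_measurable_fun.
  - by move=> x _ /=; rewrite lee_fin (le_trans (hB x)) // ler_norm.
  - by apply: finite_measure_integrable_cst.
rewrite /expectations /Rintegral.
under [in RHS]eq_integral do rewrite EFinD.
rewrite integralD //; last exact: finite_measure_integrable_cst.
rewrite integral_cst // (_ : (B%:E * _ = B%:E)%E); last first.
  by rewrite -[RHS]mule1; congr (_ * _)%E; exact: probability_setT.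
rewrite [in RHS]fineD //; last exact: (integrable_fin_num measurableT fi).
by rewrite addrK.
Qed.

End WeakTopology.

Section PathSpaceKernels.
Context {R : realType}.

Lemma path_cvg (T : Type) (F : set_system T) {FF : Filter F} (z : T -> pathspace) (y : pathspace) :
  (forall i, \forall x \near F, sval (z x) i = sval y i) -> z @ F --> y.
Proof.
move=> h; have hv : (fun x => sval (z x) : {ptws nat -> nat}) @ F --> (sval y : {ptws nat -> nat}).
  apply: (@prod_cvg nat T (fun=> nat)) => i A hA; have Ay := nbhs_singleton hA.
  by apply: filterS (h i) => x /= ->.
move=> U [_ [[B oB <-] By] BU]; apply: filterS BU _; apply: hv.
exact: open_nbhs_nbhs.
Qed.

Lemma path_eval_continuous i : continuous (fun y : pathspace => sval y i).
Proof.
move=> y A hA.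
exact: (@initial_continuous _ _ (set_val : pathspace -> {ptws nat -> nat}) y _
  (@prod_eval_continuous nat (fun=> nat) i (set_val y) A hA)).
Qed.

Definition cylinder n (s : nat -> nat) : set pathspace :=
  [set z | forall i, (i < n)%N -> sval z i = s i].

Lemma cylinder_nbhs n (y : pathspace) : nbhs y (cylinder n (sval y)).
Proof.
elim: n => [|n IH]; first by apply: filterE.
apply: filterS2 IH (@path_eval_continuous n y [set sval y n] _) => [z zn zy i|].
  by rewrite ltnS leq_eqVlt => /predU1P[->|/zn].
exact: discrete_set1.
Qed.

(** Otherwise points outside A would agree with y on longer and longer initial
    segments, hence converge to y. *)
Lemma open_cylinder (A : set pathspace) y : open A -> A y ->
  exists n, cylinder n (sval y) `<=` A.
Proof.
move=> oA Ay; apply/not_existsP => h.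
have /choice[z hz] n : exists z, cylinder n (sval y) z /\ ~ A z.
  by have /existsNP[z /not_implyP] := h n; exists z.
have zy : z @ \oo --> y.
  apply: path_cvg => i; exists i.+1 => // n /= ni.
  by case: (hz n) => + _; apply.
have [n _ /(_ n (leqnn n))] := zy A (open_nbhs_nbhs (conj oA Ay)).
by case: (hz n).
Qed.

Definition cylinders : set (set pathspace) :=
  [set A | A = set0 \/ exists n s, A = cylinder n s].

Lemma cylinders_setI : setI_closed cylinders.
Proof.
move=> A B [->|[n [s ->]]]; first by left; rewrite set0I.
move=> [->|[m [t ->]]]; first by left; rewrite setI0.
have [[z [zs zt]]|h] := pselect (exists z, (cylinder n s `&` cylinder m t) z).
  right; exists (maxn n m), (sval z); apply/seteqP; split => x /=.
    move=> [xs xt] i; rewrite leq_max => /orP[] im; [rewrite xs ?zs|rewrite xt ?zt] => //.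
  by move=> xz; split=> i im; rewrite xz ?leq_max ?im ?orbT //; [exact: zs|exact: zt].
by left; apply/seteqP; split=> // x hx; apply: h; exists x.
Qed.

Lemma cylinder_nbhs_mem n s z : cylinder n s z -> nbhs z (cylinder n s).
Proof.
move=> zs; have := cylinder_nbhs n z; apply: filterS => x xz i im.
by rewrite xz // zs.
Qed.

Lemma cylinder_nbhs_notin n s z : ~ cylinder n s z -> nbhs z (~` cylinder n s).
Proof.
move=> zs; have := cylinder_nbhs n z; apply: filterS => x xz xs; apply: zs => i im.
by rewrite -xz // xs.
Qed.

(** There are countably many cylinders, and every open set is a union of them. *)
Lemma borel_pathspaceE : @measurable _ (borel pathspace) = <<s cylinders >>.
Proof.
apply/seteqP; split; apply: smallest_sub; try exact: smallest_sigma_algebra.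
  move=> A oA; pose F (k : nat) : set pathspace := if choice.unpickle k is Some s then
     let C := cylinder (size s) (nth 0%N s) in if pselect (C `<=` A) then C else set0 else set0.
  have -> : A = \bigcup_k F k.
    apply/seteqP; split=> [y Ay|y [k _]]; last first.
      by rewrite /F; case: choice.unpickle => //= s; case: pselect => // sA /sA.
    have [n hn] := open_cylinder oA Ay.
    exists (choice.pickle (mkseq (sval y) n)) => //; rewrite /F choice.pickleK /= size_mkseq.
    have E : cylinder n (nth 0%N (mkseq (sval y) n)) = cylinder n (sval y).
      by apply/seteqP; split=> z zE i im; rewrite zE ?nth_mkseq.
    by rewrite E; case: pselect.
  apply: (@bigcupT_measurable _ (g_sigma_algebraType cylinders)) => k.
  apply: sub_gen_smallest; rewrite /F; case: choice.unpickle => [s|]; last by left.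
  by case: pselect => _ /=; [right; exists (size s), (nth 0%N s)|left].
move=> A [->|[n [s ->]]]; first exact: measurable0.
apply: sub_gen_smallest; rewrite openE => z; exact: cylinder_nbhs_mem.
Qed.

Lemma cylinder_indic_continuous n s : continuous (\1_(cylinder n s) : pathspace -> R).
Proof.
move=> z; apply: (@cvg_near_cst _ _ _ _ (nbhs z) _); have [zs|zs] := pselect (cylinder n s z).
  have := cylinder_nbhs_mem zs; apply: filterS => x xs.
  by rewrite !indicE !mem_set.
have := cylinder_nbhs_notin zs; apply: filterS => x xs.
by rewrite !indicE !memNset.
Qed.

Lemma indic_bounded T (A : set T) : exists B, forall x, `|\1_A x : R| <= B.
Proof.
by exists 1 => x; rewrite indicE; case: (_ \in _); rewrite ?normr1 ?normr0.
Qed.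

Definition cylinder_function n s : bounded_continuous R pathspace :=
  exist _ _ (conj (@cylinder_indic_continuous n s) (indic_bounded (cylinder n s))).

Lemma expectation_cylinder (P : Mp R pathspace) n s :
  (P : probability (borel pathspace) R) (cylinder n s) = (expectations P (cylinder_function n s))%:E.
Proof.
have mC : measurable (cylinder n s : set (borel pathspace)).
  by apply: sub_gen_smallest; rewrite openE => z; exact: cylinder_nbhs_mem.
rewrite /expectations /Rintegral /=.
rewrite (_ : (\int[_]_x _)%E = (P : probability (borel pathspace) R) (cylinder n s)); last first.
  by rewrite integral_indic // setIT.
rewrite fineK //; exact: fin_num_measure.
Qed.

(** Weak continuity makes the measure of every clopen cylinder measurable in the
    parameter, and the cylinders form a generating pi-system. *)
Lemma measurable_continuous_Mp (Q : pathspace -> Mp R pathspace) : continuous Q ->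
  forall A : set (borel pathspace), measurable A ->
  measurable_fun [set: borel pathspace]
    (fun y : borel pathspace => (Q y : probability (borel pathspace) R) A).
Proof.
move=> cQ A mA; rewrite borel_pathspaceE in mA; move: A mA.
refine (@dynkin_induction _ (borel pathspace) cylinders (fun A => measurable_fun [set: borel pathspace]
    (fun y : borel pathspace => (Q y : probability (borel pathspace) R) A)) _ _ _ _ _ _).
- exact: borel_pathspaceE.
- exact: cylinders_setI.
- rewrite (_ : (fun y => _) = cst 1%E); first exact: measurable_cst.
  by apply/funext => y; exact: probability_setT.
- move=> A [->|[n [s ->]]].
    rewrite (_ : (fun y => _) = cst 0%E); first exact: measurable_cst.
    by apply/funext => y; exact: measure0.
  rewrite (_ : (fun y => _) = EFin \o (fun y => expectations (Q y) (cylinder_function n s))).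
    apply/measurable_EFinP.
    apply: (@continuous_borel_measurable R pathspace
      (fun y => expectations (Q y) (cylinder_function n s))) => y.
    exact: (continuous_comp (cQ y) (@continuous_expectation R _ _ _)).
  by apply/funext => y; exact: expectation_cylinder.
- move=> A mA hA.
  rewrite (_ : (fun y => _) = fun y => (1 - (Q y : probability (borel pathspace) R) A)%E).
    by apply: emeasurable_funB => //; exact: measurable_cst.
  by apply/funext => y; exact: probability_setC.
- move=> F mF tF hF.
  rewrite (_ : (fun y => _) = fun y => (\sum_(n <oo) (Q y : probability (borel pathspace) R) (F n))%E).
    by apply: ge0_emeasurable_sum => *; [exact: measure_ge0|exact: hF].
  apply/funext => y; apply: measure_semi_bigcup => //; exact: bigcupT_measurable.
Qed.

End PathSpaceKernels.

Section ContinuousKernel.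
Context {R : realType} (Q : pathspace -> Mp R pathspace) (cQ : continuous Q).

Definition continuous_kernel of continuous Q :
    borel pathspace -> {measure set (borel pathspace) -> \bar R} :=
  fun y => (Q y : probability (borel pathspace) R).

Let continuous_kernel_measurable A : measurable A ->
  measurable_fun [set: borel pathspace] (continuous_kernel cQ ^~ A).
Proof. by move=> mA; exact: measurable_continuous_Mp. Qed.

HB.instance Definition _ :=
  @isKernel.Build _ _ _ _ R (continuous_kernel cQ) continuous_kernel_measurable.

Let continuous_kernel_prob y : continuous_kernel cQ y [set: borel pathspace] = 1%E.
Proof. exact: probability_setT. Qed.

HB.instance Definition _ :=
  @Kernel_isProbability.Build _ _ _ _ R (continuous_kernel cQ) continuous_kernel_prob.

Definition path_kernel : R.-pker borel pathspace ~> borel pathspace := continuous_kernel cQ.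

End ContinuousKernel.

(** * Lifting commuting semigroups to the boundary *)

Section Boundary.
Context {R : realType}.
Variable Lam : forall N, signature N.+2 -> signature N.+1 -> R.
Variable K : forall N, R.-pker borel pathspace ~> borel (signature N.+1).
Hypothesis hK : is_boundary Lam K.
Hypothesis Lam_ge0 : forall N (lam : signature N.+2) mu, 0 <= Lam lam mu.
Local Open Scope ereal_scope.

Variable P : forall N, R -> signature N.+1 -> signature N.+1 -> \bar R.
Hypothesis P_ge0 : forall N t lam mu, (0 <= t)%R -> 0 <= @P N t lam mu.
Hypothesis P_sum : forall N t lam, (0 <= t)%R -> \esum_(mu in [set: signature N.+1]) @P N t lam mu = 1.
Hypothesis P0 : forall N lam mu, @P N 0%R lam mu = kdelta lam mu.
Hypothesis P_add : forall N s t lam mu, (0 <= s)%R -> (0 <= t)%R ->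
  ecomp (@P N s) (@P N t) lam mu = @P N (s + t)%R lam mu.
Hypothesis P_commute : forall N t lam mu, (0 <= t)%R ->
  ecomp (@P N.+1 t) (fun l m => (Lam l m)%:E) lam mu =
  ecomp (fun l m => (Lam l m)%:E) (@P N t) lam mu.

Let KN N (y : pathspace) (lam : signature N.+1) : \bar R := K N y [set lam].

Let KN_ge0 N y lam : 0 <= @KN N y lam. Proof. exact: measure_ge0. Qed.

Let mass_dirac N y lam : mass (boundary_map K (dirac_Mp R y) N) lam = @KN N y lam.
Proof. by apply: pushMp_dirac; exact: signature_measurable. Qed.

Let KN_sum N y : \esum_(lam in [set: signature N.+1]) @KN N y lam = 1.
Proof.
rewrite -(signature_mass_sum (boundary_map K (dirac_Mp R y) N)).
by apply: eq_esum => lam _; rewrite mass_dirac.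
Qed.

Let KN_coherent N y mu : ecomp (@KN N.+1) (fun l m => (Lam l m)%:E) y mu = @KN N y mu.
Proof.
have [coh _ _ _ _] := hK; rewrite -mass_dirac -(coh (dirac_Mp R y) N mu).
by apply: eq_esum => lam _; rewrite mass_dirac.
Qed.

(** The law on level N after time t, started from the boundary point y. *)
Let law N t y mu := ecomp (@KN N) (@P N t) y mu.

Let law_ge0 N t y mu : (0 <= t)%R -> 0 <= @law N t y mu.
Proof. by move=> t0; apply: ecomp_ge0 => // *; exact: P_ge0. Qed.

Let law_sum N t y : (0 <= t)%R -> \esum_(mu in [set: signature N.+1]) @law N t y mu = 1.
Proof. by move=> t0; apply: ecomp_esum1 => // *; [exact: P_ge0|exact: P_sum]. Qed.

Let law_coherent N t y mu : (0 <= t)%R ->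
  ecomp (@law N.+1 t) (fun l m => (Lam l m)%:E) y mu = @law N t y mu.
Proof.
move=> t0; have L0 l m : 0 <= (@Lam N l m)%:E by rewrite lee_fin.
have Pt0 M l m : 0 <= @P M t l m by exact: P_ge0.
rewrite /law ecompA //; transitivity (ecomp (@KN N.+1) (ecomp (fun l m => (@Lam N l m)%:E) (@P N t)) y mu).
  by apply: eq_esum => lam _; rewrite P_commute.
by rewrite -ecompA //; apply: eq_esum => lam _; rewrite KN_coherent.
Qed.

Let exists_boundary_law t y : (0 <= t)%R -> exists m : Mp R pathspace,
  forall N mu, mass (boundary_map K m N) mu = @law N t y mu.
Proof.
move=> t0; have [_ surj _ _ _] := hK.
pose m N : Mp R (signature N.+1) := weight_probability (fun mu => @law_ge0 N t y mu t0) (@law_sum N t y t0).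
have [N mu|Q hQ] := surj m.
  rewrite mass_weight_probability -law_coherent //.
  by apply: eq_esum => lam _; rewrite mass_weight_probability.
exists Q => N mu; rewrite -(mass_weight_probability (fun mu => @law_ge0 N t y mu t0) (@law_sum N t y t0)).
by apply: hQ; exact: signature_measurable.
Qed.

Let boundary_inj (m m' : Mp R pathspace) :
  (forall N mu, mass (boundary_map K m N) mu = mass (boundary_map K m' N) mu) -> Defs.eq_measure m m'.
Proof. by move=> h; have [_ _ inj _ _] := hK; apply: inj => N; exact: eq_measure_signature. Qed.

Lemma continuous_signature M (h : signature M -> R) : continuous h.
Proof. by apply/continuousP => A _; exact: discrete_open. Qed.

(** The topology of the boundary is the one of the levels, where the evolution
    maps bounded functions to bounded functions: this is the Feller property. *)
Let law_continuous t (Q : pathspace -> Mp R pathspace) : (0 <= t)%R ->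
  (forall y N mu, mass (boundary_map K (Q y) N) mu = @law N t y mu) -> continuous Q.
Proof.
move=> t0 hQ; have [_ _ _ c4 c5] := hK.
suff cb : continuous (fun y => boundary_map K (Q y)).
  move=> y U hU; have [V hV VU] := c5 _ _ hU.
  change (nbhs y (Q @^-1` U)).
  have h : nbhs y ((fun y => boundary_map K (Q y)) @^-1` V) by exact: cb.
  by apply: (filterS _ h) => z; exact: VU.
apply: prod_continuous => N; apply: continuous_Mp => h.
have [B hB] := proj2 (svalP h); have hx x := hB x.
have h0 x : (0 <= sval h x + B)%R by have := hx x; rewrite ler_norml => /andP[h1 _]; lra.
have h2 x : (sval h x + B <= B + B)%R by rewrite lerD2r (le_trans (ler_norm _) (hx x)).
have B0 : (0 <= B)%R by apply: le_trans (hx point).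
have Pt0 l m : 0 <= @P N t l m by exact: P_ge0.
pose G lam := \esum_(mu in [set: signature N.+1]) (@P N t lam mu * (sval h mu + B)%:E).
have G0 lam : 0 <= G lam by apply: esum_ge0 => mu _; rewrite mule_ge0 // lee_fin.
have G2 lam : G lam <= (B + B)%:E.
  rewrite -[leRHS]mule1 -(P_sum lam t0) ge0_esumZl ?lee_fin ?addr_ge0 //.
  by apply: le_esum => mu _; rewrite muleC lee_wpmul2r // lee_fin.
have Gfin lam : G lam \is a fin_num.
  by rewrite ge0_fin_numE // (le_lt_trans (G2 lam)) ?ltry.
pose g lam : R := (fine (G lam) - B)%R.
have gB lam : (`|g lam| <= B)%R.
  have /andP[g0 g2] : (0 <= fine (G lam) <= B + B)%R by rewrite -!lee_fin fineK // G0 G2.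
  by rewrite /g ler_norml; apply/andP; split; lra.
pose gb : bounded_continuous R (signature N.+1) :=
  exist _ g (conj (@continuous_signature _ g) (ex_intro _ B gB)).
have E y : expectations (boundary_map K (Q y) N) h = expectations (boundary_map K (dirac_Mp R y) N) gb.
  rewrite (expectation_signature _ hx) (@expectation_signature _ _ _ gb B) //; congr (fine _ - _)%R.
  transitivity (ecomp (@law N t) (fun mu (_ : unit) => (sval h mu + B)%:E) y tt).
    by apply: eq_esum => mu _; rewrite hQ.
  rewrite ecompA // => [|mu _]; last by rewrite lee_fin.
  apply: eq_esum => lam _; rewrite mass_dirac; congr (_ * _).
  by rewrite /= /g subrK fineK.
rewrite (_ : (fun y => _) = fun y => expectations (boundary_map K (dirac_Mp R y) N) gb); last first.
  by apply/funext => y; exact: E.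
have cc (T U V : topologicalType) (u : T -> U) (v : U -> V) :
    continuous u -> continuous v -> continuous (v \o u).
  by move=> cu cv x; exact: continuous_comp (cu x) (cv _).
have c1 := cc _ _ _ _ _ (@continuous_dirac_Mp R pathspace) c4.
have c2 := cc _ _ _ _ _ c1 (@prod_eval_continuous nat (fun N => Mp R (signature N.+1)) N).
exact: cc _ _ _ _ _ c2 (@continuous_expectation R _ gb).
Qed.

Let integral_KN N (y : pathspace) t mu : (0 <= t)%R ->
  \int[K N y]_lam @P N t lam mu = @law N t y mu.
Proof. by move=> t0; rewrite signature_integral // => lam; exact: P_ge0. Qed.

Let measurable_KN N mu : measurable_fun [set: borel pathspace] (fun x => K N x [set mu]).
Proof. by apply: measurable_kernel; exact: signature_measurable. Qed.

(** A kernel that satisfies the intertwining relation at time t is determined by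
    its laws on the levels. *)
Let mass_kernel (Q : R.-pker borel pathspace ~> borel pathspace) t : (0 <= t)%R ->
  (forall N y mu, \int[Q y]_x K N x [set mu] = \int[K N y]_lam @P N t lam mu) ->
  forall y N mu, mass (boundary_map K (pushMp (dirac_Mp R y) Q) N) mu = @law N t y mu.
Proof.
move=> t0 h y N mu; rewrite -integral_KN // -h; apply: eq_measure_integral => A mA _.
exact: pushMp_dirac.
Qed.

Theorem boundary_semigroup :
  exists Q : R -> R.-pker borel pathspace ~> borel pathspace,
    [/\ markov_semigroup Q,
        forall N t, (0 <= t)%R -> forall y mu,
          \int[Q t y]_x K N x [set mu] = \int[K N y]_lam @P N t lam mu
      & forall Q' : R -> R.-pker borel pathspace ~> borel pathspace,
          (forall N t, (0 <= t)%R -> forall y mu,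
            \int[Q' t y]_x K N x [set mu] = \int[K N y]_lam @P N t lam mu) ->
          forall t, (0 <= t)%R -> forall y (A : set (borel pathspace)), measurable A ->
            Q' t y A = Q t y A].
Proof.
have ex t : (0 <= t)%R -> exists Q : R.-pker borel pathspace ~> borel pathspace,
    forall N y mu, \int[Q y]_x K N x [set mu] = \int[K N y]_lam @P N t lam mu.
  move=> t0; have /choice[q hq] y := @exists_boundary_law t y t0.
  exists (path_kernel (law_continuous t0 hq)) => N y mu.
  by rewrite integral_KN // -hq.
have /choice[Q hQ] t : exists Q : R.-pker borel pathspace ~> borel pathspace, (0 <= t)%R ->
    forall N y mu, \int[Q y]_x K N x [set mu] = \int[K N y]_lam @P N t lam mu.
  have [t0|_] := leP 0%R t; first by have [Q hQ] := ex t t0; exists Q.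
  by have [Q _] := ex 0%R (lexx _); exists Q.
have uniq (Q1 Q2 : R.-pker borel pathspace ~> borel pathspace) t : (0 <= t)%R ->
    (forall N y mu, \int[Q1 y]_x K N x [set mu] = \int[K N y]_lam @P N t lam mu) ->
    (forall N y mu, \int[Q2 y]_x K N x [set mu] = \int[K N y]_lam @P N t lam mu) ->
    forall y (A : set (borel pathspace)), measurable A -> Q1 y A = Q2 y A.
  move=> t0 h1 h2 y A mA; rewrite -!(@pushMp_dirac R pathspace pathspace y) //.
  by apply: boundary_inj mA => N mu; rewrite !(mass_kernel t0).
exists Q; split; last 2 first.
- by move=> N t t0 y mu; apply: hQ.
- move=> Q' hQ' t t0 y A mA; apply: (uniq _ _ t t0) mA => [N z mu|]; last exact: hQ.
  exact: hQ'.
split=> [y A mA|s t s0 t0 y A mA].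
- rewrite -(@pushMp_dirac R pathspace pathspace y) //.
  apply: (boundary_inj (m' := dirac_Mp R y)) mA => N mu.
  rewrite (mass_kernel (lexx 0%R)); last exact: hQ.
  rewrite mass_dirac /law -[RHS](@esum_kdelta _ _ (@KN N y) mu) //.
  by apply: eq_esum => lam _; rewrite P0.
pose m := pushMp (pushMp (dirac_Mp R y) (Q s)) (Q t).
transitivity ((m : probability (borel pathspace) R) A); last first.
  by apply: eq_measure_integral => B mB _; exact: pushMp_dirac.
rewrite -(@pushMp_dirac R pathspace pathspace y) //; apply: boundary_inj mA => N mu.
rewrite (mass_kernel (addr_ge0 s0 t0)); last by apply: hQ; exact: addr_ge0.
have Pt0 l : 0 <= @P N t l mu by exact: P_ge0.
pose m1 : probability (borel pathspace) R := pushMp (dirac_Mp R y) (Q s).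
transitivity (\int[kpush m1 (Q t)]_x K N x [set mu]); last by [].
rewrite integral_kpush //.
under eq_integral do rewrite hQ //.
rewrite -(@integral_kpush _ _ _ _ _ _ (K N)) //; last exact: signature_measurable_fun.
rewrite signature_integral //.
transitivity (ecomp (@law N s) (@P N t) y mu); last first.
  by apply: eq_esum => lam _; rewrite -(mass_kernel s0 (hQ s s0)).
rewrite /law ecompA //; try by move=> *; exact: P_ge0.
by apply: eq_esum => lam _; rewrite P_add.
Qed.

End Boundary.

(** * The semigroup on the boundary *)

Section EntireCase.
Context {R : realType}.
Variables (X : root_type) (q : R) (w : Omega R).
Hypothesis q01 : 0 < q < 1.

Lemma qX_unbounded (b : R) : exists2 i, (0 < i)%N & b < qX X q i.
Proof.
have [q0 q1] := andP q01; have l0 : 0 < - ln q by rewrite oppr_gt0 ln_lt0.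
have [n hn] : exists n : nat, (b *+ 2) / - ln q < n%:R.
  exists (Num.bound `|b *+ 2 / - ln q|).
  exact: le_lt_trans (ler_norm _) (archi_boundP (normr_ge0 _)).
exists n.+1 => //; rewrite /qX ltr_pdivlMr // mulr_natr.
rewrite ltr_pdivrMr // in hn; apply: (lt_le_trans hn).
have c_ge : n%:R <= cX R X n.+1 :> R.
  rewrite /cX ler_pdivlMr // -natrM ler_nat /dbl_c /= muln2 leq_addr //.
apply: (@le_trans _ _ (q `^ (- cX R X n.+1))); last by rewrite lerDr powR_ge0.
rewrite /powR gt_eqF // mulNr -mulrN.
apply: (le_trans _ (expR_ge1Dx _)); rewrite -[leLHS]add0r lerD // ler_wpM2r //.
exact: ltW.
Qed.

(** The points q^X_i are unbounded, so that the Taylor series of Phi represents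
    it on the complement of a disc, where a pole 1 + 1/alpha would be visible. *)
Lemma taylor_annulus_alpha_eq0 : taylor_annulus X q w -> forall i, alpha w i = 0.
Proof.
move=> [r [rho [r0 hr h]]].
apply: (@entire_alpha_eq0 R w r (taylor_coef w)) => x rx.
apply: h => //; case: rho hr => [b| |] hr; last 2 first.
- exact: ltry.
- by have [_] := hr 1%N isT.
have [i i0 bi] := qX_unbounded b; have [_] := hr i i0.
by rewrite lte_fin ltNge (ltW bi).
Qed.

End EntireCase.

Theorem corollary6p1 (R : realType) (q : R) (X : root_type) (w : Omega R)
    (hq : 0 < q < 1)
    (Lam : forall N, signature N.+2 -> signature N.+1 -> R)
    (hLam : is_link X q Lam)
    (K : forall N, R.-pker borel pathspace ~> borel (signature N.+1))
    (hK : is_boundary Lam K)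
    (hPsi : forall i, (0 < i)%N -> 0 < Psi w (qcX X q i))
    (hPhi : taylor_annulus X q w) :
  let L := fun N => @generator R X q w N.+1 in
  exists Q : R -> R.-pker borel pathspace ~> borel pathspace,
    [/\ markov_semigroup Q,
        intertwines K L Q
      & forall Q' : R -> R.-pker borel pathspace ~> borel pathspace,
          markov_semigroup Q' -> intertwines K L Q' ->
          forall t, 0 <= t ->
          forall y (A : set (borel pathspace)), measurable A ->
            Q' t y A = Q t y A].
Proof.
move=> L; have alpha0 := taylor_annulus_alpha_eq0 hq hPhi.
pose T N (lam mu : signature N.+1) := jump_transition X q w lam mu.
pose kT N (lam mu : signature N.+1) : \bar R := (T N lam mu)%:E.
have T0 N lam mu : 0 <= T N lam mu by exact: jump_transition_ge0.
have kT0 N lam mu : (0 <= kT N lam mu)%E by rewrite lee_fin.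
have kT1 N lam : (\esum_(mu in [set: signature N.+1]) kT N lam mu = 1)%E.
  exact: jump_transition_esum.
have Lam0 N (lam : signature N.+2) mu : 0 <= Lam N lam mu by case: (hLam N lam).
have LE N : L N = fun lam mu => T N lam mu - (lam == mu)%:R.
  by apply/funext => lam; apply/funext => mu; exact: generatorE.
have expE N t lam mu : 0 <= t -> (mexp (L N) t lam mu)%:E = poisson_mixture (kT N) t lam mu.
  by move=> t0; rewrite LE mexp_poisson // => i; exact: kT1.
have [|||||Q [hQ iQ uQ]] := @boundary_semigroup R Lam K hK Lam0 (fun N => poisson_mixture (kT N)).
- by move=> N t lam mu t0; exact: poisson_mixture_ge0.
- by move=> N t lam t0; exact: poisson_mixture_esum1.
- by move=> N lam mu; exact: poisson_mixture0.
- by move=> N s t lam mu s0 t0; exact: poisson_mixture_add.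
- move=> N t lam mu t0; apply: poisson_mixture_commute => //.
    by move=> i j; rewrite lee_fin.
  by move=> i j; rewrite /ecomp; under eq_esum do rewrite -EFinM;
     under [RHS]eq_esum do rewrite -EFinM; exact: (jump_commutation hq alpha0 hLam).
have intE Q' : intertwines K L Q' <-> forall N t, 0 <= t -> forall y mu,
    (\int[Q' t y]_x K N x [set mu] = \int[K N y]_lam poisson_mixture (kT N) t lam mu)%E.
  split=> h N t t0 y mu; rewrite h //.
    by apply: eq_integral => lam _; rewrite expE.
  by apply: eq_integral => lam _; rewrite expE.
exists Q; split=> //; first exact/intE.
by move=> Q' _ /intE hQ' t t0 y A mA; exact: uQ.
Qed.
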